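(* Let $(b_n)_{n\in\mathbb{N}}$ be an interpolating sequence in $\mathbb{D}$ with interpolation constant $M$, and let $(\beta_n)_{n\in\mathbb{N}}$ be a sequence of functions in $H^\infty$ such that (i) $\beta_k(b_j)=\delta_{k,j}$ for all $j,k\in\mathbb{N}$, and (ii) $\sup_{z\in\mathbb{D}}\sum_{n\in\mathbb{N}}|\beta_n(z)|\le M$. Then the linear mapping $T:c=(c_n)_{n\in\mathbb{N}}\mapsto T(c)=\sum_{n\in\mathbb{N}}c_n\beta_n$ implements a weak*- and norm-homeomorphism between $\ell^\infty$ and $\mathcal{E}=T(\ell^\infty)$, with inverse $\mathcal{J}|_{\mathcal{E}}$, such that $\|T\|\le M$ and $\|T^{-1}\|\le1$. Moreover the sequence $(E_{b_n})_n$ is an $\ell^1$-basis for $\mathcal{Q}_{\mathcal{E}}$, and $(\beta_n)_n$ is an $\ell^\infty$-basis for $\mathcal{E}$.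
   Context: $\mathbb{D}$ is the open unit disk, $\mathbb{T}$ the unit circle. $H^\infty$ is the space of bounded analytic functions on $\mathbb{D}$ with sup norm, the dual of $L^1/H^1_0$ under $\langle[f],h\rangle=\int_{\mathbb{T}}fh\,dm$ ($m$ normalized Lebesgue measure on $\mathbb{T}$, $L^1=L^1(m)$, $H^1_0$ the functions in the Hardy space $H^1$ vanishing at $0$); this defines the weak* topology of $H^\infty$. $\ell^\infty$ has the weak* topology as dual of $\ell^1$. A sequence $(b_n)_n$ in $\mathbb{D}$ is interpolating if the map $\mathcal{J}:H^\infty\to\ell^\infty$, $\mathcal{J}(h)=(h(b_n))_n$, is onto; its interpolation constant is the least $M$ such that every $c\in\ell^\infty$ equals $\mathcal{J}(h)$ for some $h\in H^\infty$ with $\|h\|_\infty\le M\|c\|_\infty$. For a weak*-closed subspace $\mathcal{E}$ of $H^\infty$, $\mathcal{Q}_{\mathcal{E}}$ denotes its predual, i.e. the quotient of $L^1/H^1_0$ by the preannihilator of $\mathcal{E}$ (the weak*-continuous functionals on $\mathcal{E}$). For $\lambda\in\mathbb{D}$, $E_\lambda$ denotes the evaluation functional $h\mapsto h(\lambda)$, which is weak*-continuous, regarded as an element of $\mathcal{Q}_{\mathcal{E}}$. The existence of $\mathcal{Q}_{\mathcal{E}}$ includes the assertion that $\mathcal{E}$ is weak*-closed. A sequence $(x_n)_n$ in a Banach space $X$ is an $\ell^1$-basis if there is a Banach space isomorphism from $\ell^1$ onto $X$ sending the canonical unit vector $\epsilon_n$ to $x_n$ for all $n$. A sequence $(x_n)_n$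 in a dual space $X$ is an $\ell^\infty$-basis if there is a linear weak*-homeomorphism from $\ell^\infty$ onto $X$ sending $\epsilon_n$ to $x_n$ for all $n$. *)

(* Defs.v *)
From HB Require Import structures.
From mathcomp Require Import all_boot all_order all_algebra complex.
From mathcomp Require Import all_classical all_reals all_analysis.

Set Implicit Arguments.
Unset Strict Implicit.
Unset Printing Implicit Defensive.
Import Order.TTheory GRing.Theory Num.Theory.
Import numFieldNormedType.Exports.

Local Open Scope classical_set_scope.
Local Open Scope ring_scope.
Local Open Scope complex_scope.

HB.instance Definition _ (R : rcfType) := NormedModule.copy R[i] R[i]^o.

(* The real-valued modulus; the library's `|z| is (normc z)%:C. *)
Notation normc := ComplexField.Normc.normc.

Lemma normc_ge0 (R : rcfType) (z : R[i]) : 0 <= normc z.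
Proof. by case: z => a b; exact: sqrtr_ge0. Qed.

Section BoundedFunctions.
Variables (R : realType) (X : Type).
Implicit Types f g : X -> R[i].

Definition bounded_pred : {pred X -> R[i]} :=
  fun f => `[< exists M : R, forall x, normc (f x) <= M >].

Lemma bounded_submod_closed : submod_closed bounded_pred.
Proof.
split; first by apply/asboolP; exists 0 => x; rewrite ComplexField.Normc.normc0.
move=> a f g /asboolP[M fM] /asboolP[N gN]; apply/asboolP.
exists (normc a * M + normc (N%:C)) => x.
apply: le_trans (le_normcD _ _) _; apply: lerD.
  rewrite ComplexField.Normc.normcM ler_wpM2l//.
  by rewrite /normc; case: (a) => ? ?; rewrite sqrtr_ge0.
apply: le_trans (gN x) _.
by rewrite /normc/= expr0n/= addr0 sqrtr_sqr ler_norm.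
Qed.

HB.instance Definition _ :=
  GRing.isSubmodClosed.Build _ _ bounded_pred bounded_submod_closed.

Record bfun := BFun { bfun_fun :> X -> R[i]; _ : bfun_fun \in bounded_pred }.

HB.instance Definition _ := [isSub for bfun_fun].
HB.instance Definition _ := [Choice of bfun by <:].
HB.instance Definition _ := [SubChoice_isSubLmodule of bfun by <:].

Definition supnorm (f : bfun) : R := sup (range (fun x => normc (f x))).

Lemma bfun_has_ubound (f : bfun) : has_ubound (range (fun x => normc (f x))).
Proof.
by have /asboolP[M fM] := valP f; exists M => _ [x _ <-]; exact: fM.
Qed.

Lemma le_supnorm (f : bfun) x : normc (f x) <= supnorm f.
Proof. by apply: ub_le_sup; [exact: bfun_has_ubound|exists x]. Qed.

Lemma supnorm_le (f : bfun) M :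
  0 <= M -> (forall x, normc (f x) <= M) -> supnorm f <= M.
Proof.
move=> M0 fM; have [[x]|/set0P/negP/negPn/eqP S0] :=
  pselect (range (fun x => normc (f x)) !=set0).
  by move=> fx; apply: ge_sup; [exists x|move=> _ [y _ <-]; exact: fM].
by rewrite /supnorm S0 sup0.
Qed.

Lemma supnorm_ge0 (f : bfun) : 0 <= supnorm f.
Proof.
have [[_ [x _ _]]|/set0P/negP/negPn/eqP S0] :=
  pselect (range (fun x => normc (f x)) !=set0).
  by apply: le_trans (le_supnorm f x); exact: normc_ge0.
by rewrite /supnorm S0 sup0.
Qed.

Lemma supnormD (f g : bfun) :
  (supnorm (f + g))%:C <= (supnorm f)%:C + (supnorm g)%:C.
Proof.
rewrite -rmorphD lecR supnorm_le ?addr_ge0 ?supnorm_ge0// => x.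
by apply: le_trans (le_normcD _ _) _; rewrite lerD ?le_supnorm.
Qed.

Lemma supnormZ (a : R[i]) (f : bfun) :
  (supnorm (a *: f))%:C = `|a| * (supnorm f)%:C.
Proof.
have le (b : R[i]) (g : bfun) : supnorm (b *: g) <= normc b * supnorm g.
  apply: supnorm_le => [|x]; first by rewrite mulr_ge0 ?supnorm_ge0 ?normc_ge0.
  by rewrite ComplexField.Normc.normcM ler_wpM2l ?normc_ge0 ?le_supnorm.
suff -> : supnorm (a *: f) = normc a * supnorm f by rewrite rmorphM.
apply/eqP; rewrite eq_le le /=; have [->|a0] := eqVneq a 0.
  by rewrite ComplexField.Normc.normc0 mul0r supnorm_ge0.
have na0 : 0 < normc a.
  rewrite lt_neqAle normc_ge0 andbT eq_sym; apply: contra a0.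
  by move=> /eqP/ComplexField.Normc.eq0_normc ->.
rewrite -ler_pdivlMl// -ComplexField.Normc.normcV.
by have := le a^-1 (a *: f); rewrite scalerA mulVf// scale1r.
Qed.

Lemma supnorm_eq0 (f : bfun) : (supnorm f)%:C = 0 -> f = 0.
Proof.
move=> [f0]; apply/val_inj/funext => x /=.
apply: ComplexField.Normc.eq0_normc; apply/eqP.
by rewrite eq_le normc_ge0 andbT -f0 le_supnorm.
Qed.

HB.instance Definition _ :=
  Lmodule_isNormed.Build R[i] bfun supnormD supnormZ supnorm_eq0.
End BoundedFunctions.

Notation linf R := (bfun R nat).

Section Summable.
Variable R : realType.
Implicit Types a c : nat -> R[i].

Definition summable_pred : {pred nat -> R[i]} :=
  fun a => `[< cvgn (series (fun n => normc (a n))) >].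

Lemma summable_submod_closed : submod_closed summable_pred.
Proof.
split.
  apply/asboolP; rewrite (_ : (fun n => _) = cst 0).
    by rewrite /series; under eq_fun do rewrite big1//; exact: is_cvg_cst.
  by apply/funext => n; rewrite ComplexField.Normc.normc0.
move=> k a c /asboolP sa /asboolP sc; apply/asboolP.
have := is_cvg_seriesD (is_cvg_seriesZ (k := normc k) sa) sc.
apply: series_le_cvg => n; rewrite ?normc_ge0//.
  by rewrite addr_ge0 ?mulr_ge0 ?normc_ge0.
by rewrite (le_trans (le_normcD _ _))// ComplexField.Normc.normcM.
Qed.

HB.instance Definition _ :=
  GRing.isSubmodClosed.Build _ _ summable_pred summable_submod_closed.

Record l1 := L1Seq { l1_fun :> nat -> R[i]; _ : l1_fun \in summable_pred }.

HB.instance Definition _ := [isSub for l1_fun].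
HB.instance Definition _ := [Choice of l1 by <:].
HB.instance Definition _ := [SubChoice_isSubLmodule of l1 by <:].

Definition l1norm (a : l1) : R := limn (series (fun n => normc (a n))).

Lemma l1_summable (a : l1) : cvgn (series (fun n => normc (a n))).
Proof. by have /asboolP := valP a. Qed.

Lemma l1normD (a c : l1) : (l1norm (a + c))%:C <= (l1norm a)%:C + (l1norm c)%:C.
Proof.
rewrite -rmorphD lecR /l1norm -lim_seriesD; try exact: l1_summable.
apply: lim_series_le; first exact: l1_summable.
  by apply: is_cvg_seriesD; exact: l1_summable.
by move=> n; exact: le_normcD.
Qed.

Lemma l1normZ (k : R[i]) (a : l1) : (l1norm (k *: a))%:C = `|k| * (l1norm a)%:C.
Proof.
suff -> : l1norm (k *: a) = normc k * l1norm a by rewrite rmorphM.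
rewrite /l1norm -[RHS](lim_seriesZ _ (@l1_summable a)); congr (limn (series _)).
by apply/funext => n; rewrite ComplexField.Normc.normcM.
Qed.

Lemma l1norm_eq0 (a : l1) : (l1norm a)%:C = 0 -> a = 0.
Proof.
move=> [a0]; apply/val_inj/funext => n /=.
apply: ComplexField.Normc.eq0_normc; apply/eqP.
rewrite eq_le normc_ge0 andbT -a0.
have : series (fun n => normc (a n)) n.+1 <= l1norm a.
  apply: nondecreasing_cvgn_le (@l1_summable a) _.
  by apply: nondecreasing_series => k _ _; exact: normc_ge0.
apply: le_trans; rewrite seriesEord/= big_ord_recr/= lerDr sumr_ge0// => k _.
exact: normc_ge0.
Qed.

HB.instance Definition _ :=
  Lmodule_isNormed.Build R[i] l1 l1normD l1normZ l1norm_eq0.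

End Summable.

Section SequenceUnits.
Variable R : realType.

Definition unit_seq (k n : nat) : R[i] := (n == k)%:R.

Lemma unit_seq_summable k : unit_seq k \in @summable_pred R.
Proof.
apply/asboolP; rewrite -(is_cvg_series_restrict k.+1).
apply: (is_cvg_near_cst 0); apply: nearW => m /=.
rewrite big_nat big1// => i /andP[ki _].
by rewrite /unit_seq gtn_eqF// ComplexField.Normc.normc0.
Qed.

Lemma unit_seq_bounded k : unit_seq k \in @bounded_pred R nat.
Proof.
apply/asboolP; exists 1 => n; rewrite /unit_seq.
by case: eqP; rewrite ?ComplexField.Normc.normc0 ?ComplexField.Normc.normc1.
Qed.

Definition l1_unit k : l1 R := L1Seq (unit_seq_summable k).
Definition linf_unit k : linf R := BFun (unit_seq_bounded k).
End SequenceUnits.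

Section Hardy.
Variable R : realType.

Definition disk : set R[i] := [set z | `|z| < 1].
Definition circle : set R[i] := [set z | `|z| = 1].

Definition analytic_pred : {pred bfun R disk} :=
  fun h => `[< forall z0 : disk, exists (a : nat -> R[i]) (r : R), 0 < r /\
    forall z : disk, normc (val z - val z0) < r ->
      series (fun n => a n * (val z - val z0) ^+ n) @ \oo --> h z >].

Lemma analytic_submod_closed : submod_closed analytic_pred.
Proof.
split.
  apply/asboolP => z0; exists (fun=> 0), 1; split=> // z _.
  apply: cvg_near_cst; apply: nearW => n.
  by rewrite /series/= big1// => i _; rewrite mul0r.
move=> k f g /asboolP fa /asboolP ga; apply/asboolP => z0.
have [a [r [r0 ar]]] := fa z0; have [c [s [s0 cs]]] := ga z0.
exists (fun n => k * a n + c n), (Num.min r s).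
split=> [|z]; first by rewrite lt_min r0 s0.
rewrite lt_min => /andP[/ar az /cs cz].
rewrite (_ : series _ =
    fun n => k * series (fun m => a m * (val z - val z0) ^+ m) n +
             series (fun m => c m * (val z - val z0) ^+ m) n).
  have kaz : (fun n => k * series (fun m => a m * (val z - val z0) ^+ m) n)
      @ \oo --> k * f z by exact: (cvgZl_tmp (k := k) az).
  exact: cvgD kaz cz.
apply/funext => n; rewrite /series/= mulr_sumr -big_split/=.
by apply: eq_bigr => i _; rewrite mulrDl mulrA.
Qed.

HB.instance Definition _ :=
  GRing.isSubmodClosed.Build _ _ analytic_pred analytic_submod_closed.

Record Hinf := HinfFun {
  hinf_fun :> bfun R disk; _ : hinf_fun \in analytic_pred }.

HB.instance Definition _ := [isSub for hinf_fun].
HB.instance Definition _ := [Choice of Hinf by <:].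
HB.instance Definition _ := [SubChoice_isSubLmodule of Hinf by <:].

Definition hinf_norm (h : Hinf) : R[i] := `|hinf_fun h|.

Lemma hinf_normD (h k : Hinf) : hinf_norm (h + k) <= hinf_norm h + hinf_norm k.
Proof. exact: ler_normD. Qed.

Lemma hinf_normZ (a : R[i]) (h : Hinf) : hinf_norm (a *: h) = `|a| * hinf_norm h.
Proof. exact: normrZ. Qed.

Lemma hinf_norm_eq0 (h : Hinf) : hinf_norm h = 0 -> h = 0.
Proof. by move=> /normr0_eq0 h0; exact: val_inj. Qed.

HB.instance Definition _ :=
  Lmodule_isNormed.Build R[i] Hinf hinf_normD hinf_normZ hinf_norm_eq0.

Lemma expi_subproof (t : R) : cos t +i* sin t \in circle.
Proof. by apply/mem_set; rewrite /circle/= normc_def/= cos2Dsin2 sqrtr1. Qed.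

Definition expi (t : R) : circle := SigSub (expi_subproof t).

(* Integration against normalized arc length, in the parametrization [expi] of
   the circle by [0, 2 pi]. *)
Definition mean (g : circle -> R) : R :=
  (2 * pi)^-1 * \int[lebesgue_measure]_(t in `[0, 2 * pi]) g (expi t).

Definition cmean (f : circle -> R[i]) : R[i] :=
  mean (fun x => complex.Re (f x)) +i* mean (fun x => complex.Im (f x)).

(* Functions, not classes up to a.e. equality; classes only appear through the
   functionals the functions induce. *)
Definition L1 : set (circle -> R[i]) := [set f |
  lebesgue_measure.-integrable `[0, 2 * pi]
    (fun t => (complex.Re (f (expi t)))%:E) /\
  lebesgue_measure.-integrable `[0, 2 * pi]
    (fun t => (complex.Im (f (expi t)))%:E)].

Definition L1norm (f : circle -> R[i]) : R := mean (fun x => normc (f x)).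

Definition fourier (f : circle -> R[i]) (n : int) : R[i] :=
  cmean (fun x => f x * val x ^ (- n)).

Definition H1 : set (circle -> R[i]) :=
  [set f | L1 f /\ forall n : int, n < 0 -> fourier f n = 0].

(* [fourier f 0] is the value at 0 of the analytic extension of [f]. *)
Definition H10 : set (circle -> R[i]) := [set f | H1 f /\ fourier f 0 = 0].

(* Radial boundary values, which exist a.e. for bounded analytic functions
   (Fatou); [lim] is an arbitrary value on the remaining null set. *)
Definition boundary (h : disk -> R[i]) (x : circle) : R[i] :=
  lim ('valL_0 h (r%:C * val x) @[r --> 1^'-]).

Definition pairing (f : circle -> R[i]) (h : Hinf) : R[i] :=
  cmean (fun x => f x * boundary h x).

Definition Hinf_wstar := initial_topology
  (fun h : Hinf => (fun f : L1 => pairing (val f) h) : {ptws L1 -> R[i]}).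

Definition linf_wstar := initial_topology
  (fun c : linf R => (fun a : l1 R => limn (series (fun n => a n * c n)))
                       : {ptws l1 R -> R[i]}).

(* Two elements of L^1/H^1_0 agree modulo the preannihilator of [E] exactly when
   they induce the same functional on [E]: the cosets are represented by these
   functionals. *)
Definition predual (E : set Hinf) : set (E -> R[i]) :=
  [set phi | exists2 f, L1 f & forall h, phi h = pairing f (val h)].

Definition L1H10_norm (f : circle -> R[i]) : R :=
  inf [set L1norm (f + g) | g in H10].

(* The quotient norm: the infimum runs over the coset represented by [phi]. *)
Definition predual_norm (E : set Hinf) (phi : E -> R[i]) : R :=
  inf [set L1H10_norm f |
    f in [set f | L1 f /\ forall h, phi h = pairing f (val h)]].

Definition evaluation (E : set Hinf) (z : disk) : E -> R[i] :=
  fun h => (val h : Hinf) z.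

Lemma restr_subproof (b : nat -> disk) (h : Hinf) :
  (fun n => h (b n)) \in @bounded_pred R nat.
Proof.
have /asboolP[M hM] := valP (hinf_fun h).
by apply/asboolP; exists M => n; exact: hM.
Qed.

Definition restr (b : nat -> disk) (h : Hinf) : linf R :=
  BFun (restr_subproof b h).

Definition interpolating (b : nat -> disk) : Prop :=
  forall c : linf R, exists h : Hinf, restr b h = c.

Definition interpolation_bound (b : nat -> disk) (M : R) : Prop :=
  forall c : linf R, exists2 h : Hinf, restr b h = c & `|h| <= M%:C * `|c|.

Definition interpolation_constant (b : nat -> disk) (M : R) : Prop :=
  interpolation_bound b M /\ forall M', interpolation_bound b M' -> M <= M'.
End Hardy.

Arguments disk : clear implicits.
Arguments circle : clear implicits.
Arguments predual {R} E.
Arguments predual_norm {R} E phi.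
Arguments evaluation {R} E z.

(* [f] is a homeomorphism onto the subspace [E], with inverse [g] on [E]. *)
Definition homeo_onto (U V : topologicalType) (f : U -> V) (E : set V)
    (g : V -> U) : Prop :=
  [/\ continuous f, range f = E, cancel f g & {within E, continuous g}].

(* The Banach space is the set [S] with the norm [N]. *)
Definition l1_basis (R : realType) (V : lmodType R[i]) (S : set V) (N : V -> R)
    (x : nat -> V) : Prop :=
  exists Phi : {linear l1 R -> V},
    [/\ injective Phi,
        range Phi = S,
        (exists A : R, forall a, (N (Phi a))%:C <= A%:C * `|a|),
        (exists B : R, forall a, `|a| <= (B * N (Phi a))%:C) &
        forall n, Phi (l1_unit R n) = x n].

(* The weak* topology of [E], as the dual of [predual E], is the restriction of
   that of H^oo: both are given by the functionals in [predual E]. *)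
Definition linf_basis (R : realType) (E : set (Hinf R)) (x : nat -> Hinf R)
    : Prop :=
  exists (S : {linear linf R -> Hinf R}) (g : Hinf R -> linf R),
    @homeo_onto (linf_wstar R) (Hinf_wstar R) S E g /\
    forall n, S (linf_unit R n) = x n.

(* Main.v *)
(* Every h in H^oo is the Poisson and Cauchy integral of a bounded function u on
   the circle, which by Fatou's theorem is its radial boundary function.  If u_n
   belongs to beta_n, then sum |u_n| <= M a.e., so g = sum c_n u_n is bounded; its
   Cauchy integral is analytic, equals Tc = sum c_n beta_n, and g is the boundary
   function of Tc.  By dominated convergence every f in L^1 satisfies
   <f, Tc> = sum c_n <f, beta_n> with sum |<f, beta_n>| <= M ||f||_1; hence T is
   weak*-continuous, and its predual map sends f to (<f, beta_n>)_n.  Conversely,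
   for a in l^1 the function f = sum a_n P_(b_n) of L^1-norm at most ||a||_1, where
   P_z is the Poisson kernel, satisfies <f, h> = sum a_n h(b_n) for all h in H^oo;
   hence J is weak*-continuous.  Since J T = id, the range E is the set where
   T J h = h, which is weak*-closed, and the two estimates give the l^1-basis. *)

(* Analyticity is given only through local power series, so Cauchy's formula has to be proved from
   them. Along the segments from w to the circle of radius r, a weighted mean of F is followed; the
   first-order part of its increment is a multiple of the difference between a function and its
   rotation, which has mean zero, so the increment is quadratic and the mean is constant. Neither a
   derivative of F nor a contour integral occurs. The pairing is defined through radial limits, so a
   function with the right Fourier coefficients is not enough. Such a u is found as an a.e. limit of
   a sequence of dilations; full radial convergence is then obtained from its Poisson integral at
   Lebesgue points. The same argument serves for sum c_n u_n, of which only the Cauchy and Poisson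
   integrals are known at first. Measurability is Borel measurability in the parameter of the
   circle, which is lost on null sets. Radial limits and a.e. sums are therefore either compared
   under integrals without measurability or replaced by measurable representatives. *)
Require Import Defs.
From HB Require Import structures.
From mathcomp Require Import all_boot all_order all_algebra complex.
From mathcomp Require Import all_classical all_reals all_analysis.
From mathcomp Require Import measurable_realfun ring lra.

Set Implicit Arguments.
Unset Strict Implicit.
Unset Printing Implicit Defensive.
Import Order.TTheory GRing.Theory Num.Theory.
Import numFieldNormedType.Exports.

Local Open Scope classical_set_scope.
Local Open Scope ring_scope.
Local Open Scope complex_scope.

(** * Moduli, convergence and series of complex numbers *)

Section ComplexBasics.
Variable R : realType.
Implicit Types z w : R[i].

Lemma normcN z : normc (- z) = normc z.
Proof. by case: z => a b /=; rewrite !sqrrN. Qed.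

Lemma normcB z w : normc (z - w) = normc (w - z).
Proof. by rewrite -normcN opprB. Qed.

Lemma normcX z n : normc (z ^+ n) = normc z ^+ n.
Proof.
elim: n => [|n IH]; first by rewrite !expr0 ComplexField.Normc.normc1.
by rewrite !exprS ComplexField.Normc.normcM IH.
Qed.

Lemma normc_real (x : R) : normc x%:C = `|x|.
Proof. by rewrite /= expr0n addr0 sqrtr_sqr. Qed.

Lemma normc_eq0 z : (normc z == 0) = (z == 0).
Proof.
apply/eqP/eqP => [/ComplexField.Normc.eq0_normc//|->].
by rewrite ComplexField.Normc.normc0.
Qed.

Lemma normc_gt0 z : (0 < normc z) = (z != 0).
Proof. by rewrite lt_neqAle normc_ge0 andbT eq_sym normc_eq0. Qed.

Lemma le_Re_normc z : `|complex.Re z| <= normc z.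
Proof.
by case: z => a b /=; rewrite -sqrtr_sqr ler_wsqrtr// lerDl sqr_ge0.
Qed.

Lemma le_Im_normc z : `|complex.Im z| <= normc z.
Proof.
by case: z => a b /=; rewrite -sqrtr_sqr ler_wsqrtr// lerDr sqr_ge0.
Qed.

Lemma le_normc_ReIm z : normc z <= `|complex.Re z| + `|complex.Im z|.
Proof.
case: z => a b /=.
rewrite -[leRHS]ger0_norm ?addr_ge0// -sqrtr_sqr ler_wsqrtr//.
rewrite sqrrD !real_normK ?num_real// lerD2r lerDl.
by rewrite mulrn_wge0// mulr_ge0.
Qed.

Lemma normc_conj z : normc z^*%C = normc z.
Proof. by case: z => a b /=; rewrite sqrrN. Qed.

Lemma normc_sqr z : normc z ^+ 2 = complex.Re (z * z^*%C).
Proof. by case: z => a b /=; rewrite sqr_sqrtr ?addr_ge0 ?sqr_ge0//; ring. Qed.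

Lemma cvgcP (T : Type) (F : set_system T) {FF : Filter F} (f : T -> R[i]) l :
  (f @ F --> l) <-> ((fun x => normc (f x - l)) @ F --> (0 : R)).
Proof.
split=> [/cvgrPdist_lt fl|/cvgrPdist_lt fl].
  apply/cvgrPdist_lt => e e0.
  have /fl : (0 : R[i]) < e%:C by rewrite ltcR.
  apply: filterS => x h; rewrite sub0r normrN ger0_norm ?normc_ge0//.
  by rewrite normcB -ltcR; exact: h.
apply/cvgrPdist_lt => e e0.
(* In the order of [R[i]] a positive element is real, so complex radii are real radii. *)
have [r er] : exists r : R, e = r%:C.
  by exists (complex.Re e); case: e e0 => a b /=; rewrite ltcE/= => /andP[/eqP -> _].
move: e0; rewrite er ltcR => r0; have := fl _ r0.
apply: filterS => x; rewrite sub0r normrN ger0_norm ?normc_ge0// normcB.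
by rewrite -ltcR.
Qed.

Lemma cvg_ReIm (T : Type) (F : set_system T) {FF : Filter F} (f : T -> R[i]) l :
  (f @ F --> l) <-> ((fun x => complex.Re (f x)) @ F --> complex.Re l) /\
    ((fun x => complex.Im (f x)) @ F --> complex.Im l).
Proof.
split=> [/cvgcP fl|[/cvgrPdist_lt fr /cvgrPdist_lt fi]].
  split; apply/cvgrPdist_lt => e e0; move/cvgrPdist_lt : fl => /(_ _ e0);
    apply: filterS => x; rewrite sub0r normrN ger0_norm ?normc_ge0// distrC;
    apply: le_lt_trans.
    by have := le_Re_normc (f x - l); case: (f x) (l) => [a b] [c d].
  by have := le_Im_normc (f x - l); case: (f x) (l) => [a b] [c d].
apply/cvgcP/cvgrPdist_lt => e e0.
have e20 : 0 < e / 2 by rewrite divr_gt0.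
move: (fr _ e20) (fi _ e20); apply: filterS2 => x fr1 fi1.
rewrite sub0r normrN ger0_norm ?normc_ge0//.
apply: (le_lt_trans (le_normc_ReIm _)); rewrite [e]splitr ltrD//.
  by move: fr1; rewrite distrC; case: (f x) (l) => [a b] [c d].
by move: fi1; rewrite distrC; case: (f x) (l) => [a b] [c d].
Qed.

Lemma cvgc_norm (T : Type) (F : set_system T) {FF : Filter F} (f : T -> R[i]) l :
  f @ F --> l -> (fun x => normc (f x)) @ F --> normc l.
Proof.
move=> /cvgcP/cvgrPdist_lt fl; apply/cvgrPdist_lt => e /fl; apply: filterS => x.
rewrite sub0r normrN ger0_norm ?normc_ge0//; apply: le_lt_trans.
rewrite ler_norml; apply/andP; split.
  rewrite lerBrDr addrC lerBlDr addrC.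
  by have := le_normcD (f x - l) l; rewrite subrK.
rewrite lerBlDr normcB.
by have := le_normcD (l - f x) (f x); rewrite subrK.
Qed.

Lemma Re_series (a : nat -> R[i]) n :
  complex.Re (series a n) = series (fun k => complex.Re (a k)) n.
Proof.
rewrite /series/=; elim/big_rec2 : _ => //= i x y _ <-.
by case: (a i) y => [? ?] [].
Qed.

Lemma Im_series (a : nat -> R[i]) n :
  complex.Im (series a n) = series (fun k => complex.Im (a k)) n.
Proof.
rewrite /series/=; elim/big_rec2 : _ => //= i x y _ <-.
by case: (a i) y => [? ?] [].
Qed.

Lemma abs_cvg_cseries (a : nat -> R[i]) :
  cvgn (series (fun n => normc (a n))) -> cvgn (series a).
Proof.
move=> ca; have cR : cvgn (series (fun n => complex.Re (a n))).
  apply: normed_cvg; apply: series_le_cvg ca => n /=; rewrite ?normc_ge0//.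
  exact: le_Re_normc.
have cI : cvgn (series (fun n => complex.Im (a n))).
  apply: normed_cvg; apply: series_le_cvg ca => n /=; rewrite ?normc_ge0//.
  exact: le_Im_normc.
apply/cvg_ex; exists (limn (series (fun n => complex.Re (a n))) +i*
  limn (series (fun n => complex.Im (a n)))).
apply/cvg_ReIm; split => /=.
  by under eq_fun do rewrite Re_series.
by under eq_fun do rewrite Im_series.
Qed.

Lemma normc_series_le (a : nat -> R[i]) n :
  normc (series a n) <= series (fun k => normc (a k)) n.
Proof.
rewrite /series/=; elim/big_rec2 : _ => [|i x y _ le].
  by rewrite ComplexField.Normc.normc0.
by apply: le_trans (le_normcD _ _) _; rewrite lerD2l.
Qed.

Lemma normc_lim_series (a : nat -> R[i]) :
  cvgn (series (fun n => normc (a n))) ->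
  normc (limn (series a)) <= limn (series (fun n => normc (a n))).
Proof.
move=> ca; have /cvgc_norm sa := abs_cvg_cseries ca.
rewrite -(cvg_lim _ sa)//; apply: ler_lim => //.
  by apply/cvg_ex; eexists; exact: sa.
by apply: nearW => n; exact: normc_series_le.
Qed.

End ComplexBasics.

Import HBNNSimple.

(** * Integrals of a.e. equal functions without measurability *)

Section IntegralAe.
Context d (T : measurableType d) (R : realType) (mu : {measure set T -> \bar R}).
Local Open Scope ereal_scope.

Let ge0_le_integral_off_null (N : set T) (f g : T -> \bar R) :
  measurable N -> mu N = 0 -> (forall x, 0 <= f x) -> (forall x, 0 <= g x) ->
  (forall x, ~ N x -> f x <= g x) -> \int[mu]_x f x <= \int[mu]_x g x.
Proof.
move=> mN N0 f0 g0 fg; rewrite !ge0_integralTE//; apply: ge_ereal_sup => _ [h hf <-].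
apply: ereal_sup_ubound; exists (proj_nnsfun h (measurableC mN)) => [x|].
  rewrite /= /mindic/= indicE; have [xN|xN] := boolP (x \in ~` N).
    by rewrite mulr1; apply: le_trans (hf x) _; apply: fg; exact/set_mem.
  by rewrite mulr0.
rewrite -!integralT_nnsfun; apply: ae_eq_integral => //=.
- by apply/measurable_EFinP; exact: (measurable_funPT (proj_nnsfun h (measurableC mN))).
- by apply/measurable_EFinP; exact: (measurable_funPT h).
exists N; split => // x /= /not_implyP[_ hx]; apply: contrapT => nNx; apply: hx.
by rewrite /mindic indicE mem_set// mulr1.
Qed.

(* [ae_eq_integral] without measurability: the integral of a nonnegative function
   is a supremum over simple functions, each of which may be set to 0 on a null set. *)
Lemma ae_eq_integral_nonmeasurable (D : set T) (f g : T -> \bar R) :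
  {ae mu, forall x, D x -> f x = g x} ->
  \int[mu]_(x in D) f x = \int[mu]_(x in D) g x.
Proof.
move=> [N [mN N0 fgN]].
have fg x : ~ N x -> (f \_ D) x = (g \_ D) x.
  move=> nNx; rewrite !patchE; case: ifPn => // /set_mem Dx; apply: contrapT => fgx.
  by apply: nNx; apply: fgN => /= /(_ Dx).
rewrite integral_mkcond [RHS]integral_mkcond integralE [RHS]integralE.
by congr (_ - _); apply/eqP; rewrite eq_le; apply/andP; split;
  apply: (@ge0_le_integral_off_null N) => // x nNx;
  rewrite ?funeposE ?funenegE fg.
Qed.
End IntegralAe.

(** * Means over the circle *)

Section CircleMean.
Variable R : realType.
Local Notation mu := (@lebesgue_measure R).
Local Notation C := R[i].
Local Notation I := (`[0, 2 * pi]%classic : set (measurableTypeR R)).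
Implicit Types (f g : circle R -> C) (G : circle R -> R).

Let ae_filter_lebesgue : Filter (nbhs (almost_everywhere mu)).
Proof. exact: (ae_filter_ringOfSetsType mu). Qed.
#[local] Existing Instance ae_filter_lebesgue.

Definition ae_circle (P : circle R -> Prop) : Prop :=
  {ae mu, forall t, I t -> P (expi t)}.

Lemma ae_circleW (P : circle R -> Prop) : (forall x, P x) -> ae_circle P.
Proof. by move=> p; apply: aeW => t _; exact: p. Qed.

Lemma ae_circleS (P Q : circle R -> Prop) :
  (forall x, P x -> Q x) -> ae_circle P -> ae_circle Q.
Proof. by move=> PQ; rewrite /ae_circle; apply: filterS => t Pt It; apply/PQ/Pt. Qed.

Lemma ae_circleS2 (P Q S : circle R -> Prop) :
  (forall x, P x -> Q x -> S x) -> ae_circle P -> ae_circle Q -> ae_circle S.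
Proof.
move=> PQ; rewrite /ae_circle.
by apply: filterS2 => t Pt Qt It; apply: PQ; [exact: Pt|exact: Qt].
Qed.

Lemma ae_circle_forall (P : nat -> circle R -> Prop) :
  (forall n, ae_circle (P n)) -> ae_circle (fun x => forall n, P n x).
Proof. by rewrite /ae_circle => /ae_foralln; apply: filterS => t Pt It n; exact: Pt. Qed.

Definition rmeasurable G := measurable_fun I (fun t => G (expi t)).

Definition rintegrable G := mu.-integrable I (fun t => (G (expi t))%:E).

Definition cmeasurable f :=
  rmeasurable (fun x => complex.Re (f x)) /\ rmeasurable (fun x => complex.Im (f x)).

Lemma I_measurable : measurable I. Proof. exact: measurable_itv. Qed.
Hint Resolve I_measurable : core.

Lemma pi2_gt0 : 0 < 2 * pi :> R.
Proof. by rewrite mulr_gt0// pi_gt0. Qed.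

Lemma mu_I : mu I = (2 * pi)%:E.
Proof. by rewrite lebesgue_measure_itv/= lte_fin pi2_gt0 oppr0 adde0. Qed.

Lemma L1_cmeasurable f : L1 f -> cmeasurable f.
Proof. by move=> [/integrableP[/measurable_EFinP ? _] /integrableP[/measurable_EFinP ? _]]. Qed.

Lemma rintegrable_rmeasurable G : rintegrable G -> rmeasurable G.
Proof. by move=> /integrableP[/measurable_EFinP]. Qed.

Lemma cmeasurable_cst (c : C) : cmeasurable (fun=> c).
Proof. by split; exact: measurable_cst. Qed.

Lemma cmeasurableD f g : cmeasurable f -> cmeasurable g ->
  cmeasurable (fun x => f x + g x).
Proof.
move=> [fr fi] [gr gi]; split.
  rewrite /rmeasurable (_ : (fun t => _) = (fun t => complex.Re (f (expi t))) \+
    (fun t => complex.Re (g (expi t)))); first exact: measurable_funD.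
  by apply/funext => t /=; case: (f _) (g _) => [? ?] [].
rewrite /rmeasurable (_ : (fun t => _) = (fun t => complex.Im (f (expi t))) \+
  (fun t => complex.Im (g (expi t)))); first exact: measurable_funD.
by apply/funext => t /=; case: (f _) (g _) => [? ?] [].
Qed.

Lemma cmeasurableM f g : cmeasurable f -> cmeasurable g ->
  cmeasurable (fun x => f x * g x).
Proof.
move=> [fr fi] [gr gi]; split.
  rewrite /rmeasurable (_ : (fun t => _) = ((fun t => complex.Re (f (expi t))) \*
    (fun t => complex.Re (g (expi t)))) \- ((fun t => complex.Im (f (expi t))) \*
    (fun t => complex.Im (g (expi t))))).
    by apply: measurable_funB; exact: measurable_funM.
  by apply/funext => t /=; case: (f _) (g _) => [? ?] [].
rewrite /rmeasurable (_ : (fun t => _) = ((fun t => complex.Re (f (expi t))) \*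
  (fun t => complex.Im (g (expi t)))) \+ ((fun t => complex.Im (f (expi t))) \*
  (fun t => complex.Re (g (expi t))))).
  by apply: measurable_funD; exact: measurable_funM.
by apply/funext => t /=; case: (f _) (g _) => [? ?] [].
Qed.

Lemma cmeasurable_series (f : nat -> circle R -> C) n :
  (forall k, cmeasurable (f k)) -> cmeasurable (fun x => series (fun k => f k x) n).
Proof.
move=> mf; elim: n => [|n IH].
  rewrite (_ : (fun x => _) = fun=> 0); first exact: cmeasurable_cst.
  by apply/funext => x; rewrite /series/= big_geq.
rewrite (_ : (fun x => _) = fun x => series (fun k => f k x) n + f n x).
  exact: cmeasurableD.
by apply/funext => x; rewrite /series/= big_nat_recr.
Qed.

Lemma cmeasurable_conj f : cmeasurable f -> cmeasurable (fun x => (f x)^*%C).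
Proof.
move=> [fr fi]; split.
  rewrite /rmeasurable (_ : (fun t => _) = (fun t => complex.Re (f (expi t))))//.
  by apply/funext => t /=; case: (f _).
rewrite /rmeasurable (_ : (fun t => _) = \- (fun t => complex.Im (f (expi t)))).
  exact: measurable_funN.
by apply/funext => t /=; case: (f _).
Qed.

Lemma rmeasurable_normc f : cmeasurable f -> rmeasurable (fun x => normc (f x)).
Proof.
move=> [fr fi].
rewrite /rmeasurable (_ : (fun t => _) = Num.sqrt \o (((fun t =>
  complex.Re (f (expi t))) \* (fun t => complex.Re (f (expi t)))) \+ ((fun t =>
  complex.Im (f (expi t))) \* (fun t => complex.Im (f (expi t)))))).
  apply: measurableT_comp.
    by apply: continuous_measurable_fun; exact: sqrt_continuous.
  by apply: measurable_funD; exact: measurable_funM.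
by apply/funext => t /=; case: (f _) => a b /=; rewrite !expr2.
Qed.

Lemma cmeasurable_cvg (f : nat -> circle R -> C) g :
  (forall n, cmeasurable (f n)) -> (forall x, f ^~ x @ \oo --> g x) -> cmeasurable g.
Proof.
move=> mf fg; split; [apply: (@measurable_fun_cvg _ _ _ _
    (fun n t => complex.Re (f n (expi t))))|apply: (@measurable_fun_cvg _ _ _ _
    (fun n t => complex.Im (f n (expi t))))].
- by move=> n; have [] := mf n.
- by move=> t _; have /cvg_ReIm[] := fg (expi t).
- by move=> n; have [] := mf n.
- by move=> t _; have /cvg_ReIm[] := fg (expi t).
Qed.

Lemma rintegrable_le G H : rmeasurable G -> rintegrable H ->
  ae_circle (fun x => `|G x| <= H x) -> rintegrable G.
Proof.
move=> mG /integrableP[mH iH] GH; apply/integrableP; split; first exact/measurable_EFinP.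
apply: le_lt_trans iH; apply: ae_ge0_le_integral => //.
- by apply: measurableT_comp => //; exact/measurable_EFinP.
- exact: measurableT_comp.
move: GH; rewrite /ae_circle; apply: filterS => t GHt It.
by rewrite !abse_EFin lee_fin; apply: le_trans (GHt It) _; exact: ler_norm.
Qed.

Lemma rintegrable_cst (c : R) : rintegrable (fun=> c).
Proof.
apply/integrableP; split; first exact: measurable_cst.
rewrite integral_cst// [X in (_ * X)%E](_ : _ = mu I)// mu_I.
by rewrite -EFinM ltry.
Qed.

Lemma rintegrableD G H : rintegrable G -> rintegrable H ->
  rintegrable (fun x => G x + H x).
Proof.
by move=> iG iH; apply: eq_integrable (integrableD I_measurable iG iH).
Qed.

Lemma rintegrableZ G (k : R) : rintegrable G -> rintegrable (fun x => k * G x).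
Proof.
by move=> iG; apply: eq_integrable (integrableZl I_measurable k iG).
Qed.

Lemma rintegrable_norm G : rintegrable G -> rintegrable (fun x => `|G x|).
Proof. by move=> iG; exact: (integrable_abse iG). Qed.

Lemma L1_le f H : cmeasurable f -> rintegrable H ->
  ae_circle (fun x => normc (f x) <= H x) -> L1 f.
Proof.
move=> [fr fi] iH fH; split.
  apply: (@rintegrable_le (fun x => complex.Re (f x)) H) => //.
  by apply: ae_circleS fH => x; apply: le_trans; exact: le_Re_normc.
apply: (@rintegrable_le (fun x => complex.Im (f x)) H) => //.
by apply: ae_circleS fH => x; apply: le_trans; exact: le_Im_normc.
Qed.

Lemma L1_bounded f M : cmeasurable f -> ae_circle (fun x => normc (f x) <= M) -> L1 f.
Proof. by move=> mf; apply: L1_le => //; exact: rintegrable_cst. Qed.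

Lemma L1_normc f : L1 f -> rintegrable (fun x => normc (f x)).
Proof.
move=> Lf; have [fr fi] := Lf.
apply: (@rintegrable_le _ (fun x => `|complex.Re (f x)| + `|complex.Im (f x)|)).
- by apply: rmeasurable_normc; exact: L1_cmeasurable.
- exact: rintegrableD (rintegrable_norm fr) (rintegrable_norm fi).
- by apply: ae_circleW => x; rewrite ger0_norm ?normc_ge0// le_normc_ReIm.
Qed.

Lemma L1D f g : L1 f -> L1 g -> L1 (fun x => f x + g x).
Proof.
move=> Lf Lg; apply: (@L1_le _ (fun x => normc (f x) + normc (g x))).
- by apply: cmeasurableD; exact: L1_cmeasurable.
- exact: rintegrableD (L1_normc Lf) (L1_normc Lg).
- by apply: ae_circleW => x; exact: le_normcD.
Qed.

Lemma L1M_bounded f g M : L1 f -> cmeasurable g ->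
  ae_circle (fun x => normc (g x) <= M) -> L1 (fun x => f x * g x).
Proof.
move=> Lf mg gM; apply: (@L1_le _ (fun x => M * normc (f x))).
- by apply: cmeasurableM => //; exact: L1_cmeasurable.
- exact: rintegrableZ (L1_normc Lf).
- apply: ae_circleS gM => x gM.
  by rewrite ComplexField.Normc.normcM mulrC ler_wpM2r ?normc_ge0.
Qed.

Lemma L1Z f (c : C) : L1 f -> L1 (fun x => f x * c).
Proof.
move=> Lf; apply: (@L1M_bounded _ _ (normc c)) => //; first exact: cmeasurable_cst.
exact: ae_circleW.
Qed.

(** Measurability is avoided because this is applied to [boundary h], a pointwise [lim] with
    arbitrary values off a full set. *)
Lemma ae_mean G H : ae_circle (fun x => G x = H x) -> mean G = mean H.
Proof.
move=> GH; congr (_ * fine _); apply: ae_eq_integral_nonmeasurable.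
by move: GH; rewrite /ae_circle; apply: filterS => t GH /GH ->.
Qed.

Lemma ae_cmean f g : ae_circle (fun x => f x = g x) -> cmean f = cmean g.
Proof.
by move=> fg; congr (_ +i* _); apply: ae_mean; apply: ae_circleS fg => x ->.
Qed.

Lemma meanD G H : rintegrable G -> rintegrable H ->
  mean (fun x => G x + H x) = mean G + mean H.
Proof. by move=> iG iH; rewrite /mean RintegralD// mulrDr. Qed.

Lemma meanZ G k : rintegrable G -> mean (fun x => k * G x) = k * mean G.
Proof. by move=> iG; rewrite /mean RintegralZl// mulrCA. Qed.

Lemma mean_cst (k : R) : mean (fun=> k) = k.
Proof.
rewrite /mean Rintegral_cst// [X in fine X](_ : _ = mu I)// mu_I/=.
by rewrite mulrCA mulVf ?mulr1// gt_eqF// pi2_gt0.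
Qed.

Lemma mean_ge0 G : (forall x, 0 <= G x) -> 0 <= mean G.
Proof.
move=> G0; apply: mulr_ge0; first by rewrite invr_ge0 ltW// pi2_gt0.
by apply: Rintegral_ge0 => x _.
Qed.

Lemma le_mean G H : rintegrable G -> rintegrable H ->
  ae_circle (fun x => G x <= H x) -> mean G <= mean H.
Proof.
move=> iG iH GH; rewrite -subr_ge0.
have -> : mean H - mean G = mean (fun x => H x + -1 * G x).
  rewrite meanD ?meanZ ?mulN1r//.
  exact: rintegrableZ.
(* The inequality holds only a.e.; the absolute value agrees a.e. with the difference and is
   nonnegative everywhere, as [mean_ge0] demands. *)
rewrite (@ae_mean _ (fun x => `|H x - G x|)).
  by apply: mean_ge0.
by apply: ae_circleS GH => x GH; rewrite ger0_norm ?subr_ge0// mulN1r.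
Qed.

Lemma L1norm_ge0 f : 0 <= L1norm f.
Proof. by apply: mean_ge0 => x; exact: normc_ge0. Qed.

Lemma cmeanD f g : L1 f -> L1 g ->
  cmean (fun x => f x + g x) = cmean f + cmean g.
Proof.
move=> [fr fi] [gr gi]; rewrite /cmean.
transitivity ((mean (fun x => complex.Re (f x)) + mean (fun x => complex.Re (g x)))
  +i* (mean (fun x => complex.Im (f x)) + mean (fun x => complex.Im (g x)))) => //.
rewrite -!meanD//; congr (mean _ +i* mean _).
  by apply/funext => x; case: (f x) (g x) => [? ?] [].
by apply/funext => x; case: (f x) (g x) => [? ?] [].
Qed.

Lemma cmeanZ f c : L1 f -> cmean (fun x => f x * c) = cmean f * c.
Proof.
case: c => a b [fr fi]; rewrite /cmean.
transitivity ((mean (fun x => complex.Re (f x)) * a - mean (fun x => complex.Im (f x)) * b)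
  +i* (mean (fun x => complex.Re (f x)) * b + mean (fun x => complex.Im (f x)) * a)) => //.
rewrite ![mean _ * _]mulrC -mulNr -!meanZ//.
rewrite -!meanD//; try exact: rintegrableZ.
congr (mean _ +i* mean _); apply/funext => x; case: (f x) => c d /=; ring.
Qed.

Lemma cmean_cst (c : C) : cmean (fun _ : circle R => c) = c.
Proof. by case: c => a b; rewrite /cmean !mean_cst. Qed.

Lemma cmean_conj f : L1 f -> cmean (fun x => (f x)^*%C) = (cmean f)^*%C.
Proof.
move=> [_ fi]; rewrite /cmean /=; congr (_ +i* _).
  by congr mean; apply/funext => x; case: (f x).
rewrite -mulN1r -meanZ//; congr mean; apply/funext => x.
by case: (f x) => a b /=; rewrite mulN1r.
Qed.

Lemma normc_cmean f : L1 f -> normc (cmean f) <= L1norm f.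
Proof.
move=> Lf; have [->|z0] := eqVneq (cmean f) 0.
  by rewrite ComplexField.Normc.normc0 L1norm_ge0.
have n0 : 0 < normc (cmean f) by rewrite normc_gt0.
(* Multiplication by the unimodular [w] turns the mean into its modulus, which is then the mean of a
   real part. *)
pose w : C := (cmean f)^*%C * ((normc (cmean f))^-1)%:C.
have nw : normc w = 1.
  rewrite ComplexField.Normc.normcM normc_conj normc_real ger0_norm ?invr_ge0 ?ltW//.
  by rewrite mulfV// gt_eqF.
have -> : normc (cmean f) = complex.Re (cmean (fun x => f x * w)).
  rewrite cmeanZ// /w mulrA.
  have -> (z : C) (r : R) : complex.Re (z * r%:C) = complex.Re z * r.
    by case: z => a b /=; rewrite mulr0 subr0.
  by rewrite -normc_sqr expr2 mulfK// gt_eqF.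
have Lw := L1Z w Lf.
apply: le_mean; [by have [] := Lw|exact: L1_normc|].
apply: ae_circleW => x; apply: le_trans (ler_norm _) _.
by apply: le_trans (le_Re_normc _) _; rewrite ComplexField.Normc.normcM nw mulr1.
Qed.

Lemma L1norm_le f H : L1 f -> rintegrable H ->
  ae_circle (fun x => normc (f x) <= H x) -> L1norm f <= mean H.
Proof. by move=> Lf iH fH; exact: (le_mean (L1_normc Lf) iH fH). Qed.

Lemma dominated_mean (G_ : nat -> circle R -> R) G H :
  (forall n, rmeasurable (G_ n)) -> rmeasurable G -> rintegrable H ->
  ae_circle (fun x => G_ ^~ x @ \oo --> G x) ->
  ae_circle (fun x => forall n, `|G_ n x| <= H x) ->
  rintegrable G /\ (fun n => mean (G_ n)) @ \oo --> mean G.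
Proof.
move=> mG_ mG iH G_G GH.
have [||||iG _ cG] := @dominated_convergence _ _ _ mu I I_measurable
  (fun n t => (G_ n (expi t))%:E) (fun t => (G (expi t))%:E)
  (fun t => (H (expi t))%:E) _ _ _ iH.
- by move=> n; apply/measurable_EFinP; exact: mG_.
- exact/measurable_EFinP.
- move: G_G; rewrite /ae_circle; apply: filterS => t h It.
  apply: cvg_EFin; first by apply: nearW.
  exact: (h It).
- move: GH; rewrite /ae_circle; apply: filterS => t h n It.
  by rewrite abse_EFin lee_fin; exact: h.
split => //; apply: cvgMl_tmp; apply: fine_cvg; rewrite fineK//.
exact: (integrable_fin_num I_measurable iG).
Qed.

Lemma dominated_cmean (f_ : nat -> circle R -> C) f H :
  (forall n, cmeasurable (f_ n)) -> cmeasurable f -> rintegrable H ->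
  ae_circle (fun x => f_ ^~ x @ \oo --> f x) ->
  ae_circle (fun x => forall n, normc (f_ n x) <= H x) ->
  (fun n => cmean (f_ n)) @ \oo --> cmean f.
Proof.
move=> mf_ [mfr mfi] iH ff fH; apply/cvg_ReIm; split.
  apply: (proj2 (@dominated_mean (fun n x => complex.Re (f_ n x))
    (fun x => complex.Re (f x)) H _ mfr iH _ _)).
  - by move=> n; have [] := mf_ n.
  - by apply: ae_circleS ff => x /cvg_ReIm[].
  - by apply: ae_circleS fH => x h n; apply: le_trans (h n); exact: le_Re_normc.
apply: (proj2 (@dominated_mean (fun n x => complex.Im (f_ n x))
  (fun x => complex.Im (f x)) H _ mfi iH _ _)).
- by move=> n; have [] := mf_ n.
- by apply: ae_circleS ff => x /cvg_ReIm[].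
- by apply: ae_circleS fH => x h n; apply: le_trans (h n); exact: le_Im_normc.
Qed.

Lemma cmean_series (f : nat -> circle R -> C) n : (forall k, L1 (f k)) ->
  cmean (fun x => series (fun k => f k x) n) = series (fun k => cmean (f k)) n.
Proof.
move=> Lf; suff : L1 (fun x => series (fun k => f k x) n) /\
  cmean (fun x => series (fun k => f k x) n) = series (fun k => cmean (f k)) n by case.
elim: n => [|n [IH1 IH2]].
  rewrite (_ : (fun x => _) = fun=> 0); last first.
    by apply/funext => x; rewrite /series/= big_geq.
  split; last by rewrite cmean_cst /series/= big_geq.
  apply: (@L1_bounded _ 0); first exact: cmeasurable_cst.
  by apply: ae_circleW => x; rewrite ComplexField.Normc.normc0.
rewrite (_ : (fun x => _) = fun x => series (fun k => f k x) n + f n x); last first.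
  by apply/funext => x; rewrite /series/= big_nat_recr.
split; first exact: L1D.
by rewrite cmeanD// IH2 /series/= big_nat_recr.
Qed.

End CircleMean.

(** * Termwise integration of series over the circle *)

Section TermwiseMean.
Variable R : realType.
Local Notation mu := (@lebesgue_measure R).
Local Notation C := R[i].
Local Notation I := (`[0, 2 * pi]%classic : set (measurableTypeR R)).

Lemma nneseries_EFin (u : nat -> R) : (forall n, 0 <= u n) -> cvgn (series u) ->
  (\sum_(0 <= n <oo) (u n)%:E = (limn (series u))%:E)%E.
Proof.
move=> u0 cu; rewrite -EFin_lim//; congr (limn _); apply/funext => n /=.
by rewrite /series/= -sumEFin.
Qed.

Lemma le_series_lim (u : nat -> R) n : (forall n, 0 <= u n) -> cvgn (series u) ->
  series u n <= limn (series u).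
Proof.
move=> u0 cu; apply: nondecreasing_cvgn_le cu _.
by apply: nondecreasing_series => k _ _; exact: u0.
Qed.

Lemma cvg_nnseries_le (u : nat -> R) (M : R) : (forall n, 0 <= u n) ->
  (forall n, series u n <= M) -> cvgn (series u) /\ limn (series u) <= M.
Proof.
move=> u0 uM; have cu : cvgn (series u).
  apply: nondecreasing_is_cvgn.
    by apply: nondecreasing_series => k _ _; exact: u0.
  by exists M => _ [n _ <-].
by split => //; apply: limr_le => //; apply: nearW.
Qed.

Let ae_filter_lebesgue : Filter (nbhs (almost_everywhere mu)).
Proof. exact: (ae_filter_ringOfSetsType mu). Qed.
#[local] Existing Instance ae_filter_lebesgue.

Variable f : nat -> circle R -> C.
Hypothesis Lf : forall n, L1 (f n).
Hypothesis sf : cvgn (series (fun n => L1norm (f n))).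

Let S x := (\sum_(0 <= n <oo) (normc (f n x))%:E)%E.

Let S0 x : (0 <= S x)%E.
Proof. by apply: nneseries_ge0 => n _ _; rewrite lee_fin normc_ge0. Qed.

Let mS : measurable_fun I (fun t => S (expi t)).
Proof.
apply: (@ge0_emeasurable_sum _ _ _ I (fun n t => (normc (f n (expi t)))%:E) predT).
  by move=> n t _ _; rewrite lee_fin normc_ge0.
move=> n _; apply/measurable_EFinP.
by apply: rmeasurable_normc; exact: L1_cmeasurable.
Qed.

Let integral_S :
  (\int[mu]_(t in I) S (expi t) = (2 * pi * limn (series (fun n => L1norm (f n))))%:E)%E.
Proof.
rewrite integral_nneseries//; last 2 first.
- move=> n; apply/measurable_EFinP.
  by apply: rmeasurable_normc; exact: L1_cmeasurable.
- by move=> n t _; rewrite lee_fin normc_ge0.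
rewrite EFinM -nneseries_EFin//; last by move=> n; exact: L1norm_ge0.
rewrite -nneseriesZl; last by move=> n _; rewrite lee_fin L1norm_ge0.
apply: eq_eseriesr => n _; rewrite -EFinM /L1norm /mean mulrA mulfV ?mul1r; last first.
  by rewrite gt_eqF// pi2_gt0.
rewrite /Rintegral fineK//; apply: integrable_fin_num; first exact: measurable_itv.
exact: (L1_normc (Lf n)).
Qed.

Let integrable_S : mu.-integrable I (fun t => S (expi t)).
Proof.
apply/integrableP; split => //.
under eq_integral do rewrite gee0_abs//.
by rewrite integral_S ltry.
Qed.

Let S_fin : ae_circle (fun x => S x \is a fin_num).
Proof.
have := integrable_ae (@I_measurable R) integrable_S.
by rewrite /ae_circle; apply: filterS => t h It; exact: h.
Qed.

(** Multiplying by [chi] removes the null set where the moduli are not summable. The terms [f'] then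
    sum absolutely at every point, and their sum is measurable as an everywhere limit. *)
Let chi (x : circle R) : C := (S x \is a fin_num)%:R.

Let mchi : cmeasurable chi.
Proof.
split.
  pose A := I `&` (fun t => S (expi t)) @^-1` [set` (`]-oo%E, +oo%E[ : interval (\bar R))].
  have mA : measurable A by apply: mS; [exact: measurable_itv|exact: emeasurable_itv].
  rewrite /rmeasurable; apply: (@eq_measurable_fun _ _ _ _ I (\1_A : R -> R)).
    move=> t /set_mem It; rewrite /chi indicE.
    have -> : (t \in A) = (S (expi t) \is a fin_num).
      rewrite fin_numElt; apply/idP/idP => [/set_mem[_ /=]|St]; first by rewrite in_itv.
      by apply/mem_set; split => //=; rewrite in_itv.
    by case: (_ \is a _).
  exact: measurable_indic.
rewrite /rmeasurable (_ : (fun t => _) = cst 0); first exact: measurable_cst.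
by apply/funext => t; rewrite /chi; case: (_ \is a _).
Qed.

Let f' n x := chi x * f n x.

Let Lf' n : L1 (f' n).
Proof.
rewrite /f'; under eq_fun do rewrite mulrC.
apply: (@L1M_bounded _ _ _ 1) => //; apply: ae_circleW => x.
rewrite /chi; case: (_ \is a _); first by rewrite ComplexField.Normc.normc1.
by rewrite ComplexField.Normc.normc0.
Qed.

Let series_f' x : cvgn (series (fun n => normc (f' n x))) /\
  limn (series (fun n => normc (f' n x))) <= fine (S x).
Proof.
apply: cvg_nnseries_le => [n|n]; first exact: normc_ge0.
rewrite /f' /chi; case: (boolP (S x \is a fin_num)) => Sx.
  rewrite -lee_fin fineK//; under eq_fun do rewrite mul1r.
  apply: le_trans (nneseries_lim_ge n _); last by move=> k _ _; rewrite lee_fin normc_ge0.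
  by rewrite sumEFin lee_fin.
rewrite /series/= big1 ?fine_ge0// => k _.
by rewrite mul0r ComplexField.Normc.normc0.
Qed.

Let iS : rintegrable (fun x => fine (S x)).
Proof.
apply: le_integrable integrable_S; first exact: measurable_itv.
  by apply/measurable_EFinP; apply: measurableT_comp => //; exact: fine_measurable.
move=> t _; rewrite abse_EFin ger0_norm ?fine_ge0// gee0_abs//.
by case: (S (expi t)) (S0 (expi t)) => //= *; rewrite ?leey.
Qed.

(** Beppo Levi's theorem for complex series: monotone convergence makes the sum of the moduli
    integrable, hence finite a.e., and it dominates all partial sums. It also acts as completeness
    of L^1, in building boundary functions and sums of Poisson kernels. *)
Lemma L1_series :
  ae_circle (fun x => cvgn (series (fun n => normc (f n x)))) /\
  exists s, [/\ L1 s, ae_circle (fun x => series (fun n => f n x) @ \oo --> s x),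
    series (fun n => cmean (f n)) @ \oo --> cmean s &
    L1norm s <= limn (series (fun n => L1norm (f n)))].
Proof.
have chi1 : ae_circle (fun x => chi x = 1).
  by apply: ae_circleS S_fin => x; rewrite /chi => ->.
split.
  apply: ae_circleS chi1 => x x1; have [+ _] := series_f' x.
  by rewrite /f'; under eq_fun do rewrite x1 mul1r.
pose s x := limn (series (fun n => f' n x)).
have fs x : series (fun n => f' n x) @ \oo --> s x.
  by apply: abs_cvg_cseries; have [] := series_f' x.
have ms : cmeasurable s.
  apply: (@cmeasurable_cvg _ (fun n x => series (fun k => f' k x) n)) => // n.
  by apply: cmeasurable_series => k; exact/L1_cmeasurable/Lf'.
have sS x : normc (s x) <= fine (S x).
  have [c1 c2] := series_f' x.
  exact: le_trans (normc_lim_series c1) c2.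
have Ls : L1 s by apply: (L1_le ms iS); exact: ae_circleW.
exists s; split => //.
- apply: ae_circleS chi1 => x x1; have := fs x.
  by rewrite /f'; under eq_fun do rewrite x1 mul1r.
- rewrite (_ : series _ = fun n => cmean (fun x => series (fun k => f' k x) n)).
    apply: (@dominated_cmean _ _ _ (fun x => fine (S x))) => //.
    + by move=> n; apply: cmeasurable_series => k; exact/L1_cmeasurable/Lf'.
    + exact: ae_circleW.
    apply: ae_circleW => x n; apply: le_trans (normc_series_le _ _) _.
    have [c1 c2] := series_f' x; apply: le_trans c2.
    by apply: le_series_lim => // k; exact: normc_ge0.
  apply/funext => n; rewrite cmean_series//; congr (series _ n).
  apply/funext => k; apply: ae_cmean; apply: ae_circleS chi1 => x x1.
  by rewrite /f' x1 mul1r.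
- apply: (le_trans (L1norm_le Ls iS _)); first exact: ae_circleW.
  have -> : mean (fun x => fine (S x)) = (2 * pi)^-1 *
      fine (\int[mu]_(t in I) S (expi t))%E.
    congr (_ * fine _); apply: ae_eq_integral_nonmeasurable.
    by move: S_fin; rewrite /ae_circle; apply: filterS => t + It => /(_ It) St; rewrite fineK.
  by rewrite integral_S/= mulrA mulVf ?mul1r// gt_eqF// pi2_gt0.
Qed.

End TermwiseMean.

(** * Rotations of the circle and orthogonality of the powers *)

Section CircleGroup.
Variable R : realType.
Local Notation mu := (@lebesgue_measure R).
Local Notation C := R[i].
Local Notation I := (`[0, 2 * pi]%classic : set (measurableTypeR R)).
Implicit Types (f g : circle R -> C) (x y : circle R).

Lemma continuous_itv_integrable (G : R -> R) (a b : R) : continuous G ->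
  mu.-integrable `[a, b] (EFin \o G).
Proof.
move=> cG; apply: continuous_compact_integrable; first exact: segment_compact.
exact: continuous_subspaceT.
Qed.

Lemma Rintegral_shift (G : R -> R) (a b d : R) : a <= b -> continuous G ->
  \int[mu]_(x in `[a + d, b + d]) G x = \int[mu]_(x in `[a, b]) G (x + d).
Proof.
move=> ab cG; pose F (x : R) := x + d.
have dF : derive1 F = cst 1.
  by apply/funext => x; rewrite derive1E /F deriveD// derive_id derive_cst addr0.
congr fine; rewrite (@integration_by_substitution_increasing R F G)//.
- by rewrite dF; apply: eq_integral => x _ /=; rewrite /= mulr1.
- by move=> x y _ _ xy; rewrite /F ltrD2r.
- by rewrite dF => x _; exact: cst_continuous.
- by rewrite dF; exact: is_cvg_cst.
- by rewrite dF; exact: is_cvg_cst.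
- have cF : continuous F by move=> x; apply: cvgD; [exact: cvg_id|exact: cvg_cst].
  split; first by move=> x _; apply: derivableD.
    by apply: cvg_at_right_filter; exact: cF.
  by apply: cvg_at_left_filter; exact: cF.
- exact: continuous_subspaceT.
Qed.

Lemma Rintegral_cat (G : R -> R) (a b c : R) : a <= c -> c <= b -> continuous G ->
  \int[mu]_(x in `[a, b]) G x =
  \int[mu]_(x in `[a, c]) G x + \int[mu]_(x in `[c, b]) G x.
Proof.
move=> ac cb cG; apply/eqP; rewrite addrC -subr_eq; apply/eqP.
rewrite Rintegral_itvB ?bnd_simp//; last exact: continuous_itv_integrable.
rewrite Rintegral_itv_obnd_cbnd//.
apply: integrableS (continuous_itv_integrable c b cG) => //.
by apply: subset_itvr; rewrite bnd_simp.
Qed.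

(** The shifted interval [d, 2 pi + d] is cut at 2 pi, and the part beyond 2 pi is translated back
    onto [0, d] by periodicity. *)
Lemma Rintegral_periodic_shift (G : R -> R) (d : R) : 0 <= d -> d <= 2 * pi ->
  continuous G -> (forall t, G (t + 2 * pi) = G t) ->
  \int[mu]_(x in I) G (x + d) = \int[mu]_(x in I) G x.
Proof.
move=> d0 dpi cG pG; have pi0 := @pi2_gt0 R.
rewrite -Rintegral_shift//; last exact: ltW.
rewrite add0r (@Rintegral_cat _ _ _ (2 * pi))//; last by rewrite lerDl.
rewrite [RHS](@Rintegral_cat _ _ _ d)// addrC; congr (_ + _).
have := @Rintegral_shift G 0 d (2 * pi) d0 cG.
rewrite add0r [d + _]addrC => ->.
by apply: eq_Rintegral => x _; rewrite pG.
Qed.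

Lemma normc_circle x : normc (val x) = 1.
Proof.
have /set_mem : val x \in circle R := valP x.
rewrite /circle/mkset => h.
have h1 : (normc (val x))%:C = (1 : R)%:C by exact: h.
by have := complexI h1.
Qed.

Lemma circle_neq0 x : val x != 0.
Proof. by rewrite -normc_eq0 normc_circle oner_eq0. Qed.

Lemma circle_conj x : (val x)^*%C = (val x)^-1.
Proof.
apply: (mulIf (circle_neq0 x)); rewrite mulVf ?circle_neq0//.
have := normc_circle x; case: (val x) => a b /= /(congr1 (fun z => z ^+ 2)).
rewrite sqr_sqrtr ?addr_ge0 ?sqr_ge0// expr1n => ab.
apply/eqP; rewrite eq_complex /= -ab; apply/andP; split; apply/eqP; ring.
Qed.

Lemma val_expiD (s t : R) : val (expi (s + t)) = val (expi s) * val (expi t).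
Proof.
rewrite /= cosD sinD; congr (_ +i* _).
by rewrite addrC.
Qed.

Lemma val_expi0 : val (expi (0 : R)) = 1.
Proof. by rewrite /= cos0 sin0. Qed.

Lemma val_expi_pi : val (expi (pi : R)) = -1.
Proof. by rewrite /= cospi sinpi; apply/eqP; rewrite eq_complex /= oppr0 !eqxx. Qed.

Lemma expi_periodic (t : R) : expi (t + 2 * pi) = expi t.
Proof.
apply: val_inj => /=; rewrite (_ : 2 * pi = pi *+ 2); last by rewrite mulr_natl.
by rewrite sinD2pi cosD2pi.
Qed.

Lemma val_expiMn (t : R) n : val (expi (t *+ n)) = val (expi t) ^+ n.
Proof.
elim: n => [|n IH]; first by rewrite mulr0n val_expi0 expr0.
by rewrite mulrS val_expiD IH exprS.
Qed.

Definition circle_continuous f := continuous (fun t : R => f (expi t)).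

Lemma continuous_expi : circle_continuous (fun x => val x).
Proof.
move=> t; apply/cvg_ReIm; split => /=; first exact: continuous_cos.
exact: continuous_sin.
Qed.

Lemma circle_continuous_Re f : circle_continuous f ->
  continuous (fun t : R => complex.Re (f (expi t))).
Proof. by move=> cf t; have /cvg_ReIm[] := cf t. Qed.

Lemma circle_continuous_Im f : circle_continuous f ->
  continuous (fun t : R => complex.Im (f (expi t))).
Proof. by move=> cf t; have /cvg_ReIm[] := cf t. Qed.

Lemma L1_continuous f : circle_continuous f -> L1 f.
Proof.
move=> cf; split; first exact: (continuous_itv_integrable _ _ (circle_continuous_Re cf)).
exact: (continuous_itv_integrable _ _ (circle_continuous_Im cf)).
Qed.

Lemma circle_continuousM f g : circle_continuous f -> circle_continuous g ->
  circle_continuous (fun x => f x * g x).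
Proof. by move=> cf cg t; apply: cvgM; [exact: cf|exact: cg]. Qed.

Lemma circle_continuousD f g : circle_continuous f -> circle_continuous g ->
  circle_continuous (fun x => f x + g x).
Proof. by move=> cf cg t; apply: cvgD; [exact: cf|exact: cg]. Qed.

Lemma circle_continuous_cst (c : C) : circle_continuous (fun=> c).
Proof. by move=> t; exact: cvg_cst. Qed.

Lemma circle_continuousX f n : circle_continuous f ->
  circle_continuous (fun x => f x ^+ n).
Proof.
move=> cf; elim: n => [|n IH].
  by under eq_fun do rewrite expr0; exact: circle_continuous_cst.
by under eq_fun do rewrite exprS; exact: (circle_continuousM cf IH).
Qed.

Lemma circle_continuous_conj f : circle_continuous f ->
  circle_continuous (fun x => (f x)^*%C).
Proof.
move=> cf t; have /cvg_ReIm[fr fi] := cf t; apply/cvg_ReIm.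
have conjE (z : C) : z^*%C = complex.Re z +i* - complex.Im z by case: z.
under eq_fun do rewrite conjE; under [X in _ /\ cvg_to (nbhs (fmap X _)) _]eq_fun do rewrite conjE.
by rewrite conjE; split => //=; exact: cvgN.
Qed.

Lemma circle_continuousV f : (forall x, f x != 0) -> circle_continuous f ->
  circle_continuous (fun x => (f x)^-1).
Proof. by move=> f0 cf t; apply: cvgV => //; exact: cf. Qed.

Lemma circle_mul_subproof x y : val x * val y \in circle R.
Proof.
apply/mem_set; change ((normc (val x * val y))%:C = 1).
by rewrite ComplexField.Normc.normcM !normc_circle mulr1.
Qed.

Definition circle_mul x y : circle R := SigSub (circle_mul_subproof x y).

Lemma expiD (s t : R) : expi (s + t) = circle_mul (expi s) (expi t).
Proof. by apply: val_inj; rewrite val_expiD. Qed.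

Lemma cmean_rotation f (d : R) : 0 <= d -> d <= 2 * pi -> circle_continuous f ->
  cmean (fun x => f (circle_mul x (expi d))) = cmean f.
Proof.
move=> d0 dpi cf; rewrite /cmean /mean; congr ((_ * _) +i* (_ * _)).
  have := Rintegral_periodic_shift d0 dpi (circle_continuous_Re cf).
  move=> <-; last by move=> t; rewrite expi_periodic.
  by apply: eq_Rintegral => t _; rewrite expiD.
have := Rintegral_periodic_shift d0 dpi (circle_continuous_Im cf).
move=> <-; last by move=> t; rewrite expi_periodic.
by apply: eq_Rintegral => t _; rewrite expiD.
Qed.

(** For a positive exponent n, rotation by pi / n multiplies the power by -1, so its mean equals its
    own negative. *)
Lemma cmean_exp n : cmean (fun x : circle R => val x ^+ n) = (n == 0%N)%:R.
Proof.
case: n => [|n].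
  by under eq_fun do rewrite expr0; rewrite cmean_cst.
have c : circle_continuous (fun x => val x ^+ n.+1).
  exact/circle_continuousX/continuous_expi.
have n0 : (0 : R) < n.+1%:R by rewrite ltr0n.
have d0 : 0 <= pi / n.+1%:R :> R by rewrite divr_ge0 ?pi_ge0 ?(ltW n0).
have dpi : pi / n.+1%:R <= 2 * pi :> R.
  rewrite ler_pdivrMr// mulrAC ler_peMl ?pi_ge0//.
  by rewrite -natrM ler1n.
have := cmean_rotation d0 dpi c.
have -> : (fun x => val (circle_mul x (expi (pi / n.+1%:R))) ^+ n.+1) =
    fun x : circle R => val x ^+ n.+1 * val (expi (pi / n.+1%:R : R)) ^+ n.+1.
  by apply/funext => x; rewrite exprMn.
rewrite (cmeanZ _ (L1_continuous c)).
rewrite -val_expiMn -[(pi / _) *+ _]mulr_natr divfK ?gt_eqF// val_expi_pi mulrN1.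
move=> /eqP; rewrite eq_sym -addr_eq0 -mulr2n mulrn_eq0 /=.
by move=> /eqP.
Qed.

Lemma cmean_expV n : cmean (fun x : circle R => (val x)^-1 ^+ n) = (n == 0%N)%:R.
Proof.
have c : circle_continuous (fun x => val x ^+ n).
  exact/circle_continuousX/continuous_expi.
have := cmean_conj (L1_continuous c); rewrite cmean_exp.
under eq_fun do rewrite rmorphXn /= circle_conj.
by move=> ->; case: eqP => _; apply/eqP; rewrite eq_complex/= ?oppr0 !eqxx.
Qed.

Lemma cmean_expM n m :
  cmean (fun x : circle R => val x ^+ n * (val x)^-1 ^+ m) = (n == m)%:R.
Proof.
case: (leqP m n) => [mn|nm].
  rewrite (_ : (fun x => _) = fun x : circle R => val x ^+ (n - m)).
    by rewrite cmean_exp subn_eq0 eqn_leq mn andbT.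
  apply/funext => x; rewrite -{1}(subnK mn) exprD -mulrA -exprMn mulfV ?circle_neq0//.
  by rewrite expr1n mulr1.
rewrite (_ : (fun x => _) = fun x : circle R => (val x)^-1 ^+ (m - n)).
  by rewrite cmean_expV subn_eq0 eqn_leq [(m <= n)%N]leqNgt nm andbF.
apply/funext => x; rewrite -{1}(subnK (ltnW nm)) addnC exprD mulrA -exprMn mulfV ?circle_neq0//.
by rewrite expr1n mul1r.
Qed.

End CircleGroup.

(** * Cauchy's formula for locally power series functions *)

Section LocalPowerSeries.
Variable R : realType.
Local Notation C := R[i].
Implicit Types z w x y p : C.

Lemma near_normc (z0 : C) (e : R) : 0 < e -> \forall z \near z0, normc (z - z0) < e.
Proof.
move=> e0; have /cvgcP/cvgrPdist_lt/(_ _ e0) : (id : C -> C) @ z0 --> z0 by exact: cvg_id.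
by apply: filterS => z; rewrite sub0r normrN ger0_norm ?normc_ge0.
Qed.

Lemma cvg_cgeometric z : normc z < 1 -> series (fun n => z ^+ n) @ \oo --> (1 - z)^-1.
Proof.
move=> z1; have zn1 : z != 1.
  by apply: contraTneq z1 => ->; rewrite ComplexField.Normc.normc1 ltxx.
have -> : series (fun n => z ^+ n) = fun n => (1 - z ^+ n) / (1 - z).
  rewrite (_ : (fun n => z ^+ n) = geometric 1 z).
    by rewrite geometric_seriesE//; apply/funext => n /=; rewrite mul1r.
  by apply/funext => n /=; rewrite mul1r.
rewrite -[X in _ --> X]mul1r; apply: cvgMr_tmp.
rewrite -[X in _ --> X]subr0; apply: cvgB; first exact: cvg_cst.
apply/cvgcP; under eq_fun do rewrite subr0 normcX.
by apply: cvg_expr; rewrite ger0_norm ?normc_ge0.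
Qed.

Lemma series_half_le (n : nat) : series (fun k => (2^-1 : R) ^+ k) n <= 2.
Proof.
rewrite (_ : (fun k => _) = geometric 1 (2^-1 : R)); last first.
  by apply/funext => k /=; rewrite mul1r.
rewrite geometric_seriesE /=; last by rewrite lt_eqF// invf_lt1// ltr1n.
rewrite mul1r [X in _ / X](_ : _ = 2^-1); last by field.
by rewrite invrK -[leRHS]mul1r ler_wpM2r// gerBl exprn_ge0.
Qed.

(** The sharp factor n rho^(n-1) is replaced by 2^n rho^(n-1), which keeps the bound geometric in n
    and the induction short. *)
Lemma normc_expB_le (rho : R) y w n : 0 < rho -> normc y <= rho -> normc w <= rho ->
  normc (y ^+ n - w ^+ n) <= (2 * rho) ^+ n / rho * normc (y - w).
Proof.
move=> rho0 yr wr; elim: n => [|n IH].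
  rewrite !expr0 subrr ComplexField.Normc.normc0 mulr_ge0 ?normc_ge0//.
  by rewrite mul1r invr_ge0 ltW.
have -> : y ^+ n.+1 - w ^+ n.+1 = y * (y ^+ n - w ^+ n) + w ^+ n * (y - w).
  by rewrite !exprS; ring.
apply: le_trans (le_normcD _ _) _; rewrite !ComplexField.Normc.normcM normcX.
apply: (@le_trans _ _ (rho * ((2 * rho) ^+ n / rho * normc (y - w)) +
    rho ^+ n * normc (y - w))).
  apply: lerD; first by apply: ler_pM => //; exact: normc_ge0.
  by rewrite ler_wpM2r ?normc_ge0// lerXn2r// ?nnegrE ?normc_ge0 ?ltW.
rewrite exprS; set q := (2 * rho) ^+ n; set N := normc (y - w).
have -> : rho * (q / rho * N) + rho ^+ n * N = (q + rho ^+ n) * N.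
  by field; rewrite gt_eqF.
have -> : 2 * rho * q / rho = q + q by field; rewrite gt_eqF.
rewrite ler_wpM2r ?normc_ge0// lerD2l lerXn2r ?nnegrE ?mulr_ge0 ?ltW//.
by rewrite ltr_pMl// ltr1n.
Qed.

(** The divided difference F[x,y,p] multiplied by (x - p) (y - p) (x - y), which clears all
    denominators and allows coinciding points. *)
Definition second_difference (F : C -> C) x y p :=
  (F x - F p) * (y - p) - (F y - F p) * (x - p).

(** Splitting off one factor x from the power leaves [(x - y) * (y ^+ n - p ^+ n) * (x - p)], which
    [normc_expB_le] controls. Both summands receive the same bound; their sum accounts for the
    factor 2 in each step. *)
Lemma normc_second_difference_exp (rho : R) x y p n : 0 < rho ->
  normc x <= rho -> normc y <= rho -> normc p <= rho ->
  normc (second_difference (fun z => z ^+ n) x y p) <=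
  (2 * rho) ^+ n / rho ^+ 2 * (normc (x - p) * normc (y - p) * normc (x - y)).
Proof.
move=> rho0 xr yr pr; set W := (X in _ * X).
have W0 : 0 <= W by rewrite !mulr_ge0 ?normc_ge0.
elim: n => [|n IH].
  rewrite /second_difference !expr0 subrr !mul0r subrr ComplexField.Normc.normc0.
  by rewrite mul1r mulr_ge0// invr_ge0 exprn_ge0// ltW.
have -> : second_difference (fun z => z ^+ n.+1) x y p =
    x * second_difference (fun z => z ^+ n) x y p +
    (x - y) * (y ^+ n - p ^+ n) * (x - p).
  by rewrite /second_difference !exprS; ring.
apply: le_trans (le_normcD _ _) _; rewrite !ComplexField.Normc.normcM.
set q := (2 * rho) ^+ n in IH *.
apply: (@le_trans _ _ (rho * (q / rho ^+ 2 * W) + q / rho * W)).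
  apply: lerD; first by apply: ler_pM => //; exact: normc_ge0.
  rewrite /W [X in _ <= q / rho * X]
    (_ : _ = normc (x - y) * normc (y - p) * normc (x - p)); last by ring.
  rewrite mulrA ler_wpM2r ?normc_ge0// mulrCA ler_wpM2l ?normc_ge0//.
  exact: normc_expB_le.
rewrite mulrA -mulrDl ler_wpM2r// [(2 * rho) ^+ n.+1]exprS -/q.
by rewrite le_eqVlt; apply/orP; left; apply/eqP; field; rewrite gt_eqF.
Qed.

(** This is all that Cauchy's formula uses of a power series: bounded first and second divided
    differences, uniformly for base points [p] near [p0] and not only at [p0]. *)
Definition locally_dd_bounded (F : C -> C) p0 := exists (K rho : R),
  [/\ 0 <= K, 0 < rho,
   (forall x p, normc (x - p0) < rho -> normc (p - p0) < rho ->
     normc (F x - F p) <= K * normc (x - p)) &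
   (forall x y p, normc (x - p0) < rho -> normc (y - p0) < rho -> normc (p - p0) < rho ->
     normc (second_difference F x y p) <=
     K * (normc (x - p) * normc (y - p) * normc (x - y)))].

Lemma cvg_series_normc_le (u : nat -> C) l (v : nat -> R) (M : R) :
  series u @ \oo --> l -> (forall n, normc (u n) <= v n) ->
  (forall n, series v n <= M) -> normc l <= M.
Proof.
move=> ul uv vM; have /cvgc_norm nul := ul; rewrite -(cvg_lim _ nul)//.
apply: limr_le; first by apply/cvg_ex; eexists; exact: nul.
apply: nearW => n /=; apply: le_trans (normc_series_le _ _) _; apply: le_trans (vM n).
by rewrite /series/=; apply: ler_sum => k _; exact: uv.
Qed.

Lemma power_series_dd_bounded (F : C -> C) p0 (r : R) (a : nat -> C) : 0 < r ->
  (forall z, normc (z - p0) < r ->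
    series (fun n => a n * (z - p0) ^+ n) @ \oo --> F z) ->
  locally_dd_bounded F p0.
Proof.
move=> r0 aF; pose rho0 := r / 2; have rho00 : 0 < rho0 by rewrite divr_gt0.
(* The series converges at [p0 + rho0%:C], strictly inside its disk, so its terms are bounded
   there. *)
have [B [B0 aB]] : exists B : R, 0 <= B /\ forall n, normc (a n) * rho0 ^+ n <= B.
  have : cvgn (series (fun n => a n * rho0%:C ^+ n)).
    apply/cvg_ex; exists (F (p0 + rho0%:C)).
    have := aF (p0 + rho0%:C); rewrite addrAC subrr add0r; apply.
    by rewrite normc_real gtr0_norm// /rho0 ltr_pdivrMr// ltr_pMr// ltr1n.
  move=> /cvg_series_cvg_0/cvgc_norm cv.
  have /cvg_seq_bounded/pinfty_ex_gt0[B B0 hB] : cvgn (fun n => normc (a n * rho0%:C ^+ n)).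
    by apply/cvg_ex; eexists; exact: cv.
  exists B; split; first exact: ltW.
  move=> n; have := hB n I; rewrite /= ger0_norm ?normc_ge0//.
  by rewrite ComplexField.Normc.normcM normcX normc_real gtr0_norm.
(* Since 2 rho = rho0 / 2, the factors [(2 * rho) ^+ n] of the estimates for powers turn into
   [B * (2^-1) ^+ n], with sum at most 2 B. *)
pose rho := rho0 / 4; have rho_gt0 : 0 < rho by rewrite divr_gt0.
have aB' n : normc (a n) * (2 * rho) ^+ n <= B * (2^-1) ^+ n.
  rewrite (_ : 2 * rho = rho0 * 2^-1); last by rewrite /rho; field.
  by rewrite exprMn mulrA ler_wpM2r// exprn_ge0.
have sB (k : R) n : 0 <= k -> series (fun j => B * (2^-1) ^+ j * k) n <= 2 * B * k.
  move=> k0; rewrite (_ : series _ n = series (fun j => (2^-1) ^+ j) n * (B * k)).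
    by rewrite -mulrA ler_wpM2r ?mulr_ge0// series_half_le.
  by rewrite /series/= mulr_suml; apply: eq_bigr => j _; rewrite mulrCA mulrA.
have rr z : normc (z - p0) < rho -> normc (z - p0) < r.
  move=> /lt_le_trans; apply; rewrite /rho /rho0; lra.
have ir : 0 <= rho^-1 by rewrite invr_ge0 ltW.
have ir2 : 0 <= (rho ^+ 2)^-1 by rewrite invr_ge0 exprn_ge0// ltW.
exists (2 * B * (rho^-1 + (rho ^+ 2)^-1)), rho; split => //.
- by apply: mulr_ge0; [exact: mulr_ge0|exact: addr_ge0].
- move=> x p xr pr; apply: (@le_trans _ _ (2 * B * (rho^-1 * normc (x - p)))); last first.
    rewrite -[leRHS]mulrA ler_wpM2l ?mulr_ge0// ler_wpM2r ?normc_ge0//.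
    by rewrite lerDl invr_ge0 exprn_ge0// ltW.
  apply: (@cvg_series_normc_le (fun n => a n * ((x - p0) ^+ n - (p - p0) ^+ n)) _
    (fun n => B * (2^-1) ^+ n * (rho^-1 * normc (x - p)))).
  + rewrite (_ : series _ = (series (fun n => a n * (x - p0) ^+ n)) \-
        (series (fun n => a n * (p - p0) ^+ n))).
      by apply: cvgB; apply: aF; exact: rr.
    apply/funext => n; rewrite /series/= -sumrB.
    by apply: eq_bigr => j _; rewrite mulrBr.
  + move=> n; rewrite ComplexField.Normc.normcM.
    have := @normc_expB_le rho (x - p0) (p - p0) n rho_gt0 (ltW xr) (ltW pr).
    have -> : x - p0 - (p - p0) = x - p by ring.
    move=> /(ler_wpM2l (normc_ge0 (a n))) /le_trans; apply.
    rewrite -[(2 * rho) ^+ n / rho * _]mulrA [leLHS]mulrA; apply: ler_wpM2r => //.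
    by rewrite mulr_ge0 ?normc_ge0.
  + by move=> n; apply: sB; rewrite mulr_ge0 ?normc_ge0.
- move=> x y p xr yr pr; set W := normc _ * _ * _.
  have W0 : 0 <= W by rewrite !mulr_ge0 ?normc_ge0.
  apply: (@le_trans _ _ (2 * B * ((rho ^+ 2)^-1 * W))); last first.
    rewrite -[leRHS]mulrA ler_wpM2l ?mulr_ge0// ler_wpM2r//.
    by rewrite lerDr invr_ge0 ltW.
  apply: (@cvg_series_normc_le (fun n => a n * second_difference (fun z => z ^+ n)
    (x - p0) (y - p0) (p - p0)) _
    (fun n => B * (2^-1) ^+ n * ((rho ^+ 2)^-1 * W))).
  + rewrite (_ : series _ = fun n =>
      (series (fun n => a n * (x - p0) ^+ n) n - series (fun n => a n * (p - p0) ^+ n) n) * (y - p)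
    - (series (fun n => a n * (y - p0) ^+ n) n - series (fun n => a n * (p - p0) ^+ n) n)
      * (x - p)).
      by apply: cvgB; apply: cvgMr_tmp; apply: cvgB; apply: aF; exact: rr.
    apply/funext => n; rewrite /series/= -!sumrB !mulr_suml -sumrB.
    apply: eq_bigr => j _; rewrite /second_difference; ring.
  + move=> n; rewrite ComplexField.Normc.normcM.
    have := @normc_second_difference_exp rho (x - p0) (y - p0) (p - p0) n
      rho_gt0 (ltW xr) (ltW yr) (ltW pr).
    have e z z' : z - p0 - (z' - p0) = z - z' by ring.
    rewrite !e -/W => /(ler_wpM2l (normc_ge0 (a n))) /le_trans; apply.
    rewrite -[(2 * rho) ^+ n / _ * _]mulrA [leLHS]mulrA; apply: ler_wpM2r => //.
    by rewrite mulr_ge0.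
  + by move=> n; apply: sB; rewrite mulr_ge0.
Qed.

Lemma dd_bounded_continuous (F : C -> C) p0 : locally_dd_bounded F p0 -> F @ p0 --> F p0.
Proof.
move=> [K [rho [K0 rho0 lip _]]]; apply: (proj2 (@cvgcP _ _ (nbhs p0) _ F (F p0))).
apply/cvgrPdist_lt => e e0.
have K1 : 0 < K + 1 by rewrite ltr_wpDl.
have eK : 0 < e / (K + 1) by rewrite divr_gt0.
move: (near_normc p0 rho0) (near_normc p0 eK); apply: filterS2 => z zr ze.
rewrite sub0r normrN ger0_norm ?normc_ge0//.
apply: (le_lt_trans (lip z p0 zr _)).
  by rewrite subrr ComplexField.Normc.normc0.
apply: (@le_lt_trans _ _ ((K + 1) * normc (z - p0))).
  by rewrite ler_wpM2r ?normc_ge0// lerDl.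
by rewrite mulrC -ltr_pdivlMr.
Qed.

End LocalPowerSeries.

Section NormalSeries.
Variable R : realType.
Local Notation C := R[i].

Lemma cmean_normal_series (f : nat -> circle R -> C) g (v : nat -> R) :
  (forall n, L1 (f n)) -> (forall n x, normc (f n x) <= v n) -> cvgn (series v) ->
  (forall x, series (fun n => f n x) @ \oo --> g x) ->
  series (fun n => cmean (f n)) @ \oo --> cmean g.
Proof.
move=> Lf fv cv fg; have [|_ [s [_ fs ss _]]] := L1_series Lf.
  apply: series_le_cvg cv => n; first exact: L1norm_ge0.
    exact: le_trans (normc_ge0 _) (fv n (expi 0)).
  apply: (le_trans (L1norm_le (Lf n) (rintegrable_cst (v n)) _)).
    by apply: ae_circleW => x; exact: fv.
  by rewrite mean_cst.
rewrite (ae_cmean (g := s))//; apply: ae_circleS fs => x.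
by apply: cvg_unique; [exact: norm_hausdorff|exact: fg].
Qed.

Lemma cvg_geometric_real (z : R) : 0 <= z -> z < 1 -> cvgn (series (fun n => z ^+ n)).
Proof.
move=> z0 z1; rewrite (_ : (fun n => z ^+ n) = geometric 1 z); last first.
  by apply/funext => n /=; rewrite mul1r.
by apply: is_cvg_geometric_series; rewrite ger0_norm.
Qed.

Lemma cvg_series_delta0 (u : nat -> C) : (forall n, u n.+1 = 0) ->
  series u @ \oo --> u 0%N.
Proof.
move=> u0; apply: cvg_near_cst; exists 1%N => // -[//|n] _.
by rewrite /series/= big_nat_recl// big1 ?addr0// => i _; rewrite u0.
Qed.
End NormalSeries.

(** A quadratic bound on the increments, with constants depending on the point, forces the
    derivative to vanish there; the mean value theorem does the rest. *)
Lemma quadratic_increment_cst (R : realType) (f : R -> R) (a b : R) :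
  (forall s, a < s -> s < b -> exists K eta : R, 0 < eta /\
    forall s', `|s' - s| < eta -> `|f s' - f s| <= K * `|s' - s| ^+ 2) ->
  forall s s', a < s -> s < s' -> s' < b -> f s = f s'.
Proof.
move=> quad.
have df s : a < s -> s < b -> is_derive s 1 f 0.
  move=> as_ sb; have [K [eta [eta0 H]]] := quad s as_ sb.
  suff cf : h^-1 *: ((f \o shift s) (h *: 1) - f s) @[h --> 0^'] --> (0 : R).
    apply: DeriveDef; first by apply/cvg_ex; exists 0.
    exact: cvg_lim.
  apply/cvgrPdist_lt => e e0.
  have K1 : 0 < `|K| + 1 by rewrite ltr_wpDl.
  have eK : 0 < e / (`|K| + 1) by rewrite divr_gt0.
  near=> h.
  have h0 : h != 0 by near: h; exact: nbhs_dnbhs_neq.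
  have heta : `|h| < eta by near: h; exact: dnbhs0_lt.
  have he : `|h| < e / (`|K| + 1) by near: h; exact: dnbhs0_lt.
  rewrite sub0r normrN /= normrZ normfV scaler1 ltr_pdivrMl ?normr_gt0//.
  have := H (h + s); rewrite addrK => /(_ heta) /le_lt_trans; apply.
  rewrite expr2 mulrCA ltr_pM2l ?normr_gt0//.
  apply: (@le_lt_trans _ _ ((`|K| + 1) * `|h|)).
    by rewrite ler_wpM2r// (le_trans (ler_norm K))// lerDl.
  by rewrite mulrC -ltr_pdivlMr.
move=> s s' as_ ss' s'b.
have sub x : s <= x -> x <= s' -> a < x /\ x < b.
  by move=> sx xs; split; [exact: lt_le_trans sx|exact: le_lt_trans s'b].
have [||c _] := @MVT R f (fun=> 0) s s' ss'.
- move=> x; rewrite in_itv/= => /andP[sx xs'].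
  by have [ax xb] := sub x (ltW sx) (ltW xs'); exact: df.
- apply: derivable_within_continuous => x; rewrite in_itv/= => /andP[sx xs'].
  by have [ax xb] := sub x sx xs'; have [] := df x ax xb.
by rewrite mul0r => /eqP; rewrite subr_eq0 => /eqP ->.
Unshelve. all: by end_near. Qed.

Section CauchyFormula.
Variable R : realType.
Local Notation C := R[i].
Variables (F : C -> C) (M : R) (w : C) (r : R).
Hypothesis ddF : forall p, normc p < 1 -> locally_dd_bounded F p.
Hypothesis FM : forall p, normc p < 1 -> normc (F p) <= M.
Hypothesis wr : normc w < r.
Hypothesis r1 : r < 1.

Let r0 : 0 < r. Proof. exact: le_lt_trans (normc_ge0 w) wr. Qed.

Let zeta (x : circle R) : C := r%:C * val x.

Let normc_zeta x : normc (zeta x) = r.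
Proof. by rewrite ComplexField.Normc.normcM normc_circle mulr1 normc_real gtr0_norm. Qed.

Let zetaBw_neq0 x : zeta x - w != 0.
Proof.
rewrite subr_eq0; apply: contraTneq wr => <-.
by rewrite normc_zeta ltxx.
Qed.

Let normc_zetaBw x : normc (zeta x - w) <= 2.
Proof.
apply: le_trans (le_normcD _ _) _; rewrite normcN normc_zeta.
by rewrite (_ : 2 = 1 + 1)// lerD ?ltW// (lt_trans wr).
Qed.

(** The Cauchy kernel dzeta / (2 pi i (zeta - w)) written against normalized arc length. *)
Let k x := zeta x / (zeta x - w).

Let zeta_continuous : circle_continuous zeta.
Proof. exact: circle_continuousM (@circle_continuous_cst R r%:C) (@continuous_expi R). Qed.

Let k_continuous : circle_continuous k.
Proof.
have c := circle_continuousD zeta_continuous (@circle_continuous_cst R (- w)).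
exact: circle_continuousM zeta_continuous (circle_continuousV zetaBw_neq0 c).
Qed.

(** The kernel is the geometric series in w / zeta, of which only the constant term has nonzero
    mean. *)
Lemma cauchy_kernel_mean : cmean k = 1.
Proof.
pose q := w / r%:C.
have q1 : normc q < 1.
  rewrite ComplexField.Normc.normcM ComplexField.Normc.normcV normc_real gtr0_norm//.
  by rewrite ltr_pdivrMr// mul1r.
have rC0 : r%:C != 0 by rewrite -normc_gt0 normc_real normr_gt0 gt_eqF.
have cV := circle_continuousV (@circle_neq0 R) (@continuous_expi R).
have c n : circle_continuous (fun x : circle R => (val x)^-1 ^+ n * q ^+ n).
  exact: circle_continuousM (@circle_continuousX R _ n cV) (@circle_continuous_cst R (q ^+ n)).
have := @cmean_normal_series _ (fun n x => (val x)^-1 ^+ n * q ^+ n) k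
  (fun n => normc q ^+ n) (fun n => L1_continuous (c n)).
have -> : (fun n => cmean (fun x : circle R => (val x)^-1 ^+ n * q ^+ n)) =
    fun n => (n == 0%N)%:R.
  apply/funext => n; rewrite cmeanZ ?cmean_expV.
    by case: n => [|n]; rewrite ?mul0r// expr0 mulr1.
  exact: L1_continuous (@circle_continuousX R _ n cV).
move=> h; have d : series (fun n => (n == 0%N)%:R : C) @ \oo --> (1 : C).
  exact: (@cvg_series_delta0 _ (fun n => (n == 0%N)%:R)).
apply: cvg_unique d; first exact: norm_hausdorff.
apply: h.
- move=> n x; rewrite ComplexField.Normc.normcM !normcX ComplexField.Normc.normcV.
  by rewrite normc_circle invr1 expr1n mul1r.
- exact: cvg_geometric_real (normc_ge0 _) q1.
- move=> x; under eq_fun do rewrite -exprMn.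
  have -> : k x = (1 - (val x)^-1 * q)^-1.
    have z0 : zeta x != 0 by rewrite mulf_neq0// circle_neq0.
    rewrite /k (_ : zeta x - w = zeta x * (1 - (val x)^-1 * q)); last first.
      by rewrite /zeta /q; field; rewrite ?circle_neq0 ?rC0.
    by rewrite invfM mulrA mulfV// mul1r.
  apply: cvg_cgeometric; rewrite ComplexField.Normc.normcM ComplexField.Normc.normcV.
  by rewrite normc_circle invr1 mul1r.
Qed.

Let path (s : R) x := w + s%:C * (zeta x - w).

(** The segments are prolonged slightly beyond the circle of radius r, still inside the unit disk,
    so that s = 1 is an interior parameter. *)
Let s1 := 1 + (1 - r) / 2.

Let normc_path s x : 0 <= s -> s < s1 -> normc (path s x) < 1.
Proof.
move=> s0 ss1; have -> : path s x = (1 - s)%:C * w + s%:C * zeta x.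
  by rewrite /path rmorphB /=; ring.
apply: le_lt_trans (le_normcD _ _) _.
rewrite [X in X + _]ComplexField.Normc.normcM [X in _ + X]ComplexField.Normc.normcM.
rewrite normc_zeta !normc_real (ger0_norm s0).
have w0 := normc_ge0 w; have := wr; move: (normc w) w0 => W W0 Wr.
have : (1 - r) * r < 1 - r by rewrite gtr_pMr ?subr_gt0.
move=> rr; rewrite /s1 in ss1; have [s_1|s_1] := leP s 1.
  rewrite ger0_norm ?subr_ge0//.
  have : (1 - s) * W <= (1 - s) * r by rewrite ler_wpM2l ?subr_ge0// ltW.
  by have := r1; lra.
rewrite ltr0_norm ?subr_lt0//.
have h1 : (s - 1) * W <= s - 1 by rewrite ler_piMr ?subr_ge0 ?(ltW s_1)//; lra.
have h2 : s * r <= (1 + (1 - r) / 2) * r by rewrite ler_wpM2r ?(ltW r0)// ltW.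
have := r1; lra.
Qed.

Let F_continuous p : normc p < 1 -> F @ p --> F p.
Proof. by move=> p1; apply: dd_bounded_continuous; exact: ddF. Qed.

Let path_continuous s : circle_continuous (path s).
Proof.
have c := circle_continuousD zeta_continuous (@circle_continuous_cst R (- w)).
exact: circle_continuousD (@circle_continuous_cst R w)
   (circle_continuousM (@circle_continuous_cst R s%:C) c).
Qed.

Let Fpath_continuous s : 0 <= s -> s < s1 -> circle_continuous (fun x => F (path s x)).
Proof.
move=> s0 ss1 t; apply: (@cvg_comp _ _ _ (fun t => path s (expi t)) F).
  exact: path_continuous.
by apply: F_continuous; exact: normc_path.
Qed.

(** A single number N serves as constant and as inverse radius. Both conditions become weaker
    requirements on [F] as N grows, so compactness of the parameter interval makes the local
    constants uniform. *)
Let uniform_second_difference s : 0 <= s -> s < s1 ->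
  exists N : nat, forall t : R, `[0, 2 * pi]%classic t -> forall X Y,
    normc (X - path s (expi t)) < N.+1%:R^-1 ->
    normc (Y - path s (expi t)) < N.+1%:R^-1 ->
    normc (second_difference F X Y (path s (expi t))) <= N%:R *
      (normc (X - path s (expi t)) * normc (Y - path s (expi t)) * normc (X - Y)).
Proof.
move=> s0 ss1.
have /compact_near_coveringP ncov := @segment_compact R 0 (2 * pi).
have [|N _ hN] := ncov nat \oo (fun N t => forall X Y,
    normc (X - path s (expi t)) < N.+1%:R^-1 ->
    normc (Y - path s (expi t)) < N.+1%:R^-1 ->
    normc (second_difference F X Y (path s (expi t))) <= N%:R *
      (normc (X - path s (expi t)) * normc (Y - path s (expi t)) * normc (X - Y))) _; last first.
  by exists N => t It; exact: (hN N (leqnn N) t It).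
move=> t It; have [K [rho [K0 rho0 _ dd]]] := ddF (normc_path (expi t) s0 ss1).
have rho2 : 0 < rho / 2 by rewrite divr_gt0.
have near_t : \forall t' \near t, normc (path s (expi t') - path s (expi t)) < rho / 2.
  exact: (@path_continuous s t _ (near_normc (path s (expi t)) rho2)).
have near_N : \forall N \near \oo, K <= N%:R /\ N.+1%:R^-1 < rho / 2.
  near=> N; split; first by near: N; exact: nbhs_infty_ger.
  rewrite invf_plt ?posrE//.
  have : (rho / 2)^-1 <= N%:R by near: N; exact: nbhs_infty_ger.
  by move=> /le_lt_trans; apply; rewrite ltr_nat.
near=> t' N => X Y XN YN.
have [KN Nrho] : K <= N%:R /\ N.+1%:R^-1 < rho / 2 by near: N.
have pt : normc (path s (expi t') - path s (expi t)) < rho / 2 by near: t'.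
have tri Z : normc (Z - path s (expi t')) < N.+1%:R^-1 -> normc (Z - path s (expi t)) < rho.
  move=> ZN; rewrite -(subrK (path s (expi t')) Z) -addrA [rho]splitr.
  by apply: le_lt_trans (le_normcD _ _) _; rewrite ltrD// (lt_trans ZN).
apply: (le_trans (dd _ _ _ (tri _ XN) (tri _ YN) _)).
  by apply: lt_trans pt _; rewrite ltr_pdivrMr// ltr_pMr// ltr1n.
by rewrite ler_wpM2r// !mulr_ge0 ?normc_ge0.
Unshelve. all: by end_near. Qed.

Let small_rotation (e : R) : 0 < e -> exists d : R,
  [/\ 0 <= d, d <= 2 * pi, val (expi d) - 1 != 0 & normc (val (expi d) - 1) <= e].
Proof.
move=> e0; have /cvgcP/cvgrPdist_lt/(_ _ e0) := @continuous_expi R 0.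
(* The bound d <= 1 < pi makes sin d positive, so the rotation is not the identity. *)
move=> /nbhs_ballP[a /= a0 ha]; pose d := Num.min (a / 2) 1.
have d0 : 0 < d by rewrite lt_min divr_gt0//=.
have d1 : d <= 1 by rewrite ge_min lexx orbT.
have pi2 := @pi_ge2 R.
exists d; split; first exact: ltW.
- by apply: le_trans d1 _; lra.
- apply/eqP => /(congr1 (@complex.Im R)) /=; rewrite oppr0 addr0 => sd.
  have : 0 < sin d by apply: sin_gt0_pi; apply/andP; split => //; lra.
  by rewrite sd ltxx.
have : ball (0 : R) a d.
  rewrite /ball/= sub0r normrN gtr0_norm// /d gt_min; apply/orP; left.
  by rewrite ltr_pdivrMr// ltr_pMr// ltr1n.
move=> /ha; rewrite sub0r normrN ger0_norm ?normc_ge0// => h.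
have {h} : normc (val (expi d) - val (expi 0)) < e by exact: h.
by rewrite val_expi0 => /ltW.
Qed.

(** At s = 1 this is the Cauchy integral, and as s tends to 0 it tends to F w, the kernel having
    mean 1. *)
Let phi s := cmean (fun x => F (path s x) * k x).

Let L1_Fk s : 0 <= s -> s < s1 -> L1 (fun x => F (path s x) * k x).
Proof.
by move=> s0 ss; exact: L1_continuous (circle_continuousM (Fpath_continuous s0 ss) k_continuous).
Qed.

(** Formally, the derivative of the integrand in s is F' at the path times zeta, which up to a
    factor is the derivative along rotations and has mean zero. Here finite differences replace both
    derivatives, and their mismatch is a second difference of F. *)
Let phi_quadratic s : 0 < s -> s < s1 -> exists K eta : R, 0 < eta /\
  forall s', `|s' - s| < eta -> normc (phi s' - phi s) <= K * `|s' - s| ^+ 2.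
Proof.
move=> s0 ss1; have [N hN] := uniform_second_difference (ltW s0) ss1.
have N10 : 0 < N.+1%:R^-1 :> R by rewrite invr_gt0 ltr0n.
(* The 4 comes from |X - Y| <= 4 |s' - s| below. The first radius brings X and Y within reach of the
   uniform estimate; the other two keep s' between 0 and s1. *)
exists (4 * N%:R), (Num.min (N.+1%:R^-1 / 2) (Num.min s (s1 - s))); split.
  by rewrite !lt_min s0 subr_gt0 ss1 divr_gt0.
move=> s'; rewrite !lt_min => /and3P[sN].
rewrite ltr_norml => /andP[s'0 _]; rewrite ltr_norml => /andP[_ s's1].
have {}s'0 : 0 < s' by lra.
have {}s's1 : s' < s1 by lra.
have [->|ss'] := eqVneq s' s.
  by rewrite !subrr normr0 ComplexField.Normc.normc0 expr0n mulr0.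
have ds0 : 0 < `|s' - s| by rewrite normr_gt0 subr_eq0.
(* The rotation is at most as large as the step in s, so that the moved points X and Y both stay
   within 2 |s' - s| of p. *)
have [d [d0 dpi e0 eds]] := small_rotation ds0.
set e := val (expi d) - 1 in e0 eds.
have sC0 : s%:C != 0 by rewrite -normc_gt0 normc_real normr_gt0 gt_eqF.
pose gd x := F (path s (circle_mul x (expi d))).
(* The second line subtracts a multiple of the rotation difference; it has mean zero, so [A] has
   mean phi s' - phi s. The coefficient is chosen to cancel the first-order part of the first
   line. *)
pose A x := F (path s' x) * k x + F (path s x) * k x * (-1)
  + (gd x + F (path s x) * (-1)) * (- ((s' - s)%:C / (s%:C * e))).
have cg := Fpath_continuous (ltW s0) ss1.
have cgd : circle_continuous gd.
  rewrite /circle_continuous (_ : (fun t => gd (expi t)) =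
    (fun t => F (path s (expi t))) \o (fun t => t + d)).
    move=> t; apply: continuous_comp; last exact: cg.
    by apply: cvgD; [exact: cvg_id|exact: cvg_cst].
  by apply/funext => t; rewrite /gd/= expiD.
have Lg := L1_continuous cg; have Lgd := L1_continuous cgd.
have La := L1_Fk (ltW s0) ss1; have La' := L1_Fk (ltW s'0) s's1.
have LA1 := L1D La' (L1Z (-1) La).
have LA2 := L1D Lgd (L1Z (-1) Lg).
have LA : L1 A := L1D LA1 (L1Z _ LA2).
have -> : phi s' - phi s = cmean A.
  rewrite (cmeanD LA1 (L1Z _ LA2)) (cmeanD La' (L1Z _ La)) cmeanZ// cmeanZ//.
  rewrite (cmeanD Lgd (L1Z _ Lg)) (cmeanZ _ Lg) (@cmean_rotation _ (fun x => F (path s x)))//.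
  by rewrite !mulrN1 subrr mul0r addr0.
apply: le_trans (normc_cmean LA) _.
apply: (le_trans (L1norm_le LA (rintegrable_cst (4 * N%:R * `|s' - s| ^+ 2)) _)); last first.
  by rewrite mean_cst.
apply: aeW => t It; set x := expi t; pose p := path s x.
pose X := path s' x; pose Y := path s (circle_mul x (expi d)).
have Xp : X - p = (s' - s)%:C * (zeta x - w) by rewrite /X /p /path rmorphB /=; ring.
have Yp : Y - p = s%:C * zeta x * e.
  by rewrite /Y /p /path /e /zeta /=; ring.
have nXp : normc (X - p) = `|s' - s| * normc (zeta x - w).
  by rewrite Xp ComplexField.Normc.normcM normc_real.
have nYp : normc (Y - p) = s * r * normc e.
  by rewrite Yp 2!ComplexField.Normc.normcM normc_zeta normc_real gtr0_norm.
have s2 : s <= 2 by have := r0; move: ss1; rewrite /s1; lra.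
have sr2 : s * r <= 2 by rewrite -[leRHS]mulr1; apply: ler_pM => //; exact: ltW.
have nXp2 : normc (X - p) <= 2 * `|s' - s|.
  by rewrite nXp mulrC ler_wpM2r.
have nYp2 : normc (Y - p) <= 2 * `|s' - s|.
  by rewrite nYp ler_pM ?normc_ge0// mulr_ge0// ltW.
have nXY : normc (X - Y) <= 4 * `|s' - s|.
  have -> : X - Y = (X - p) - (Y - p) by ring.
  by apply: le_trans (le_normcD _ _) _; rewrite normcN; lra.
(* The denominators cancel against X - p and Y - p, leaving a bound that depends neither on the
   rotation nor on the distance from zeta to w. *)
have AE : A x = second_difference F X Y p / ((zeta x - w) * (s%:C * e)).
  rewrite /A -/gd /gd -/X -/Y -/p /k /second_difference Xp Yp; field.
  by rewrite e0 sC0 zetaBw_neq0.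
have zw0 : 0 < normc (zeta x - w) by rewrite normc_gt0.
have ne0 : 0 < normc e by rewrite normc_gt0.
rewrite AE ComplexField.Normc.normcM ComplexField.Normc.normcV 2!ComplexField.Normc.normcM.
rewrite normc_real (gtr0_norm s0) ler_pdivrMr; last by rewrite !mulr_gt0.
have dsN : 2 * `|s' - s| < N.+1%:R^-1 by rewrite mulrC -ltr_pdivlMr.
have hX : normc (X - p) < N.+1%:R^-1 by exact: le_lt_trans nXp2 dsN.
have hY : normc (Y - p) < N.+1%:R^-1 by exact: le_lt_trans nYp2 dsN.
apply: (le_trans (hN t It X Y hX hY)).
rewrite -/x -/p nXp nYp.
have -> : 4 * N%:R * `|s' - s| ^+ 2 * (normc (zeta x - w) * (s * normc e)) =
  N%:R * (`|s' - s| * normc (zeta x - w) * (s * 1 * normc e) * (4 * `|s' - s|)) by ring.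
rewrite ler_wpM2l//; apply: ler_pM => //; rewrite ?mulr_ge0 ?normc_ge0 ?(ltW s0) ?(ltW r0)//.
rewrite ler_wpM2l ?mulr_ge0 ?normc_ge0// ler_wpM2r ?normc_ge0// ler_wpM2l ?(ltW s0)//.
exact: ltW.
Qed.

Let phi_cst s s' : 0 < s -> s < s' -> s' < s1 -> phi s = phi s'.
Proof.
move=> s0 ss' s's1; apply/eqP; rewrite eq_complex; apply/andP; split; apply/eqP.
  apply: (@quadratic_increment_cst R (fun s => complex.Re (phi s)) 0 s1) => // u u0 us.
  have [K [eta [eta0 H]]] := phi_quadratic u0 us; exists K, eta; split=> // u' /H.
  apply: le_trans; apply: le_trans (le_Re_normc _).
  by case: (phi u') (phi u) => [? ?] [].
apply: (@quadratic_increment_cst R (fun s => complex.Im (phi s)) 0 s1) => // u u0 us.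
have [K [eta [eta0 H]]] := phi_quadratic u0 us; exists K, eta; split=> // u' /H.
apply: le_trans; apply: le_trans (le_Im_normc _).
by case: (phi u') (phi u) => [? ?] [].
Qed.

Lemma cauchy_formula : cmean (fun x => F (zeta x) * k x) = F w.
Proof.
have s11 : 1 < s1 by rewrite ltrDl divr_gt0 ?subr_gt0.
have -> : cmean (fun x => F (zeta x) * k x) = phi 1.
  by congr cmean; apply/funext => x; rewrite /path mul1r addrC subrK.
have w1 : normc w < 1 by exact: lt_trans r1.
(* Constancy of [phi] is known for 0 < s only, so the value at 0 is reached along a sequence; the
   shift by 2 keeps it strictly below 1. *)
pose a (n : nat) : R := n.+2%:R^-1.
have a0 n : 0 < a n by rewrite invr_gt0 ltr0n.
have a1 n : a n < 1 by rewrite invf_lt1 ?ltr0n// ltr1n.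
have phia n : phi (a n) = phi 1 by apply: phi_cst.
have ca : a @ \oo --> (0 : R).
  by have := @cvg_harmonic R; rewrite -cvg_shiftS.
have M0 : 0 <= M := le_trans (normc_ge0 _) (FM w1).
have kB : exists B : R, forall x, normc (k x) <= B.
  exists ((r - normc w)^-1) => x.
  rewrite /k ComplexField.Normc.normcM ComplexField.Normc.normcV normc_zeta.
  have h : r - normc w <= normc (zeta x - w).
    by rewrite lerBlDr -(normc_zeta x); have := le_normcD (zeta x - w) w; rewrite subrK.
  have d0 : 0 < r - normc w by rewrite subr_gt0.
  rewrite -[leRHS]mul1r; apply: ler_pM; rewrite ?invr_ge0 ?normc_ge0 ?(ltW r0) ?(ltW r1)//.
  by rewrite lef_pV2// ?posrE// (lt_le_trans d0).
have [B kB'] := kB.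
have lim : (fun n => cmean (fun x => F (path (a n) x) * k x)) @ \oo -->
    cmean (fun x => F w * k x).
  apply: (@dominated_cmean _ _ _ (fun=> M * B)).
  - move=> n; apply: L1_cmeasurable; apply: L1_Fk; first exact: ltW.
    exact: lt_trans (a1 n) s11.
  - apply: L1_cmeasurable; apply: L1_continuous.
    exact: circle_continuousM (@circle_continuous_cst R (F w)) k_continuous.
  - exact: rintegrable_cst.
  - apply: ae_circleW => x; apply: cvgMr_tmp.
    apply: (@cvg_comp _ _ _ (fun n => path (a n) x) F); last exact: F_continuous.
    apply/cvgcP.
    under eq_fun do rewrite /path addrAC subrr add0r ComplexField.Normc.normcM normc_real.
    have h : (fun n => `|a n| * normc (zeta x - w)) @ \oo --> `|0 : R| * normc (zeta x - w).
      have hn : (fun n => `|a n|) @ \oo --> `|0 : R| by apply: cvg_norm.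
      exact: (@cvgMr_tmp R nat \oo _ _ _ _ hn).
    by rewrite normr0 mul0r in h; exact: h.
  - apply: ae_circleW => x n; rewrite ComplexField.Normc.normcM.
    apply: ler_pM; rewrite ?normc_ge0//; apply: FM; apply: normc_path; first exact: ltW.
    exact: lt_trans (a1 n) s11.
have -> : F w = cmean (fun x => F w * k x).
  under eq_fun do rewrite mulrC.
  by rewrite cmeanZ ?cauchy_kernel_mean ?mul1r//; exact: L1_continuous.
have eq : (fun n => cmean (fun x => F (path (a n) x) * k x)) = fun=> phi 1.
  by apply/funext => n; rewrite -(phia n).
rewrite eq in lim.
by apply: cvg_unique lim; [exact: norm_hausdorff|exact: cvg_cst].
Qed.

End CauchyFormula.

(** * Boundary functions of bounded analytic functions *)

Section HinfTaylor.
Variable R : realType.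
Local Notation C := R[i].
Implicit Types (h : Hinf R) (z w : C).

Lemma diskE z : (z \in disk R) = (normc z < 1).
Proof. by rewrite -ltcR; apply/idP/idP => [/set_mem//|z1]; exact/mem_set. Qed.

Lemma normc_disk (d : disk R) : normc (val d) < 1.
Proof. by rewrite -diskE; exact: valP. Qed.

Definition extension h : C -> C := 'valL_0 h.

Lemma extensionE h (d : disk R) : extension h (val d) = h d.
Proof. exact: (congr1 (@^~ d) (valLK 0 (h : disk R -> C))). Qed.

Lemma diskP z : normc z < 1 -> exists d : disk R, val d = z.
Proof. by rewrite -diskE => zd; exists (SigSub zd). Qed.

Lemma normc_extension h z : normc z < 1 -> normc (extension h z) <= supnorm h.
Proof. by move=> /diskP[d <-]; rewrite extensionE; exact: le_supnorm. Qed.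

Lemma extension_dd_bounded h z : normc z < 1 -> locally_dd_bounded (extension h) z.
Proof.
move=> /[dup] z1 /diskP[d dz]; have /asboolP/(_ d)[a [r [r0 ar]]] := valP h.
have z10 : 0 < 1 - normc z by rewrite subr_gt0.
(* The given expansion is assumed for points of the disk only; the smaller radius keeps the whole
   neighbourhood of z inside it, away from the zero extension. *)
apply: (@power_series_dd_bounded _ _ _ (Num.min r (1 - normc z)) a).
  by rewrite lt_min r0.
move=> w; rewrite lt_min => /andP[wr wz].
have /diskP[e ew] : normc w < 1.
  rewrite -(subrK z w); apply: le_lt_trans (le_normcD _ _) _.
  by rewrite -ltrBrDr.
by rewrite -ew extensionE -dz; apply: ar; rewrite ew dz.
Qed.

Lemma extension_continuous h z : normc z < 1 -> extension h w @[w --> z] --> extension h z.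
Proof. by move=> z1; apply: dd_bounded_continuous; exact: extension_dd_bounded. Qed.

Definition dilation h (r : R) (x : circle R) : C := extension h (r%:C * val x).

Lemma normc_dilation_arg (r : R) (x : circle R) : 0 <= r -> normc (r%:C * val x) = r.
Proof.
by move=> r0; rewrite ComplexField.Normc.normcM normc_circle mulr1 normc_real ger0_norm.
Qed.

Lemma dilation_continuous h (r : R) : 0 <= r -> r < 1 -> circle_continuous (dilation h r).
Proof.
move=> r0 r1 t; apply: (@cvg_comp _ _ _ (fun t => r%:C * val (expi t)) (extension h)).
  exact: (circle_continuousM (@circle_continuous_cst R r%:C) (@continuous_expi R)).
by apply: extension_continuous; rewrite normc_dilation_arg.
Qed.

Lemma normc_dilation h (r : R) x : 0 <= r -> r < 1 -> normc (dilation h r x) <= supnorm h.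
Proof. by move=> r0 r1; apply: normc_extension; rewrite normc_dilation_arg. Qed.

Lemma circle_continuousXV n : circle_continuous (fun x : circle R => (val x)^-1 ^+ n).
Proof.
exact: (@circle_continuousX R _ n (circle_continuousV (@circle_neq0 R) (@continuous_expi R))).
Qed.

Lemma circle_continuous_exp n : circle_continuous (fun x : circle R => val x ^+ n).
Proof. exact: (@circle_continuousX R _ n (@continuous_expi R)). Qed.

Lemma normc_circleXV (x : circle R) n : normc ((val x)^-1 ^+ n) = 1.
Proof. by rewrite normcX ComplexField.Normc.normcV normc_circle invr1 expr1n. Qed.

Lemma normc_circleX (x : circle R) n : normc (val x ^+ n) = 1.
Proof. by rewrite normcX normc_circle expr1n. Qed.

Section AbsolutelyConvergent.
Variables (c : nat -> C) (g : circle R -> C).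
Hypothesis sc : cvgn (series (fun n => normc (c n))).
Hypothesis cg : forall x, series (fun n => c n * val x ^+ n) @ \oo --> g x.

Let cx_continuous n : circle_continuous (fun x : circle R => c n * val x ^+ n).
Proof. exact: (circle_continuousM (@circle_continuous_cst R (c n)) (@circle_continuous_exp n)). Qed.

Lemma abs_power_series_cmeasurable : cmeasurable g.
Proof.
apply: (cmeasurable_cvg _ cg) => n; apply: cmeasurable_series => k.
by apply/L1_cmeasurable/L1_continuous; exact: cx_continuous.
Qed.

Lemma normc_abs_power_series x : normc (g x) <= limn (series (fun n => normc (c n))).
Proof.
apply: (cvg_series_normc_le (@cg x) (v := fun n => normc (c n))) => n.
  by rewrite ComplexField.Normc.normcM normc_circleX mulr1.
by apply: le_series_lim => // k; exact: normc_ge0.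
Qed.

Lemma abs_power_series_L1 : L1 g.
Proof.
apply: (L1_bounded abs_power_series_cmeasurable); apply: ae_circleW => x.
exact: normc_abs_power_series.
Qed.

Lemma abs_power_series_cvgM (e : circle R -> C) : circle_continuous e ->
  (forall x, normc (e x) = 1) ->
  series (fun n => c n * cmean (fun x => val x ^+ n * e x)) @ \oo -->
  cmean (fun x => g x * e x).
Proof.
move=> ce e1; have Le n := L1_continuous (circle_continuousM (@circle_continuous_exp n) ce).
rewrite (_ : (fun n => _) = fun n => cmean (fun x => val x ^+ n * e x * c n)); last first.
  by apply/funext => n; rewrite cmeanZ// mulrC.
apply: (@cmean_normal_series _ (fun n x => val x ^+ n * e x * c n)
  (fun x => g x * e x) (fun n => normc (c n)) _ _ sc).
- by move=> n; exact: L1Z.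
- move=> n x; rewrite 2!ComplexField.Normc.normcM e1 mulr1.
  by rewrite normc_circleX mul1r.
- move=> x; rewrite (_ : series _ = fun n => series (fun k => c k * val x ^+ k) n * e x).
    by apply: cvgMr_tmp; exact: cg.
  apply/funext => n; rewrite /series/= mulr_suml; apply: eq_bigr => k _.
  by rewrite mulrC mulrA.
Qed.

Lemma cvg_series_delta (v : C) m :
  series (fun n => (n == m)%:R * v) @ \oo --> v.
Proof.
apply: cvg_near_cst; exists m.+1 => // n /= mn.
rewrite /series/= (bigD1_seq m)/= ?iota_uniq//; last by rewrite mem_index_iota.
by rewrite eqxx mul1r big1 ?addr0// => i /negbTE ->; rewrite mul0r.
Qed.

Lemma abs_power_series_moment m : cmean (fun x => g x * (val x)^-1 ^+ m) = c m.
Proof.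
have := abs_power_series_cvgM (@circle_continuousXV m) (fun x => normc_circleXV x m).
rewrite (_ : (fun n => _) = fun n => (n == m)%:R * c m); last first.
  apply/funext => n; rewrite cmean_expM.
  by case: eqP => [->|_]; rewrite ?mulr1 ?mul1r// mulr0 mul0r.
move=> h; apply: cvg_unique h _; first exact: norm_hausdorff.
exact: cvg_series_delta.
Qed.

Lemma abs_power_series_neg_moment m : cmean (fun x => g x * val x ^+ m.+1) = 0.
Proof.
have := abs_power_series_cvgM (@circle_continuous_exp m.+1) (fun x => normc_circleX x m.+1).
rewrite (_ : (fun n => _) = fun=> 0); last first.
  apply/funext => n; under eq_fun do rewrite -exprD.
  by rewrite cmean_exp addnS mulr0.
move=> h; apply: cvg_unique h _; first exact: norm_hausdorff.
by apply: cvg_near_cst; apply: nearW => n; rewrite /series/= big1.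
Qed.

(** The series of g is integrated termwise against conj g; the n-th term is c_n times the conjugate
    of the n-th moment of g, which is c_n. *)
Lemma parseval :
  series (fun n => normc (c n) ^+ 2) @ \oo --> mean (fun x => normc (g x) ^+ 2).
Proof.
set B := limn (series (fun n => normc (c n))).
have Lg := abs_power_series_L1.
have gB : ae_circle (fun x => normc ((g x)^*%C) <= B).
  by apply: ae_circleW => x; rewrite normc_conj; exact: normc_abs_power_series.
have mg := cmeasurable_conj (L1_cmeasurable Lg).
have Lcg n : L1 (fun x => val x ^+ n * (g x)^*%C).
  exact: L1M_bounded (L1_continuous (@circle_continuous_exp n)) mg gB.
have H : series (fun n => cmean (fun x => val x ^+ n * (g x)^*%C * c n)) @ \oo -->
    cmean (fun x => g x * (g x)^*%C).
  apply: (@cmean_normal_series _ (fun n x => val x ^+ n * (g x)^*%C * c n)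
    (fun x => g x * (g x)^*%C) (fun n => normc (c n) * B)).
  - by move=> n; exact: L1Z.
  - move=> n x; rewrite 2!ComplexField.Normc.normcM normc_conj normc_circleX mul1r.
    by rewrite mulrC ler_wpM2l ?normc_ge0// normc_abs_power_series.
  - rewrite (_ : series _ = fun n => series (fun k => normc (c k)) n * B).
      by apply: is_cvgMr_tmp.
    by apply/funext => n; rewrite /series/= mulr_suml.
  - move=> x; rewrite (_ : series _ = fun n => series (fun k => c k * val x ^+ k) n * (g x)^*%C).
      by apply: cvgMr_tmp; exact: cg.
    apply/funext => n; rewrite /series/= mulr_suml; apply: eq_bigr => k _.
    by rewrite mulrC mulrA.
have [+ _] := (proj1 (cvg_ReIm _ _) H).
rewrite (_ : mean _ = complex.Re (cmean (fun x => g x * (g x)^*%C))); last first.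
  by congr mean; apply/funext => x; rewrite normc_sqr.
under eq_fun do rewrite Re_series.
rewrite (_ : (fun n => complex.Re _) = fun n => normc (c n) ^+ 2)//.
apply/funext => n; rewrite cmeanZ// normc_sqr mulrC; congr (complex.Re (_ * _)).
rewrite -[in RHS](abs_power_series_moment n) -cmean_conj; last first.
  apply: (@L1M_bounded R _ _ 1 Lg (L1_cmeasurable (L1_continuous (@circle_continuousXV n)))).
  by apply: ae_circleW => x; rewrite normc_circleXV.
congr cmean; apply/funext => x.
by rewrite rmorphM rmorphXn /= -circle_conj conjcK mulrC.
Qed.

End AbsolutelyConvergent.

Definition taylor_at h (r : R) n : C :=
  cmean (fun x => dilation h r x * (val x)^-1 ^+ n) * (r%:C)^-1 ^+ n.

Lemma normc_taylor_at h (r : R) n : 0 < r -> r < 1 ->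
  normc (taylor_at h r n) <= supnorm h * r^-1 ^+ n.
Proof.
move=> r0 r1; rewrite ComplexField.Normc.normcM normcX ComplexField.Normc.normcV.
rewrite normc_real gtr0_norm// ler_wpM2r ?exprn_ge0 ?invr_ge0 ?(ltW r0)//.
have Ld := L1_continuous (circle_continuousM (@dilation_continuous h r (ltW r0) r1)
  (@circle_continuousXV n)).
apply: (le_trans (normc_cmean Ld)).
apply: (le_trans (L1norm_le Ld (rintegrable_cst (supnorm h)) _)); last by rewrite mean_cst.
apply: ae_circleW => x; rewrite ComplexField.Normc.normcM normc_circleXV mulr1.
by apply: normc_dilation => //; exact: ltW.
Qed.

(** In Cauchy's formula on the circle of radius r, the kernel is expanded as a geometric series in w
    / (r x). *)
Lemma taylor_at_cvg h (r : R) w : r < 1 -> normc w < r ->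
  series (fun n => taylor_at h r n * w ^+ n) @ \oo --> extension h w.
Proof.
move=> r1 wr; have r0 : 0 < r by exact: le_lt_trans (normc_ge0 w) wr.
have rC0 : r%:C != 0 by rewrite -normc_gt0 normc_real normr_gt0 gt_eqF.
pose q := w / r%:C.
have q1 : normc q < 1.
  rewrite ComplexField.Normc.normcM ComplexField.Normc.normcV normc_real gtr0_norm//.
  by rewrite ltr_pdivrMr// mul1r.
have cd := @dilation_continuous h r (ltW r0) r1.
have Ld n := L1_continuous (circle_continuousM cd (@circle_continuousXV n)).
have -> : extension h w = cmean (fun x => dilation h r x * (1 - (val x)^-1 * q)^-1).
  rewrite -(@cauchy_formula _ (extension h) (supnorm h) w r)//; last 2 first.
  - exact: extension_dd_bounded.
  - exact: normc_extension.
  congr cmean; apply/funext => x; congr (_ * _).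
  have x0 := circle_neq0 x.
  have -> : r%:C * val x - w = r%:C * val x * (1 - (val x)^-1 * q).
    by rewrite /q; field; rewrite x0 rC0.
  by rewrite invfM mulrA mulfV ?mul1r// mulf_neq0.
rewrite (_ : (fun n => _) = fun n => cmean (fun x => dilation h r x * (val x)^-1 ^+ n * q ^+ n)).
  apply: (@cmean_normal_series _ (fun n x => dilation h r x * (val x)^-1 ^+ n * q ^+ n)
    (fun x => dilation h r x * (1 - (val x)^-1 * q)^-1) (fun n => supnorm h * normc q ^+ n)).
  - by move=> n; exact: L1Z.
  - move=> n x; rewrite 2!ComplexField.Normc.normcM normc_circleXV mulr1 normcX.
    by rewrite ler_wpM2r ?exprn_ge0 ?normc_ge0// normc_dilation// ltW.
  - rewrite (_ : series _ = fun n => supnorm h * series (fun k => normc q ^+ k) n).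
      by apply: is_cvgMl_tmp; exact: cvg_geometric_real (normc_ge0 _) q1.
    by apply/funext => n; rewrite /series/= mulr_sumr.
  - move=> x; rewrite (_ : series _ = fun n =>
        dilation h r x * series (fun k => ((val x)^-1 * q) ^+ k) n).
      apply: cvgMl_tmp; apply: cvg_cgeometric; rewrite ComplexField.Normc.normcM.
      by rewrite ComplexField.Normc.normcV normc_circle invr1 mul1r.
    apply/funext => n; rewrite /series/= mulr_sumr; apply: eq_bigr => k _.
    by rewrite -mulrA -exprMn.
apply/funext => n; rewrite cmeanZ// /taylor_at -mulrA; congr (_ * _).
by rewrite /q exprMn mulrC.
Qed.

Lemma taylor_at_summable h (r s : R) : 0 < r -> r < 1 -> 0 <= s -> s < r ->
  cvgn (series (fun n => normc (taylor_at h r n * s%:C ^+ n))).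
Proof.
move=> r0 r1 s0 sr.
have : cvgn (fun n => supnorm h * series (fun k => (s / r) ^+ k) n).
  apply: is_cvgMl_tmp; apply: cvg_geometric_real; first by rewrite divr_ge0// ltW.
  by rewrite ltr_pdivrMr// mul1r.
rewrite (_ : (fun n => _) = series (fun n => supnorm h * (s / r) ^+ n)); last first.
  by apply/funext => n; rewrite /series/= mulr_sumr.
apply: series_le_cvg => n; first exact: normc_ge0.
  by rewrite mulr_ge0 ?supnorm_ge0// exprn_ge0// divr_ge0// ltW.
rewrite ComplexField.Normc.normcM normcX normc_real ger0_norm// mulrC exprMn mulrCA.
by rewrite ler_wpM2l ?exprn_ge0// normc_taylor_at.
Qed.

Lemma dilation_series h (r s : R) (x : circle R) : 0 <= s -> s < r -> r < 1 ->
  series (fun n => taylor_at h r n * s%:C ^+ n * val x ^+ n) @ \oo --> dilation h s x.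
Proof.
move=> s0 sr r1; under eq_fun do rewrite -mulrA -exprMn.
by apply: taylor_at_cvg => //; rewrite normc_dilation_arg.
Qed.

(** The expansion obtained from the larger circle converges absolutely on the smaller one, where its
    coefficients are read off as moments. *)
Lemma taylor_at_eq h (r s : R) n : 0 < s -> s < r -> r < 1 ->
  taylor_at h s n = taylor_at h r n.
Proof.
move=> s0 sr r1; have r0 := lt_trans s0 sr.
rewrite {1}/taylor_at (abs_power_series_moment (@taylor_at_summable h r s r0 r1 (ltW s0) sr)
  (fun x => @dilation_series h r s x (ltW s0) sr r1)).
have sC0 : s%:C != 0 by rewrite -normc_gt0 normc_real normr_gt0 gt_eqF.
by rewrite -mulrA -exprMn mulfV// expr1n mulr1.
Qed.

(** The radius is arbitrary, by [taylorE]. *)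
Definition taylor h n := taylor_at h 2^-1 n.

Lemma taylorE h (r : R) n : 0 < r -> r < 1 -> taylor h n = taylor_at h r n.
Proof.
move=> r0 r1; have h1 : 2^-1 < 1 :> R by rewrite invf_lt1// ltr1n.
have h0 : 0 < 2^-1 :> R by rewrite invr_gt0.
rewrite /taylor; have [rh|hr|->] := ltgtP r 2^-1.
- by rewrite -(taylor_at_eq h n r0 rh h1).
- by rewrite (taylor_at_eq h n h0 hr r1).
- by [].
Qed.

Lemma between_lt1 (s : R) : 0 <= s -> s < 1 -> exists r : R, [/\ 0 < r, s < r & r < 1].
Proof. by move=> s0 s1; exists ((s + 1) / 2); split; lra. Qed.

Lemma taylor_summable h (s : R) : 0 <= s -> s < 1 ->
  cvgn (series (fun n => normc (taylor h n * s%:C ^+ n))).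
Proof.
move=> s0 /(between_lt1 s0)[r [r0 sr r1]].
under [X in series X]eq_fun do rewrite (taylorE h _ r0 r1).
exact: taylor_at_summable.
Qed.

Lemma taylor_dilation h (s : R) (x : circle R) : 0 <= s -> s < 1 ->
  series (fun n => taylor h n * s%:C ^+ n * val x ^+ n) @ \oo --> dilation h s x.
Proof.
move=> s0 /(between_lt1 s0)[r [r0 sr r1]].
under [X in series X]eq_fun do rewrite (taylorE h _ r0 r1).
exact: dilation_series.
Qed.

Lemma taylor_cvg h w : normc w < 1 ->
  series (fun n => taylor h n * w ^+ n) @ \oo --> extension h w.
Proof.
move=> /(between_lt1 (normc_ge0 w))[r [r0 wr r1]].
under [X in series X]eq_fun do rewrite (taylorE h _ r0 r1).
exact: taylor_at_cvg.
Qed.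

Definition energy h (r : R) := mean (fun x => normc (dilation h r x) ^+ 2).

Lemma rintegrable_sqr (f : circle R -> C) (B : R) : cmeasurable f ->
  (forall x, normc (f x) <= B) -> rintegrable (fun x => normc (f x) ^+ 2).
Proof.
move=> mf fB; apply: (@rintegrable_le _ _ (fun=> B ^+ 2)); last 2 first.
- exact: rintegrable_cst.
- apply: ae_circleW => x; rewrite ger0_norm ?exprn_ge0 ?normc_ge0//.
  by rewrite lerXn2r ?nnegrE ?normc_ge0// (le_trans (normc_ge0 _) (fB x)).
by apply: measurable_funX; exact: rmeasurable_normc.
Qed.

Lemma energy_le h (r : R) : 0 <= r -> r < 1 -> energy h r <= supnorm h ^+ 2.
Proof.
move=> r0 r1; rewrite -(mean_cst (supnorm h ^+ 2)); apply: le_mean.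
- apply: (@rintegrable_sqr _ (supnorm h)); last by move=> x; exact: normc_dilation.
  by apply/L1_cmeasurable/L1_continuous; exact: dilation_continuous.
- exact: rintegrable_cst.
apply: ae_circleW => x.
by rewrite lerXn2r ?nnegrE ?normc_ge0 ?supnorm_ge0// normc_dilation.
Qed.

(** By Parseval this is a comparison of coefficients: (r^n - s^n)^2 <= r^(2n) - s^(2n). Bounded
    energy thus makes the dilations Cauchy in L^2 as the radius tends to 1. *)
Lemma energy_increment h (r s : R) : 0 <= s -> s <= r -> r < 1 ->
  mean (fun x => normc (dilation h r x - dilation h s x) ^+ 2) <= energy h r - energy h s.
Proof.
move=> s0 sr r1; have r0 := le_trans s0 sr; have s1 := le_lt_trans sr r1.
pose a t n := taylor h n * t%:C ^+ n : C.
have Er := parseval (@taylor_summable h r r0 r1) (fun x => @taylor_dilation h r x r0 r1).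
have Es := parseval (@taylor_summable h s s0 s1) (fun x => @taylor_dilation h s x s0 s1).
have sB : cvgn (series (fun n => normc (a r n - a s n))).
  have := is_cvg_seriesD (@taylor_summable h r r0 r1) (@taylor_summable h s s0 s1).
  apply: series_le_cvg => n; rewrite ?normc_ge0 ?addr_ge0 ?normc_ge0//.
  by apply: le_trans (le_normcD _ _) _; rewrite normcN.
have Erd : series (fun n => normc (a r n - a s n) ^+ 2) @ \oo -->
    mean (fun x => normc (dilation h r x - dilation h s x) ^+ 2).
  apply: (parseval sB) => x; rewrite (_ : series _ = (series (fun n => a r n * val x ^+ n)) \-
      (series (fun n => a s n * val x ^+ n))).
    by apply: cvgB; exact: taylor_dilation.
  apply/funext => n; rewrite /series/= -sumrB.
  by apply: eq_bigr => k _; rewrite mulrBl.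
have ErEs : (fun n => series (fun n => normc (a r n) ^+ 2) n -
    series (fun n => normc (a s n) ^+ 2) n) @ \oo --> energy h r - energy h s.
  by apply: cvgB; [exact: Er|exact: Es].
rewrite -(cvg_lim _ Erd)// -(cvg_lim _ ErEs)//; apply: ler_lim.
- by apply/cvg_ex; eexists; exact: Erd.
- by apply/cvg_ex; eexists; exact: ErEs.
apply: nearW => n; rewrite /= /series/= -sumrB; apply: ler_sum => k _.
have xk (t : R) : t%:C ^+ k = (t ^+ k)%:C by rewrite rmorphXn.
have na t : 0 <= t -> normc (a t k) = normc (taylor h k) * t ^+ k.
  by move=> t0; rewrite /a xk ComplexField.Normc.normcM normc_real ger0_norm// exprn_ge0.
have srk : s ^+ k <= r ^+ k by rewrite lerXn2r ?nnegrE.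
have -> : normc (a r k - a s k) = normc (taylor h k) * (r ^+ k - s ^+ k).
  rewrite /a !xk -mulrBr ComplexField.Normc.normcM -(rmorphB (real_complex R)) normc_real.
  by rewrite ger0_norm// subr_ge0.
rewrite (na r r0) (na s s0) -subr_ge0; set T := normc _; set x := r ^+ k; set y := s ^+ k.
have -> : (T * x) ^+ 2 - (T * y) ^+ 2 - (T * (x - y)) ^+ 2 = T ^+ 2 * (2 * y * (x - y)) by ring.
by rewrite mulr_ge0 ?sqr_ge0// mulr_ge0 ?subr_ge0// mulr_ge0// exprn_ge0.
Qed.

End HinfTaylor.

Section BoundaryFunction.
Variable R : realType.
Local Notation C := R[i].
Implicit Types (h : Hinf R) (z w : C).

Lemma energy_mono h (s r : R) : 0 <= s -> s <= r -> r < 1 -> energy h s <= energy h r.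
Proof.
move=> s0 sr r1; rewrite -subr_ge0; apply: le_trans (energy_increment h s0 sr r1).
by apply: mean_ge0 => x; rewrite exprn_ge0 ?normc_ge0.
Qed.

Lemma near_maximal_energy h : exists L : R, forall e, 0 < e -> exists rho,
  [/\ 0 <= rho, rho < 1 & forall r, rho <= r -> r < 1 -> L - e < energy h r <= L].
Proof.
pose E := [set y | exists2 r : R, 0 <= r < 1 & y = energy h r].
have E0 : E !=set0 by exists (energy h 0), 0 => //; rewrite lexx ltr01.
have supE : has_sup E.
  split => //; exists (supnorm h ^+ 2) => _ [r /andP[r0 r1] ->]; exact: energy_le.
exists (sup E) => e e0; have [_ [rho /andP[rho0 rho1] ->] Lrho] := sup_adherent e0 supE.
exists rho; split => // r rhor r1; have r0 := le_trans rho0 rhor.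
rewrite (lt_le_trans Lrho) ?energy_mono//=.
by apply: ub_le_sup; [exact: (proj2 supE)|exists r => //; rewrite r0].
Qed.

(** In place of the Cauchy-Schwarz inequality, the pointwise bound |f| <= |f|^2 / (2e) + e / 2 is
    integrated. *)
Lemma L1norm_square (f : circle R -> C) (B e : R) : cmeasurable f ->
  (forall x, normc (f x) <= B) -> 0 < e ->
  mean (fun x => normc (f x) ^+ 2) <= e ^+ 2 -> L1norm f <= e.
Proof.
move=> mf fB e0 fe; have Lf : L1 f by apply: (L1_bounded mf); exact: ae_circleW.
have i2 := rintegrable_sqr mf fB.
have iH := rintegrableD (rintegrableZ (2^-1 / e) i2) (rintegrable_cst (2^-1 * e)).
apply: (le_trans (L1norm_le Lf iH _)).
  apply: ae_circleW => x; set n := normc _; rewrite -subr_ge0.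
  have -> : 2^-1 / e * n ^+ 2 + 2^-1 * e - n = 2^-1 / e * (n - e) ^+ 2.
    by field; rewrite gt_eqF.
  by rewrite mulr_ge0 ?sqr_ge0// divr_ge0// ltW.
rewrite (meanD (rintegrableZ _ i2) (rintegrable_cst _)) (meanZ _ i2) mean_cst.
apply: (@le_trans _ _ (2^-1 / e * e ^+ 2 + 2^-1 * e)).
  by rewrite lerD2r ler_wpM2l// divr_ge0// ltW.
have -> : 2^-1 / e * e ^+ 2 + 2^-1 * e = e by field; rewrite gt_eqF.
by [].
Qed.

(** The link to [h] is made by Fourier coefficients and mentions no radial limit, so it can be
    verified along one sequence of radii, before Fatou's theorem. *)
Definition boundary_function h (u : circle R -> C) :=
  [/\ L1 u, ae_circle (fun x => normc (u x) <= supnorm h),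
    (forall m, cmean (fun x => u x * (val x)^-1 ^+ m) = taylor h m) &
    forall m, cmean (fun x => u x * val x ^+ m.+1) = 0].

Lemma dilation_moment h (r : R) m : 0 <= r -> r < 1 ->
  cmean (fun x => dilation h r x * (val x)^-1 ^+ m) = taylor h m * r%:C ^+ m.
Proof.
move=> r0 r1.
exact: (abs_power_series_moment (@taylor_summable R h r r0 r1)
  (fun x => @taylor_dilation R h r x r0 r1)).
Qed.

Lemma dilation_neg_moment h (r : R) m : 0 <= r -> r < 1 ->
  cmean (fun x => dilation h r x * val x ^+ m.+1) = 0.
Proof.
move=> r0 r1.
exact: (abs_power_series_neg_moment (@taylor_summable R h r r0 r1)
  (fun x => @taylor_dilation R h r x r0 r1)).
Qed.

(* The radii are chosen so fast that the increments of the dilations, whose L^2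
   norms are controlled by the increments of the bounded monotone energy, are
   summable in L^1. *)
Lemma dilation_ae_cvg h : exists (r : nat -> R) (u : circle R -> C),
  [/\ (forall n, 0 <= r n < 1), r @ \oo --> (1 : R), L1 u &
    ae_circle (fun x => (fun n => dilation h (r n) x) @ \oo --> u x)].
Proof.
have [L hL] := near_maximal_energy h.
pose e (k : nat) : R := 2^-1 ^+ k.
have e0 k : 0 < e k by rewrite exprn_gt0// invr_gt0.
have /choice[rho hrho] : forall k : nat, exists rho,
    [/\ 0 <= rho, rho < 1 & forall r, rho <= r -> r < 1 -> L - e k ^+ 2 < energy h r <= L].
  by move=> k; apply: hL; rewrite exprn_gt0.
(* The second entry forces the radii to 1 even when the energy is nearly maximal at small radii. *)
pose r k := Num.max (rho k) (1 - k.+1%:R^-1).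
have r01 k : 0 <= r k < 1.
  have [rho0 rho1 _] := hrho k; rewrite le_max rho0/= gt_max rho1/=.
  by rewrite gtrBl invr_gt0 ltr0n.
have r0 k : 0 <= r k by have /andP[] := r01 k.
have r1 k : r k < 1 by have /andP[] := r01 k.
have cr : r @ \oo --> (1 : R).
  apply: (@squeeze_cvgr _ _ _ _ (fun k => 1 - k.+1%:R^-1) (fun=> 1)).
  - by apply: nearW => k; rewrite le_max lexx orbT/= ltW.
  - rewrite -[X in _ --> X]subr0; apply: cvgB; first exact: cvg_cst.
    exact: cvg_harmonic.
  - exact: cvg_cst.
have er k j : (k <= j)%N -> L - e k ^+ 2 < energy h (r j) <= L.
  move=> kj; have [_ _ /(_ (r j))] := hrho j.
  rewrite le_max lexx => /(_ isT (r1 j))/andP[h1 ->]; rewrite andbT.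
  apply: le_lt_trans h1; rewrite lerD2l lerN2 lerXn2r ?nnegrE ?(ltW (e0 _))//.
  by rewrite /e ler_wiXn2l// ?invr_ge0// invf_le1// ler1n.
have se : cvgn (series e).
  by apply: cvg_geometric_real; rewrite ?invr_ge0// invf_lt1// ltr1n.
clearbody r e.
pose d k x := dilation h (r k.+1) x - dilation h (r k) x.
have cd k : circle_continuous (d k).
  move=> t; apply: cvgB; exact: dilation_continuous.
have Ld k : L1 (d k) := L1_continuous (@cd k).
have dB k x : normc (d k x) <= supnorm h + supnorm h.
  by apply: le_trans (le_normcD _ _) _; rewrite normcN lerD// normc_dilation.
have nd k : L1norm (d k) <= e k.
  apply: (L1norm_square (L1_cmeasurable (Ld k)) (dB k) (e0 k)).
  have /andP[a1 a2] := er k k (leqnn k); have /andP[b1 b2] := er k k.+1 (leqnSn k).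
  (* The radii need not increase, so the increment is taken in whichever order applies. *)
  have [rr|/ltW rr] := leP (r k) (r k.+1).
    apply: (le_trans (energy_increment h (r0 k) rr (r1 _))).
    by rewrite lerBlDr; apply: le_trans b2 _; rewrite -lerBlDl; exact: (ltW a1).
  rewrite (_ : (fun x => _) = fun x => normc (dilation h (r k) x - dilation h (r k.+1) x) ^+ 2).
    apply: (le_trans (energy_increment h (r0 _) rr (r1 _))).
    by rewrite lerBlDr; apply: le_trans a2 _; rewrite -lerBlDl; exact: (ltW b1).
  by apply/funext => x; rewrite normcB.
have sd : cvgn (series (fun k => L1norm (d k))).
  by apply: series_le_cvg se => k; [exact: L1norm_ge0|exact: ltW|exact: nd].
have [_ [s [Ls ds _ _]]] := L1_series Ld sd.
have Ld0 := L1_continuous (@dilation_continuous R h (r 0%N) (r0 _) (r1 _)).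
exists r, (fun x => dilation h (r 0%N) x + s x).
split; [exact: r01|exact: cr|exact: L1D Ld0 Ls|].
apply: ae_circleS ds => x dsx.
rewrite (_ : (fun n => _) = fun n => dilation h (r 0%N) x + series (fun k => d k x) n).
  by apply: cvgD; [exact: cvg_cst|exact: dsx].
apply/funext => n; elim: n => [|n IH]; first by rewrite /series/= big_geq// addr0.
rewrite /series/= big_nat_recr//= addrA -[X in X + _]/(_ + series (fun k => d k x) n) -IH.
by rewrite /d addrC subrK.
Qed.

Lemma boundary_function_exists h : exists u, boundary_function h u.
Proof.
have [r [u [r01 cr Lu ru]]] := dilation_ae_cvg h.
have r0 k : 0 <= r k by have /andP[] := r01 k.
have r1 k : r k < 1 by have /andP[] := r01 k.
have lim (e : circle R -> C) : circle_continuous e -> (forall x, normc (e x) = 1) ->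
    (fun n => cmean (fun x => dilation h (r n) x * e x)) @ \oo --> cmean (fun x => u x * e x).
  move=> ce e1; have me := L1_cmeasurable (L1_continuous ce).
  apply: (@dominated_cmean _ _ _ (fun=> supnorm h)).
  - move=> n; apply: cmeasurableM => //; apply/L1_cmeasurable/L1_continuous.
    exact: dilation_continuous.
  - by apply: cmeasurableM => //; exact: L1_cmeasurable.
  - exact: rintegrable_cst.
  - by apply: ae_circleS ru => x rux; apply: cvgMr_tmp.
  - apply: ae_circleW => x n; rewrite ComplexField.Normc.normcM e1 mulr1.
    exact: normc_dilation.
exists u; split => //.
- apply: ae_circleS ru => x rux; have /cvgc_norm nu := rux.
  rewrite -(cvg_lim _ nu)//; apply: limr_le; first by apply/cvg_ex; eexists; exact: nu.
  by apply: nearW => n; exact: normc_dilation.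
- move=> m; have := lim _ (@circle_continuousXV R m) (fun x => normc_circleXV x m).
  rewrite (_ : (fun n => _) = fun n => taylor h m * (r n)%:C ^+ m); last first.
    by apply/funext => n; rewrite dilation_moment.
  move=> l; apply: cvg_unique l _; first exact: norm_hausdorff.
  have rm : (fun n => (r n)%:C ^+ m) @ \oo --> (1 : C).
    rewrite -[X in _ --> X](expr1n C m); elim: (m) => [|k IH].
      by rewrite expr0; under eq_fun do rewrite expr0; exact: cvg_cst.
    rewrite exprS; under eq_fun do rewrite exprS; apply: cvgM; last exact: IH.
    by apply/cvg_ReIm; split; [exact: cr|exact: cvg_cst].
  have h2 : (fun n => taylor h m * (r n)%:C ^+ m) @ \oo --> taylor h m * 1.
    by apply: cvgMl_tmp; exact: rm.
  by rewrite mulr1 in h2; exact: h2.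
- move=> m; have := lim _ (@circle_continuous_exp R m.+1) (fun x => normc_circleX x m.+1).
  rewrite (_ : (fun n => _) = fun=> 0); last first.
    by apply/funext => n; rewrite dilation_neg_moment.
  by move=> l; apply: cvg_unique l _; [exact: norm_hausdorff|exact: cvg_cst].
Qed.

Definition cauchy_kernel z (x : circle R) : C := (1 - (val x)^-1 * z)^-1.

Lemma cauchy_kernel_den z (x : circle R) : normc z < 1 -> 1 - (val x)^-1 * z != 0.
Proof.
move=> z1; rewrite subr_eq0; apply: contraTneq z1 => /(congr1 (fun z : C => normc z)).
rewrite ComplexField.Normc.normcM ComplexField.Normc.normcV normc_circle invr1 mul1r.
by rewrite ComplexField.Normc.normc1 => <-; rewrite ltxx.
Qed.

Lemma cauchy_kernel_continuous z : normc z < 1 -> circle_continuous (cauchy_kernel z).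
Proof.
move=> z1; apply: (@circle_continuousV _ (fun x => 1 - (val x)^-1 * z)).
  by move=> x; exact: cauchy_kernel_den.
have c := circle_continuousV (@circle_neq0 R) (@continuous_expi R).
move=> t; apply: cvgB; first exact: cvg_cst.
by apply: cvgMr_tmp; exact: c.
Qed.

Lemma normc_cauchy_kernel z x : normc z < 1 -> normc (cauchy_kernel z x) <= (1 - normc z)^-1.
Proof.
move=> z1; have d0 : 0 < 1 - normc z by rewrite subr_gt0.
have h : 1 - normc z <= normc (1 - (val x)^-1 * z).
  rewrite lerBlDr.
  have -> : normc z = normc ((val x)^-1 * z).
    by rewrite ComplexField.Normc.normcM ComplexField.Normc.normcV normc_circle invr1 mul1r.
  have := le_normcD (1 - (val x)^-1 * z) ((val x)^-1 * z).
  by rewrite subrK ComplexField.Normc.normc1.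
by rewrite ComplexField.Normc.normcV lef_pV2// posrE (lt_le_trans d0).
Qed.

Lemma cvg_cauchy_kernel z (x : circle R) : normc z < 1 ->
  series (fun n => (val x)^-1 ^+ n * z ^+ n) @ \oo --> cauchy_kernel z x.
Proof.
move=> z1; under [X in series X]eq_fun do rewrite -exprMn.
apply: cvg_cgeometric; rewrite ComplexField.Normc.normcM ComplexField.Normc.normcV.
by rewrite normc_circle invr1 mul1r.
Qed.

Lemma cvgc_conj (f : nat -> C) l : f @ \oo --> l -> (fun n => (f n)^*%C) @ \oo --> l^*%C.
Proof.
move=> fl; apply/cvgcP; move/cvgcP : fl.
by under [X in _ -> X @ _ --> _]eq_fun do rewrite -rmorphB normc_conj.
Qed.

(** Here [z] only supplies the geometric majorant; the terms [e n] need not be powers of it, and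
    later uses take an auxiliary real ratio. *)
Lemma cmean_L1_series_kernel (g : circle R -> C) z (e : nat -> circle R -> C) (k : circle R -> C) :
  L1 g -> normc z < 1 -> (forall n, circle_continuous (e n)) ->
  (forall n x, normc (e n x) <= normc z ^+ n) ->
  (forall x, series (fun n => e n x) @ \oo --> k x) ->
  series (fun n => cmean (fun x => g x * e n x)) @ \oo --> cmean (fun x => g x * k x).
Proof.
move=> Lg z1 ce ez ek.
have Lge n : L1 (fun x => g x * e n x).
  apply: (@L1M_bounded _ _ _ (normc z ^+ n) Lg (L1_cmeasurable (L1_continuous (@ce n)))).
  by apply: ae_circleW => x; exact: ez.
have [|_ [s [_ es ss _]]] := L1_series Lge.
  have : cvgn (fun n => L1norm g * series (fun k => normc z ^+ k) n).
    by apply: is_cvgMl_tmp; apply: cvg_geometric_real => //; exact: normc_ge0.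
  rewrite (_ : (fun n => _) = series (fun n => L1norm g * normc z ^+ n)); last first.
    by apply/funext => n; rewrite /series/= mulr_sumr.
  apply: series_le_cvg => n; first exact: L1norm_ge0.
    by rewrite mulr_ge0 ?L1norm_ge0 ?exprn_ge0 ?normc_ge0.
  apply: (le_trans (L1norm_le (Lge n) (rintegrableZ (normc z ^+ n) (L1_normc Lg)) _)).
    apply: ae_circleW => x; rewrite ComplexField.Normc.normcM mulrC.
    by rewrite ler_wpM2r ?normc_ge0.
  by rewrite (meanZ _ (L1_normc Lg)) mulrC.
rewrite (ae_cmean (g := s))//; apply: ae_circleS es => x esx.
apply: cvg_unique esx; first exact: norm_hausdorff.
rewrite (_ : series _ = fun n => g x * series (fun k => e k x) n).
  by apply: cvgMl_tmp; exact: ek.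
by apply/funext => n; rewrite /series/= mulr_sumr.
Qed.

Lemma cmean_cauchy_kernel (g : circle R -> C) z : L1 g -> normc z < 1 ->
  series (fun n => cmean (fun x => g x * (val x)^-1 ^+ n) * z ^+ n) @ \oo -->
  cmean (fun x => g x * cauchy_kernel z x).
Proof.
move=> Lg z1; rewrite (_ : (fun n => _) =
    fun n => cmean (fun x => g x * ((val x)^-1 ^+ n * z ^+ n))).
  apply: (@cmean_L1_series_kernel g z (fun n x => (val x)^-1 ^+ n * z ^+ n)) => //.
  - move=> n.
    exact: (circle_continuousM (@circle_continuousXV R n) (@circle_continuous_cst R (z ^+ n))).
  - by move=> n x; rewrite ComplexField.Normc.normcM normc_circleXV mul1r normcX.
  - by move=> x; exact: cvg_cauchy_kernel.
apply/funext => n; rewrite -cmeanZ.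
  by congr cmean; apply/funext => x; rewrite mulrA.
apply: (@L1M_bounded _ _ _ 1 Lg (L1_cmeasurable (L1_continuous (@circle_continuousXV R n)))).
by apply: ae_circleW => x; rewrite normc_circleXV.
Qed.

Lemma cmean_conj_cauchy_kernel (g : circle R -> C) z : L1 g -> normc z < 1 ->
  series (fun n => cmean (fun x => g x * val x ^+ n) * z^*%C ^+ n) @ \oo -->
  cmean (fun x => g x * (cauchy_kernel z x)^*%C).
Proof.
move=> Lg z1; rewrite (_ : (fun n => _) =
    fun n => cmean (fun x => g x * (val x ^+ n * z^*%C ^+ n))).
  apply: (@cmean_L1_series_kernel g z (fun n x => val x ^+ n * z^*%C ^+ n)) => //.
  - move=> n.
    exact: (circle_continuousM (@circle_continuous_exp R n)
      (@circle_continuous_cst R (z^*%C ^+ n))).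
  - by move=> n x; rewrite ComplexField.Normc.normcM normc_circleX mul1r normcX normc_conj.
  - move=> x; have := cvgc_conj (cvg_cauchy_kernel (x := x) z1); apply: cvg_trans.
    apply: near_eq_cvg; apply: nearW => n; rewrite /series/= rmorph_sum.
    by apply: eq_bigr => k _; rewrite rmorphM !rmorphXn /= -circle_conj conjcK.
apply/funext => n; rewrite -cmeanZ.
  by congr cmean; apply/funext => x; rewrite mulrA.
apply: (@L1M_bounded _ _ _ 1 Lg (L1_cmeasurable (L1_continuous (@circle_continuous_exp R n)))).
by apply: ae_circleW => x; rewrite normc_circleX.
Qed.

(** On the circle |1 - z / x| = |x - z|, so this is the usual Poisson kernel; this form matches
    [cauchy_kernel]. *)
Definition poisson z (x : circle R) : R :=
  (1 - normc z ^+ 2) / normc (1 - (val x)^-1 * z) ^+ 2.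

Lemma poissonE z x : normc z < 1 ->
  (poisson z x)%:C = cauchy_kernel z x + (cauchy_kernel z x)^*%C - 1.
Proof.
move=> z1; have d0 := cauchy_kernel_den x z1; rewrite /poisson /cauchy_kernel.
have -> : normc z = normc ((val x)^-1 * z).
  by rewrite ComplexField.Normc.normcM ComplexField.Normc.normcV normc_circle invr1 mul1r.
move: (_ * z) d0 => v d0.
have sq (a : C) : (normc a ^+ 2)%:C = a * a^*%C.
  case: a => a b /=; rewrite sqr_sqrtr ?addr_ge0 ?sqr_ge0//.
  by apply/eqP; rewrite eq_complex/=; apply/andP; split; apply/eqP; ring.
have realE (a b : R) : ((1 - a) / b)%:C = (1 - a%:C) / b%:C.
  by rewrite rmorphM fmorphV rmorphB rmorph1.
have conjE (a : C) : ((1 - a)^-1)^*%C = (1 - a^*%C)^-1.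
  by rewrite fmorphV rmorphB rmorph1.
have conjB (a : C) : (1 - a)^*%C = 1 - a^*%C by rewrite rmorphB rmorph1.
rewrite realE !sq conjE conjB.
have d0' : 1 - v^*%C != 0.
  by rewrite -conjB -normc_eq0 normc_conj normc_eq0.
by field; rewrite d0 d0'.
Qed.

Lemma poisson_ge0 z x : normc z < 1 -> 0 <= poisson z x.
Proof.
move=> z1; rewrite divr_ge0 ?exprn_ge0 ?normc_ge0// subr_ge0.
by rewrite expr_le1 ?normc_ge0// ltW.
Qed.

Lemma poisson_continuous z : normc z < 1 -> circle_continuous (fun x => (poisson z x)%:C).
Proof.
move=> z1; rewrite (_ : (fun x => _) = fun x =>
    cauchy_kernel z x + (cauchy_kernel z x)^*%C + -1).
  have c := cauchy_kernel_continuous z1; have cc := circle_continuous_conj c.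
  exact: (circle_continuousD (circle_continuousD c cc) (@circle_continuous_cst R (-1))).
by apply/funext => x; exact: poissonE.
Qed.

(** The Poisson kernel is K + conj K - 1. The part K sums the given series; in conj K only the
    zeroth moment survives, and it cancels against -1. *)
Lemma cmean_poisson (g : circle R -> C) z (l : C) : L1 g -> normc z < 1 ->
  (forall m, cmean (fun x => g x * val x ^+ m.+1) = 0) ->
  series (fun n => cmean (fun x => g x * (val x)^-1 ^+ n) * z ^+ n) @ \oo --> l ->
  cmean (fun x => g x * (poisson z x)%:C) = l.
Proof.
move=> Lg z1 g0 gl.
have c := cauchy_kernel_continuous z1; have cc := circle_continuous_conj c.
have LK : L1 (fun x => g x * cauchy_kernel z x).
  apply: (@L1M_bounded _ _ _ (1 - normc z)^-1 Lg (L1_cmeasurable (L1_continuous c))).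
  by apply: ae_circleW => x; exact: normc_cauchy_kernel.
have LcK : L1 (fun x => g x * (cauchy_kernel z x)^*%C).
  apply: (@L1M_bounded _ _ _ (1 - normc z)^-1 Lg (L1_cmeasurable (L1_continuous cc))).
  by apply: ae_circleW => x; rewrite normc_conj; exact: normc_cauchy_kernel.
have -> : (fun x => g x * (poisson z x)%:C) =
    fun x => g x * cauchy_kernel z x + (g x * (cauchy_kernel z x)^*%C + g x * -1).
  by apply/funext => x; rewrite (poissonE _ z1); ring.
rewrite (cmeanD LK (L1D LcK (L1Z _ Lg))) (cmeanD LcK (L1Z _ Lg)) cmeanZ//.
have -> : cmean (fun x => g x * cauchy_kernel z x) = l.
  by apply: cvg_unique gl; [exact: norm_hausdorff|exact: cmean_cauchy_kernel].
have -> : cmean (fun x => g x * (cauchy_kernel z x)^*%C) = cmean g.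
  have h := cmean_conj_cauchy_kernel Lg z1.
  apply: (cvg_unique _ h); first exact: norm_hausdorff.
  pose v n := cmean (fun x => g x * val x ^+ n) * z^*%C ^+ n.
  have -> : cmean g = v 0%N.
    by rewrite /v expr0 mulr1; congr cmean; apply/funext => x; rewrite expr0 mulr1.
  by apply: (@cvg_series_delta0 _ v) => n; rewrite /v g0 mul0r.
by rewrite mulrN1 subrr addr0.
Qed.

Lemma mean_poisson z : normc z < 1 -> mean (poisson z) = 1.
Proof.
move=> z1; have c1 := @circle_continuous_cst R 1.
have := @cmean_poisson (fun=> 1) z 1 (L1_continuous c1) z1.
rewrite (_ : (fun n => _) = fun n => (n == 0%N)%:R * z ^+ n); last first.
  by apply/funext => n; under eq_fun do rewrite mul1r; rewrite cmean_expV.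
move=> h; have : cmean (fun x => 1 * (poisson z x)%:C) = 1.
  apply: h; first by move=> m; under eq_fun do rewrite mul1r; rewrite cmean_exp.
  have hd : series (fun n => (n == 0%N)%:R * z ^+ n) @ \oo --> (0%N == 0%N)%:R * z ^+ 0.
    by apply: (@cvg_series_delta0 _ (fun n => (n == 0%N)%:R * z ^+ n)) => n; rewrite mul0r.
  by rewrite eqxx mul1r expr0 in hd; exact: hd.
move=> h1; transitivity (complex.Re (cmean (fun x => 1 * (poisson z x)%:C))); last by rewrite h1.
by congr mean; apply/funext => x; rewrite mul1r.
Qed.

Lemma boundary_function_poisson h u z : boundary_function h u -> normc z < 1 ->
  extension h z = cmean (fun x => u x * (poisson z x)%:C).
Proof.
move=> [Lu _ um u0] z1; rewrite (cmean_poisson (l := extension h z))//.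
by under [X in series X]eq_fun do rewrite um; exact: taylor_cvg.
Qed.

Lemma boundary_function_cauchy h u z : boundary_function h u -> normc z < 1 ->
  extension h z = cmean (fun x => u x * cauchy_kernel z x).
Proof.
move=> [Lu _ um u0] z1; have := @taylor_cvg R h z z1.
have := cmean_cauchy_kernel Lu z1; under [X in series X]eq_fun do rewrite um.
move=> l1 l2; apply: cvg_unique l2 l1; exact: norm_hausdorff.
Qed.

End BoundaryFunction.

(** * Fatou's theorem *)

Section PoissonFatou.
Variable R : realType.
Local Notation mu := (@lebesgue_measure R).
Local Notation C := R[i].

Lemma onemcosE (x : R) : 1 - cos x = 2 * sin (x / 2) ^+ 2.
Proof.
rewrite -{1}(divfK (_ : 2 != 0 :> R) x) ?pnatr_eq0//.
by rewrite mulr_natr cos_mulr2n cos2sin2 !mulr2n; ring.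
Qed.

(** The derivative of sin at 0 is 1, so |sin y| >= |y| / 2 near 0; with y = x / 2 the identity
    [onemcosE] yields the constant 1/8. *)
Lemma onemcos_lower : exists2 d : R, 0 < d &
  forall x, `|x| < d -> x ^+ 2 / 8 <= 1 - cos x.
Proof.
have ds := @is_derive_sin R 0.
have lim : h^-1 *: ((sin \o shift 0) (h *: 1) - sin 0) @[h --> 0^'] --> (1 : R).
  have [/cvg_ex[l hl] dl] := ds; move: dl; rewrite cos0 /derive (cvg_lim _ hl)// => l1.
  by rewrite l1 in hl; exact: hl.
have /cvgrPdist_lt/(_ (2^-1)) := lim.
rewrite invr_gt0 ltr0n => /(_ isT); rewrite near_withinE => /nbhs_ballP[d /= d0 hd].
exists d => // x xd; rewrite onemcosE.
have [->|x0] := eqVneq x 0; first by rewrite mul0r sin0 expr0n/= mul0r mulr0.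
have x20 : x / 2 != 0 by rewrite mulf_neq0// invr_eq0 pnatr_eq0.
have : ball (0 : R) d (x / 2).
  rewrite /ball/= sub0r normrN normrM [`|2^-1|]ger0_norm ?invr_ge0//.
  by apply: le_lt_trans xd; rewrite ler_piMr// invf_le1// ler1n.
move=> /hd /(_ x20); rewrite sin0 subr0 /= scaler1 addr0 => hs.
have : `|x / 2| / 2 <= `|sin (x / 2)|.
  have : 2^-1 <= `|(x / 2)^-1 *: sin (x / 2)|.
    move: hs; set y := _ *: _ => hs; have := lerB_dist 1 (1 - y).
    rewrite normr1 (_ : 1 - (1 - y) = y); [lra|ring].
  by rewrite normrZ normfV ler_pdivlMl ?normr_gt0.
move=> h; rewrite -(real_normK (num_real (sin _))) -(real_normK (num_real x)).
have -> : `|x| ^+ 2 / 8 = 2 * (`|x / 2| / 2) ^+ 2.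
  by rewrite normrM [`|2^-1|]ger0_norm ?invr_ge0//; field.
by rewrite ler_wpM2l// lerXn2r// ?nnegrE// divr_ge0.
Qed.

Lemma poisson_expi (r s t : R) : 0 <= r ->
  poisson (r%:C * val (expi t)) (expi s) =
  (1 - r ^+ 2) / ((1 - r) ^+ 2 + 2 * r * (1 - cos (s - t))).
Proof.
move=> r0; rewrite /poisson normc_dilation_arg//; congr (_ / _).
rewrite -circle_conj normc_sqr.
have [cs ct] := (cos2Dsin2 s, cos2Dsin2 t).
have -> : (1 - r) ^+ 2 + 2 * r * (1 - cos (s - t)) = 1 - 2 * r * cos (s - t) + r ^+ 2 by ring.
have -> : r ^+ 2 = r ^+ 2 * ((cos s ^+ 2 + sin s ^+ 2) * (cos t ^+ 2 + sin t ^+ 2)).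
  by rewrite cs ct !mulr1.
by rewrite cosB /=; ring.
Qed.

Lemma poisson_upper1 (r s t : R) : 0 <= r -> r < 1 ->
  poisson (r%:C * val (expi t)) (expi s) <= 2 / (1 - r).
Proof.
move=> r0 r1; rewrite poisson_expi//.
have e0 : 0 < 1 - r by rewrite subr_gt0.
have c0 : 0 <= 1 - cos (s - t) by rewrite subr_ge0 cos_le1.
have d0 : 0 < (1 - r) ^+ 2 + 2 * r * (1 - cos (s - t)).
  by rewrite ltr_wpDr ?exprn_gt0// mulr_ge0// mulr_ge0.
rewrite ler_pdivrMr// mulrC mulrA ler_pdivlMr//.
have -> : 1 - r ^+ 2 = (1 - r) * (1 + r) by ring.
have h : 0 <= 2 * r * (1 - cos (s - t)) by rewrite mulr_ge0// mulr_ge0.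
set D := 2 * r * _ in h *.
have : (1 - r) ^+ 2 * (1 + r) <= (1 - r) ^+ 2 * 2 by rewrite ler_wpM2l ?sqr_ge0//; lra.
rewrite expr2; lra.
Qed.

Lemma poisson_upper2 (r s t k : R) : 2^-1 <= r -> r < 1 -> 0 < k ->
  k <= 1 - cos (s - t) ->
  poisson (r%:C * val (expi t)) (expi s) <= 2 * (1 - r) / k.
Proof.
move=> r2 r1 k0 kc; have r0 : 0 <= r by apply: le_trans r2; rewrite invr_ge0.
have e0 : 0 < 1 - r by rewrite subr_gt0.
rewrite poisson_expi//; have -> : 1 - r ^+ 2 = (1 - r) * (1 + r) by ring.
have d : k <= (1 - r) ^+ 2 + 2 * r * (1 - cos (s - t)).
  have c0 : 0 <= 1 - cos (s - t) by rewrite subr_ge0 cos_le1.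
  apply: (le_trans kc); rewrite -[leLHS]add0r lerD ?sqr_ge0// ler_peMl//; lra.
apply: ler_pM.
- by rewrite mulr_ge0// ?ltW//; lra.
- by rewrite invr_ge0 (le_trans _ d)// ltW.
- by rewrite mulrC ler_wpM2r ?ltW//; lra.
- by rewrite lef_pV2// posrE// (lt_le_trans k0).
Qed.

(** Evenness and periodicity fold [x] to a point between d and pi, where cos decreases. *)
Lemma cos_away (d x : R) : 0 <= d -> d <= `|x| -> `|x| <= 2 * pi - d -> cos x <= cos d.
Proof.
move=> d0 dx xd; have -> : cos x = cos `|x|.
  by have [x0|x0] := leP 0 x; [rewrite ger0_norm|rewrite ltr0_norm ?cosN].
move: `|x| dx xd => y dy yd.
have pi0 := pi_ge0 R.
have mono a b : 0 <= a -> a <= b -> b <= pi -> cos b <= cos a.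
  move=> a0 ab bpi; have [->//|nab] := eqVneq a b; apply: ltW.
  by rewrite ltr_cos ?in_itv/= ?a0 ?bpi ?(le_trans a0) ?(le_trans ab)// lt_neqAle nab.
have [ypi|piy] := leP y pi; first exact: mono.
rewrite -(cosN y) -(cosD2pi (- y)); apply: mono => //; rewrite -mulr_natl; lra.
Qed.

Local Open Scope ereal_scope.

(* On the annulus 2^j e <= |s - t| < 2^(j+1) e the kernel is at most K / (4^j e)
   while v has integral at most 2^(j+1) eta e, so the annuli contribute a
   geometric series. *)
Lemma dyadic_kernel_bound (t e K eta : R) (v k : R -> R) :
  (0 < e)%R -> (0 <= K)%R -> (0 <= eta)%R ->
  measurable_fun setT v -> measurable_fun setT k ->
  (forall s, (0 <= v s)%R) -> (forall s, (0 <= k s)%R) ->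
  (forall rho, (0 < rho)%R -> \int[mu]_(s in ball t rho) (v s)%:E <= (eta * rho)%:E) ->
  (forall s, (v s * k s <= v s * (K / e))%R) ->
  (forall s, (v s * k s * (s - t) ^+ 2 <= v s * (K * e))%R) ->
  forall j, \int[mu]_(s in ball t (2 ^+ j * e)%R) (v s * k s)%:E <=
    (K * eta * (1 + 4 * (1 - 2^-1 ^+ j)))%:E.
Proof.
move=> e0 K0 eta0 mv mk v0 k0 vA vk1 vk2.
have vk0 s : 0 <= (v s * k s)%:E by rewrite lee_fin mulr_ge0.
have mvk D : measurable_fun D (fun s => (v s * k s)%:E).
  by apply/measurable_EFinP; exact: measurable_funTS (measurable_funM mv mk).
have mvE D : measurable_fun D (EFin \o v).
  by apply/measurable_EFinP; exact: measurable_funTS mv.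
have v0E s : 0 <= (v s)%:E by rewrite lee_fin.
have scale D (c : R) : measurable D -> (0 <= c)%R ->
    (forall s, D s -> (v s * k s <= c * v s)%R) ->
    \int[mu]_(s in D) (v s * k s)%:E <= c%:E * \int[mu]_(s in D) (v s)%:E.
  move=> mD c0 vc; rewrite -(ge0_integralZl_EFin mu mD (fun s _ => v0E s) (mvE D) c0).
  apply: ge0_le_integral => //.
  - exact: mvk.
  - by apply: measurable_funeM; exact: mvE.
(* The innermost ball contributes K eta, and the annulus beyond radius 2^j e at most 2 K eta / 2^j,
   which is the increment of 4 K eta (1 - 2^-j). *)
elim=> [|j IH].
  rewrite expr0 mul1r subrr mulr0 addr0 mulr1.
  apply: (@le_trans _ _ ((K / e)%:E * \int[mu]_(s in ball t e) (v s)%:E)).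
    apply: scale; [exact: measurable_ball|by rewrite divr_ge0// ltW|].
    by move=> s _; rewrite [leRHS]mulrC.
  apply: (@le_trans _ _ ((K / e)%:E * (eta * e)%:E)).
    by rewrite lee_wpmul2l ?vA// lee_fin divr_ge0// ltW.
  rewrite -EFinM lee_fin le_eqVlt; apply/orP; left; apply/eqP; field.
  by rewrite gt_eqF.
set rho := (2 ^+ j * e)%R in IH *.
have rho0 : (0 < rho)%R by rewrite mulr_gt0// exprn_gt0.
have -> : (2 ^+ j.+1 * e = 2 * rho)%R by rewrite exprS mulrA.
have sub : ball t rho `<=` ball t (2 * rho)%R.
  by apply: le_ball; rewrite ler_peMl ?ltW// ltr1n.
have mA : measurable (ball t rho : set (measurableTypeR R)) by exact: measurable_ball.
have mB : measurable (ball t (2 * rho)%R `\` ball t rho : set (measurableTypeR R)).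
  by apply: measurableD => //; exact: measurable_ball.
have dAB : [disjoint ball t rho & ball t (2 * rho)%R `\` ball t rho].
  by apply/disj_setPS => s [/= h1 []].
rewrite -(setDUK sub) (ge0_integral_setU mu mA mB (mvk _) (fun s _ => vk0 s) dAB).
have c0 : (0 <= K * e / rho ^+ 2)%R by rewrite divr_ge0 ?sqr_ge0 ?mulr_ge0 ?(ltW e0).
have vkB s : (ball t (2 * rho)%R `\` ball t rho) s -> (v s * k s <= K * e / rho ^+ 2 * v s)%R.
  move=> [_ /= /negP]; rewrite /ball/= -leNgt => rs.
  rewrite mulrAC ler_pdivlMr ?exprn_gt0//.
  apply: (@le_trans _ _ (v s * k s * (s - t) ^+ 2)%R).
    rewrite ler_wpM2l ?mulr_ge0// -(real_normK (num_real (s - t))) distrC.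
    by rewrite lerXn2r ?nnegrE// ltW.
  by rewrite [leRHS]mulrC; exact: vk2.
apply: (le_trans (leeD IH (scale _ _ mB c0 vkB))).
apply: (@le_trans _ _ ((K * eta * (1 + 4 * (1 - 2^-1 ^+ j)))%:E +
    (K * e / rho ^+ 2)%:E * (eta * (2 * rho))%:E)).
  rewrite leeD2l// lee_wpmul2l ?lee_fin//.
  apply: le_trans (vA _ _); last by rewrite mulr_gt0.
  apply: (@ge0_subset_integral _ _ _ _ _ _ mB _ (EFin \o v) (mvE _)).
  - exact: measurable_ball.
  - by move=> s _; exact: v0E.
  - by move=> s [].
rewrite -EFinM -EFinD lee_fin le_eqVlt; apply/orP; left; apply/eqP.
rewrite /rho [(2^-1 ^+ j.+1)%R]exprS !exprVn; field.
by rewrite ?gt_eqF ?exprn_gt0.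
Qed.

End PoissonFatou.

Lemma poisson_le (R : realType) (z : R[i]) x : normc z < 1 ->
  poisson z x <= (1 - normc z)^-1 ^+ 2.
Proof.
move=> z1; have k1 := normc_cauchy_kernel x z1.
rewrite /poisson -[_ / _]/(_ * (_ ^+ 2)^-1) -exprVn -ComplexField.Normc.normcV.
rewrite -[leRHS]mul1r; apply: ler_pM.
- by rewrite subr_ge0 expr_le1// ?normc_ge0// ltW.
- by rewrite exprn_ge0// normc_ge0.
- by rewrite gerBl exprn_ge0// normc_ge0.
- by rewrite lerXn2r ?nnegrE ?normc_ge0// invr_ge0 subr_ge0 ltW.
Qed.

Lemma rmeasurable_poisson (R : realType) (z : R[i]) : normc z < 1 -> rmeasurable (poisson z).
Proof.
move=> z1; apply: rintegrable_rmeasurable.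
exact: (L1_continuous (poisson_continuous z1)).1.
Qed.

Lemma rintegrable_poisson (R : realType) (z : R[i]) (G : circle R -> R) : normc z < 1 ->
  rintegrable G -> rintegrable (fun x => G x * poisson z x).
Proof.
move=> z1 iG; pose B := (1 - normc z)^-1 ^+ 2.
apply: (rintegrable_le (H := fun x => B * `|G x|)).
- apply: measurable_funM; first exact: rintegrable_rmeasurable iG.
  exact: rmeasurable_poisson z1.
- exact: rintegrableZ (rintegrable_norm iG).
- apply: ae_circleW => x; rewrite normrM mulrC ler_wpM2r//.
  by rewrite ger0_norm ?poisson_ge0//; exact: poisson_le.
Qed.

Lemma L1_poisson (R : realType) (z : R[i]) (f : circle R -> R[i]) : normc z < 1 ->
  L1 f -> L1 (fun x => f x * (poisson z x)%:C).
Proof.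
move=> z1 Lf; apply: (L1M_bounded (M := (1 - normc z)^-1 ^+ 2) Lf).
  exact: L1_cmeasurable (L1_continuous (poisson_continuous z1)).
apply: ae_circleW => x; rewrite normc_real ger0_norm ?poisson_ge0//.
exact: poisson_le.
Qed.

Section RadialLimit.
Variable R : realType.
Local Notation mu := (@lebesgue_measure R).
Local Notation C := R[i].
Local Notation I := (`[0, 2 * pi]%classic : set (measurableTypeR R)).
Variable G : circle R -> R.
Hypothesis iG : rintegrable G.

Let f : R -> R := (fun t => G (expi t)) \_ I.

Let mf : measurable_fun setT f.
Proof.
by apply/(measurable_restrictT _ _).1; [exact: I_measurable|exact: rintegrable_rmeasurable].
Qed.

Let fE t : I t -> f t = G (expi t).
Proof. by move=> It; rewrite /f patchE mem_set. Qed.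

Let poisson_measurable z : normc z < 1 -> measurable_fun setT (fun s : R => poisson z (expi s)).
Proof.
move=> z1; apply: continuous_measurable_fun.
exact: (circle_continuous_Re (poisson_continuous z1)).
Qed.

Let lebesgue_pt_ball t (eta : R) : 0 < eta -> lebesgue_pt f t -> exists2 d : R, 0 < d &
  forall rho, 0 < rho -> rho < d ->
    (\int[mu]_(s in ball t rho) `|f s - f t|%:E <= (2 * eta * rho)%:E)%E.
Proof.
move=> eta0 ft.
have : \forall rho \near 0^'+, (davg f t rho < eta%:E)%E.
  by apply: (ft [set y | (y < eta%:E)%E]); exact: (@nbhs_open_ereal_lt R 0 (fun=> eta)).
rewrite near_withinE => /nbhs_ballP[d /= d0 hd].
exists d => // rho rho0 rhod.
have : ball (0 : R) d rho by rewrite /ball/= sub0r normrN gtr0_norm.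
move=> /hd/(_ rho0) /ltW; rewrite /davg /iavg lebesgue_measure_ball; last exact: ltW.
rewrite inver mulrn_eq0/= gt_eqF//.
rewrite lee_pdivrMl; last by rewrite mulrn_wgt0.
by rewrite -EFinM; move=> /le_trans; apply; rewrite lee_fin -mulr_natl; lra.
Qed.

(** The kernel has mean 1, so the error is at most the mean of |G - G(t)| times the kernel. Within
    distance d of t the Lebesgue point property enters through the dyadic estimate; farther away the
    kernel itself is of order 1 - r. *)
Lemma poisson_radial_limit_lebesgue_pt t : 0 < t -> t < 2 * pi -> lebesgue_pt f t ->
  (fun r => mean (fun y => G y * poisson (r%:C * val (expi t)) y)) @ 1^'- --> G (expi t).
Proof.
move=> t0 tpi ft; set a := G (expi t).
have pi2 := @pi_ge2 R.
have It : I t by rewrite /= in_itv/= !ltW.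
have fta : f t = a by rewrite fE.
pose n s := `|f s - a|.
have n0 s : 0 <= n s by exact: normr_ge0.
have mn : measurable_fun setT n.
  by apply: measurableT_comp => //; apply: measurable_funB.
have In : rintegrable (fun y => `|G y - a|).
  have := rintegrable_norm (rintegrableD iG (rintegrable_cst (- a))).
  by [].
pose J := fine (\int[mu]_(s in I) (n s)%:E)%E.
have IJ : (\int[mu]_(s in I) (n s)%:E)%E = J%:E.
  have IE : (\int[mu]_(s in I) (n s)%:E = \int[mu]_(s in I) (`|G (expi s) - a|)%:E)%E.
    by apply: eq_integral => s /set_mem Is; rewrite /n fE.
  rewrite /J IE fineK//; have := integrable_fin_num (@I_measurable R) In; exact.
have J0 : 0 <= J by rewrite fine_ge0// integral_ge0// => s _; rewrite lee_fin.
apply/cvgrPdist_lt => e e0.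
(* The near part will be at most 180 eta = 1.8 e and the far part at most 2 e, while their sum has
   to stay below 2 pi e, which is at least 4 e. *)
pose eta := e / 100; have eta0 : 0 < eta by rewrite divr_gt0.
have [d1 d10 cosd] := onemcos_lower R.
have [d2 d20 avg] := lebesgue_pt_ball eta0 ft.
(* The last two entries give |s - t| <= 2 pi - d for all s in [I], so no point of [I] is close to t
   across the ends of the interval. *)
pose d := Num.min d1 (Num.min d2 (Num.min t (2 * pi - t))) / 2.
have [dp dd1 dd2 dt dpi] : [/\ 0 < d, d < d1, d < d2, d < t & d < 2 * pi - t].
  rewrite /d; set m := Num.min d1 _.
  have m0 : 0 < m by rewrite !lt_min d10 d20 t0 subr_gt0.
  have mm : m / 2 < m by rewrite ltr_pdivrMr// ltr_pMr// ltr1n.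
  have : m <= m by [].
  rewrite {2}/m !le_min => /and4P[h1 h2 h3 h4].
  by split; [rewrite divr_gt0|exact: lt_le_trans h1|exact: lt_le_trans h2|
    exact: lt_le_trans h3|exact: lt_le_trans h4].
pose kap := 1 - cos d.
have kap0 : 0 < kap.
  have := cosd d; rewrite gtr0_norm// => /(_ dd1); apply: lt_le_trans.
  by rewrite divr_gt0// exprn_gt0.
have J1 : 0 < J + 1 by rewrite ltr_wpDl.
have far s : I s -> d <= `|s - t| -> kap <= 1 - cos (s - t).
  rewrite /= in_itv/= => /andP[s0 s2] ds; rewrite lerD2l lerN2.
  apply: cos_away => //; first exact: ltW.
  by rewrite ler_norml; apply/andP; split; lra.
have small : \forall r \near 1^'-, [/\ r < 1, 2^-1 <= r & (1 - r) * (J + 1) < e * kap].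
  have h2 : (2^-1 : R) < 1 by rewrite invf_lt1// ltr1n.
  have h3 : 1 - e * kap / (J + 1) < 1 by rewrite gtrBl divr_gt0// mulr_gt0.
  apply: filterS3 (nbhs_left_lt (1 : R)) (nbhs_left_ge h2) (nbhs_left_gt h3) => r rl rg rk.
  by split=> //; rewrite -ltr_pdivlMr// ltrBlDr -ltrBlDl.
apply: filterS small => r [r1 r2 rJ].
have r0 : 0 <= r by apply: le_trans r2; rewrite invr_ge0.
pose z := r%:C * val (expi t).
have z1 : normc z < 1 by rewrite normc_dilation_arg.
pose ep := 1 - r; have ep0 : 0 < ep by rewrite subr_gt0.
pose k (s : R) := poisson z (expi s).
have k0 s : 0 <= k s by exact: poisson_ge0.
have mk : measurable_fun setT k by exact: poisson_measurable.
pose v : R -> R := n \_ (ball t d).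
have v0 s : 0 <= v s by rewrite /v patchE; case: ifP.
have mv : measurable_fun setT v.
  apply/(measurable_restrictT _ _).1; first exact: measurable_ball.
  exact: measurable_funTS mn.
have ballE s : (s \in (ball t d : set R)) = (`|s - t| < d).
  by rewrite distrC; apply/idP/idP => [h|h]; [exact: set_mem h|exact: (@mem_set _ (ball t d) s h)].
have vA rho : 0 < rho -> (\int[mu]_(s in ball t rho) (v s)%:E <= (2 * eta * rho)%:E)%E.
  move=> rho0; pose m := Num.min rho d.
  have m0 : 0 < m by rewrite lt_min rho0.
  have -> : (\int[mu]_(s in ball t rho) (v s)%:E =
      \int[mu]_(s in ball t rho) ((EFin \o n) \_ (ball t d)) s)%E.
    by apply: eq_integral => s _; rewrite /v !patchE; case: ifP.
  rewrite -integral_mkcondr.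
  apply: (@le_trans _ _ (\int[mu]_(s in ball t m) (n s)%:E)%E).
    apply: ge0_subset_integral.
    - by apply: measurableI; exact: measurable_ball.
    - exact: measurable_ball.
    - by apply/measurable_EFinP; exact: measurable_funTS mn.
    - by move=> s _; rewrite lee_fin.
    - by move=> s []; rewrite /ball/= lt_min => -> ->.
  rewrite /n -fta; apply: (le_trans (avg m m0 _)).
    by rewrite gt_min dd2 orbT.
  rewrite lee_fin; apply: ler_wpM2l; first by rewrite mulr_ge0 ?(ltW eta0).
  by rewrite ge_min lexx.
(* One constant has to dominate the 2 of the central bound and the 2 * 8 = 16 of the decaying bound;
   18 does. *)
have vk1 s : v s * k s <= v s * (18 / ep).
  rewrite ler_wpM2l//; apply: (le_trans (poisson_upper1 s t r0 r1)).
  by rewrite ler_wpM2r ?invr_ge0 ?(ltW ep0)// ler_nat.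
have vk2 s : v s * k s * (s - t) ^+ 2 <= v s * (18 * ep).
  rewrite -mulrA; rewrite /v patchE ballE; case: ifPn => [sd|_]; last by rewrite !mul0r.
  rewrite ler_wpM2l//; have [->|st] := eqVneq (s - t) 0.
    by rewrite expr0n mulr0 mulr_ge0 ?(ltW ep0).
  have st0 : 0 < (s - t) ^+ 2 by rewrite lt_neqAle sqr_ge0 eq_sym sqrf_eq0 st.
  have := poisson_upper2 r2 r1 (_ : 0 < (s - t) ^+ 2 / 8) (cosd _ (lt_trans sd dd1)).
  rewrite divr_gt0// => /(_ isT) kle.
  rewrite -ler_pdivlMr//; apply: (le_trans kle).
  rewrite invf_div mulrA; apply: ler_wpM2r; first by rewrite invr_ge0 ltW.
  by rewrite -/ep; have := ep0; lra.
(* Enough dyadic annuli to cover all of [I]; the bound they give does not grow with j. *)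
have [j hj] : exists j : nat, 2 * pi < 2 ^+ j * ep.
  exists (Num.trunc (2 * pi / ep)).+1; rewrite -ltr_pdivrMr//.
  by apply: (lt_trans (truncnS_gt _)); rewrite -natrX ltr_nat ltn_expl.
have eta20 : 0 <= 2 * eta by rewrite mulr_ge0 ?(ltW eta0).
have near_int := @dyadic_kernel_bound R t ep 18 (2 * eta) v k ep0 (ler0n R 18) eta20 mv mk v0 k0
  vA vk1 vk2 j.
have mvkI : measurable_fun I (fun s => v s * k s).
  by apply: measurable_funTS; exact: measurable_funM mv mk.
have mnI : measurable_fun I n by exact: measurable_funTS mn.
have Ivk : (\int[mu]_(s in I) (v s * k s)%:E <= (180 * eta)%:E)%E.
  apply: le_trans (_ : _ <= (18 * (2 * eta) * (1 + 4 * (1 - 2^-1 ^+ j)))%:E)%E _; last first.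
    rewrite lee_fin; have : 0 <= (2^-1 : R) ^+ j by rewrite exprn_ge0// invr_ge0.
    have := eta0; nra.
  apply: le_trans near_int; apply: ge0_subset_integral.
  - exact: I_measurable.
  - exact: measurable_ball.
  - by apply/measurable_EFinP; apply: measurable_funTS; exact: measurable_funM mv mk.
  - by move=> s _; rewrite lee_fin mulr_ge0.
  - move=> s; rewrite /= in_itv/= => /andP[s0 s2].
    change (`|t - s| < 2 ^+ j * ep).
    by apply: le_lt_trans hj; rewrite ler_norml; apply/andP; split; lra.
pose c := 2 * ep / kap.
have c0 : 0 <= c by rewrite divr_ge0 ?mulr_ge0 ?(ltW ep0) ?(ltW kap0).
have Ink : (\int[mu]_(s in I) (`|G (expi s) - a| * k s)%:E <= (180 * eta + c * J)%:E)%E.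
  apply: (@le_trans _ _ (\int[mu]_(s in I) ((v s * k s)%:E + c%:E * (n s)%:E))%E).
    apply: ge0_le_integral.
    - exact: I_measurable.
    - by move=> s _; rewrite lee_fin mulr_ge0.
    - apply/measurable_EFinP/measurable_funM; last exact: measurable_funTS mk.
      exact: rintegrable_rmeasurable In.
    - apply: emeasurable_funD; first by apply/measurable_EFinP; exact: mvkI.
      by apply/measurable_EFinP; apply: measurable_funM => //; exact: mnI.
    - move=> s Is; rewrite -EFinM -EFinD lee_fin -fE//.
      rewrite /v patchE ballE; case: ifPn => [sd|]; first by rewrite lerDl mulr_ge0.
      rewrite -leNgt => /(far _ Is) hk; rewrite mul0r add0r (mulrC c).
      by rewrite ler_wpM2l//; exact: (poisson_upper2 r2 r1 kap0 hk).
  rewrite ge0_integralD.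
  - rewrite ge0_integralZl//.
    + by rewrite IJ EFinD EFinM leeD2r.
    + by apply/measurable_EFinP.
    + by move=> s _; rewrite lee_fin.
  - exact: I_measurable.
  - by move=> s _; rewrite lee_fin mulr_ge0.
  - by apply/measurable_EFinP; exact: mvkI.
  - by move=> s _; rewrite -EFinM lee_fin mulr_ge0.
  - by apply/measurable_EFinP; apply: measurable_funM => //; exact: mnI.
have iGa : rintegrable (fun y => G y + - a) by exact: rintegrableD iG (rintegrable_cst _).
have lin : mean (fun y => G y * poisson z y) - a = mean (fun y => (G y - a) * poisson z y).
  under [in RHS]eq_fun do rewrite mulrBl -mulNr.
  rewrite meanD; [|exact: rintegrable_poisson|]; last first.
    exact: rintegrable_poisson z1 (rintegrable_cst _).
  rewrite meanZ ?mean_poisson ?mulr1//.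
  have := rintegrable_poisson z1 (rintegrable_cst 1).
  by under eq_fun do rewrite mul1r.
have iGk : rintegrable (fun y => `|G y - a| * poisson z y).
  exact: rintegrable_poisson z1 (rintegrable_norm iGa).
have meanle : mean (fun y => `|G y - a| * poisson z y) <= (2 * pi)^-1 * (180 * eta + c * J).
  rewrite /mean ler_wpM2l ?invr_ge0 ?mulr_ge0//; first exact: pi_ge0.
  rewrite -lee_fin fineK; first exact: Ink.
  by have := integrable_fin_num (@I_measurable R) iGk; exact.
rewrite -/z distrC lin.
apply: (@le_lt_trans _ _ (mean (fun y => `|G y - a| * poisson z y))).
  have abs1 := rintegrable_poisson z1 iGa.
  rewrite ler_norml -[- mean _]mulN1r -meanZ//; apply/andP; split; apply: le_mean => //.
  - exact: rintegrableZ.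
  - apply: ae_circleW => y; rewrite mulN1r -mulNr ler_wpM2r ?poisson_ge0//.
    by have := ler_norm (- (G y - a)); rewrite normrN lerNl.
  - by apply: ae_circleW => y; rewrite ler_wpM2r ?poisson_ge0// ler_norm.
apply: le_lt_trans meanle _.
rewrite mulrC ltr_pdivrMr; last by rewrite mulr_gt0// pi_gt0.
have cJ : c * J <= 2 * e.
  rewrite /c mulrAC ler_pdivrMr// -!mulrA ler_wpM2l//.
  by apply: le_trans (ltW rJ); rewrite ler_wpM2l ?(ltW ep0)// lerDl.
have e4 : e * 4 <= e * (2 * pi) by rewrite ler_wpM2l ?(ltW e0)//; lra.
by rewrite /eta; lra.
Qed.

End RadialLimit.

Section Fatou.
Variable R : realType.
Local Notation mu := (@lebesgue_measure R).
Local Notation C := R[i].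
Local Notation I := (`[0, 2 * pi]%classic : set (measurableTypeR R)).

Let ae_filter_lebesgue : Filter (nbhs (almost_everywhere mu)).
Proof. exact: (ae_filter_ringOfSetsType mu). Qed.
#[local] Existing Instance ae_filter_lebesgue.

Lemma poisson_fatou (G : circle R -> R) : rintegrable G -> ae_circle (fun x =>
  (fun r => mean (fun y => G y * poisson (r%:C * val x) y)) @ 1^'- --> G x).
Proof.
move=> iG; pose f : R -> R := (fun t => G (expi t)) \_ I.
have lf : locally_integrable setT f by exact: integrable_locally (@I_measurable R) iG.
(* The two ends of [I], where the local argument does not apply, form a null set. *)
have ne (a : R) : {ae mu, forall t, t != a}.
  exists [set a]; split; [exact: measurable_set1|exact: lebesgue_measure_set1|].
  by move=> t /= /negP; rewrite negbK => /eqP.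
have lp : {ae mu, forall t, lebesgue_pt f t} by exact: lebesgue_differentiation.
have l2 := @filterS3 _ _ ae_filter_lebesgue _ _ _ _
  (fun t h1 h2 h3 => conj h1 (conj h2 h3)) (ne 0) (ne (2 * pi)) lp.
rewrite /ae_circle; apply: (@filterS _ _ ae_filter_lebesgue _ _ _ l2) => t [t0 [t2 ft]].
rewrite /= in_itv/= => /andP[ge0 le2].
have t0' : 0 < t by rewrite lt_neqAle eq_sym t0.
have t2' : t < 2 * pi by rewrite lt_neqAle t2.
exact: (poisson_radial_limit_lebesgue_pt iG t0' t2' ft).
Qed.

Lemma cmean_mulr_real (g : circle R -> C) (P : circle R -> R) :
  cmean (fun x => g x * (P x)%:C) =
  mean (fun x => complex.Re (g x) * P x) +i* mean (fun x => complex.Im (g x) * P x).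
Proof.
rewrite /cmean; congr (mean _ +i* mean _); apply/funext => x; case: (g x) => a b /=.
  by rewrite mulr0 subr0.
by rewrite mulr0 add0r.
Qed.

Lemma poisson_radial_limit (h : Hinf R) (g : circle R -> C) : L1 g ->
  (forall z : C, normc z < 1 -> extension h z = cmean (fun y => g y * (poisson z y)%:C)) ->
  ae_circle (fun x => extension h (r%:C * val x) @[r --> 1^'-] --> g x).
Proof.
move=> [rg ig] hg.
apply: (ae_circleS2 _ (poisson_fatou rg) (poisson_fatou ig)) => x cr ci.
have near1 : \forall r \near (1 : R)^'-, 0 <= r /\ r < 1.
  have h0 : (0 : R) < 1 by [].
  exact: (filterI (nbhs_left_ge h0) (nbhs_left_lt (1 : R))).
pose H (r : R) : C :=
  mean (fun y => complex.Re (g y) * poisson (r%:C * val x) y) +i*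
  mean (fun y => complex.Im (g y) * poisson (r%:C * val x) y).
have Hg : H r @[r --> 1^'-] --> g x by apply/cvg_ReIm; split; [exact: cr|exact: ci].
apply: cvg_trans Hg; apply: near_eq_cvg; apply: filterS near1 => r [r0 r1].
rewrite /H -cmean_mulr_real -hg//.
by rewrite normc_dilation_arg.
Qed.

(** Only a Poisson representation is asked of [g], not [boundary_function]: for the synthesized
    functions nothing else is at hand when their pairings are computed. *)
Lemma pairing_cmean (h : Hinf R) (f g : circle R -> C) : L1 g ->
  (forall z : C, normc z < 1 -> extension h z = cmean (fun y => g y * (poisson z y)%:C)) ->
  pairing f h = cmean (fun x => f x * g x).
Proof.
move=> Lg hg; apply: ae_cmean; apply: ae_circleS (poisson_radial_limit Lg hg) => x hx.
congr (_ * _); apply: cvg_lim hx; exact: norm_hausdorff.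
Qed.

Lemma pairing_boundary_function (h : Hinf R) (f u : circle R -> C) : boundary_function h u ->
  pairing f h = cmean (fun x => f x * u x).
Proof.
move=> hu; have [Lu _ _ _] := hu.
by apply: pairing_cmean Lu _ => z z1; exact: boundary_function_poisson.
Qed.

Lemma boundary_function_radial (h : Hinf R) (u : circle R -> C) : boundary_function h u ->
  ae_circle (fun x => extension h (r%:C * val x) @[r --> 1^'-] --> u x).
Proof.
move=> hu; have [Lu _ _ _] := hu.
by apply: poisson_radial_limit Lu _ => z z1; exact: boundary_function_poisson.
Qed.

Lemma L1_boundary_function (h : Hinf R) (f u : circle R -> C) : boundary_function h u ->
  L1 f -> L1 (fun x => f x * u x).
Proof.
by move=> [Lu ub _ _] Lf; exact: (L1M_bounded Lf (L1_cmeasurable Lu) ub).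
Qed.

End Fatou.

(** * Cauchy transforms and point masses *)

Section CauchyTransform.
Variable R : realType.
Local Notation C := R[i].

Lemma cauchy_kernel_shift (z0 z : C) (x : circle R) : normc z0 < 1 ->
  cauchy_kernel z x =
  cauchy_kernel z0 x * (1 - (val x)^-1 * cauchy_kernel z0 x * (z - z0))^-1.
Proof.
move=> z01; have d0 := cauchy_kernel_den x z01.
rewrite /cauchy_kernel -invfM; congr (_^-1); move: d0; set a := (val x)^-1 => d0.
by field.
Qed.

(** Cauchy integrals are analytic in the required local sense: by [cauchy_kernel_shift] the kernel
    is a geometric series in z - z0 with ratio at most |z - z0| / (1 - |z0|). *)
Lemma cauchy_transform_expansion (g : circle R -> C) (z0 z : C) : L1 g -> normc z0 < 1 ->
  normc (z - z0) < 1 - normc z0 ->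
  series (fun n => cmean (fun x => g x * cauchy_kernel z0 x *
    ((val x)^-1 * cauchy_kernel z0 x) ^+ n) * (z - z0) ^+ n) @ \oo -->
  cmean (fun x => g x * cauchy_kernel z x).
Proof.
move=> Lg z01 zz; pose q (x : circle R) := (val x)^-1 * cauchy_kernel z0 x.
have d0 : 0 < 1 - normc z0 by rewrite subr_gt0.
have ck := cauchy_kernel_continuous z01.
have Lgk : L1 (fun x => g x * cauchy_kernel z0 x).
  apply: (@L1M_bounded _ _ _ ((1 - normc z0)^-1) Lg (L1_cmeasurable (L1_continuous ck))).
  by apply: ae_circleW => x; exact: normc_cauchy_kernel.
have nq x : normc (q x) <= (1 - normc z0)^-1.
  rewrite /q ComplexField.Normc.normcM ComplexField.Normc.normcV normc_circle invr1 mul1r.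
  exact: normc_cauchy_kernel.
have cq : circle_continuous q.
  have /circle_continuousM := @circle_continuousXV R 1; apply.
  exact: ck.
have cqn n : circle_continuous (fun x => q x ^+ n).
  elim: n => [|n IH]; first exact: (@circle_continuous_cst R 1).
  have := circle_continuousM cq IH; by under eq_fun do rewrite -exprS.
have Lgq n : L1 (fun x => g x * cauchy_kernel z0 x * q x ^+ n).
  apply: (@L1M_bounded _ _ _ ((1 - normc z0)^-1 ^+ n) Lgk (L1_cmeasurable (L1_continuous (cqn n)))).
  apply: ae_circleW => x; rewrite normcX.
  by apply: lerXn2r; rewrite ?nnegrE ?normc_ge0 ?invr_ge0 ?(ltW d0)//; exact: nq.
(* This real ratio takes the place of [z] in [cmean_L1_series_kernel]. *)
pose rho := (1 - normc z0)^-1 * normc (z - z0).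
have rho0 : 0 <= rho by rewrite mulr_ge0 ?normc_ge0// invr_ge0 ltW.
have rho1 : rho < 1 by rewrite /rho mulrC ltr_pdivrMr// mul1r.
have nr : normc (rho%:C : C) = rho by rewrite normc_real ger0_norm.
have qw x : normc (q x * (z - z0)) <= rho.
  rewrite ComplexField.Normc.normcM; apply: ler_wpM2r (nq x); exact: normc_ge0.
have HP n : circle_continuous (fun x => (q x * (z - z0)) ^+ n).
  have := circle_continuousM (cqn n) (@circle_continuous_cst R ((z - z0) ^+ n)).
  by under eq_fun do rewrite -exprMn.
have rho1' : normc (rho%:C : C) < 1 by rewrite nr.
have HQ n x : normc ((q x * (z - z0)) ^+ n) <= normc (rho%:C : C) ^+ n.
  by rewrite nr normcX; apply: lerXn2r; rewrite ?nnegrE ?normc_ge0//; exact: qw.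
have HS x : series (fun n => (q x * (z - z0)) ^+ n) @ \oo --> (1 - q x * (z - z0))^-1.
  by apply: cvg_cgeometric; exact: le_lt_trans rho1.
have := cmean_L1_series_kernel Lgk rho1' HP HQ HS.
rewrite (_ : (fun x => g x * cauchy_kernel z0 x * (1 - q x * (z - z0))^-1) =
  (fun x => g x * cauchy_kernel z x)); last first.
  by apply/funext => x; rewrite (cauchy_kernel_shift z x z01) mulrA.
rewrite (_ : (fun n => cmean (fun x => g x * cauchy_kernel z0 x * (q x * (z - z0)) ^+ n)) =
   (fun n => cmean (fun x => g x * cauchy_kernel z0 x * q x ^+ n) * (z - z0) ^+ n)); first exact.
apply/funext => n; rewrite -(cmeanZ _ (Lgq n)); congr cmean; apply/funext => x.
by rewrite exprMn mulrA.
Qed.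

End CauchyTransform.

Section MeasurableLimit.
Variable R : realType.
Local Notation C := R[i].

(* Borel measurability is lost along a.e. limits, so the limit has to be
   replaced by a measurable representative. *)
Lemma cmeasurable_ae_cvg (f : nat -> circle R -> C) (g : circle R -> C) :
  (forall n, cmeasurable (f n)) -> ae_circle (fun x => f ^~ x @ \oo --> g x) ->
  exists2 g', cmeasurable g' & ae_circle (fun x => g x = g' x).
Proof.
move=> mf fg; pose L (F : nat -> circle R -> R) x := fine (limn_esup (fun n => (F n x)%:E)).
have mL F : (forall n, rmeasurable (F n)) -> rmeasurable (L F).
  move=> mF; have mfine : measurable_fun [set: \bar R] (@fine R) by exact: fine_measurable.
  apply: (measurableT_comp mfine (g := fun t => limn_esup (fun n => (F n (expi t))%:E))).
  by apply: measurable_fun_limn_esup => n; apply/measurable_EFinP; exact: mF.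
have LE F x l : F ^~ x @ \oo --> l -> L F x = l.
  move=> Fl; have Fe : (fun n => (F n x)%:E) @ \oo --> l%:E.
    by apply: cvg_EFin Fl; exact: nearW.
  by rewrite /L (cvg_limn_einf_sup Fe).2.
exists (fun x => L (fun n x => complex.Re (f n x)) x +i* L (fun n x => complex.Im (f n x)) x).
  by split; apply: mL => n; have [] := mf n.
apply: ae_circleS fg => x /cvg_ReIm[cr ci].
rewrite (LE _ _ _ cr) (LE _ _ _ ci); by case: (g x).
Qed.

End MeasurableLimit.

Section Evaluation.
Variable R : realType.
Local Notation C := R[i].

Lemma pairing_poisson (z : C) (h : Hinf R) : normc z < 1 ->
  pairing (fun x => (poisson z x)%:C) h = extension h z.
Proof.
move=> z1; have [u hu] := boundary_function_exists h.
rewrite (pairing_boundary_function _ hu) (boundary_function_poisson hu z1).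
by congr cmean; apply/funext => x; rewrite mulrC.
Qed.

Lemma pairing_cauchy_kernel (z : C) (h : Hinf R) : normc z < 1 ->
  pairing (cauchy_kernel z) h = extension h z.
Proof.
move=> z1; have [u hu] := boundary_function_exists h.
rewrite (pairing_boundary_function _ hu) (boundary_function_cauchy hu z1).
by congr cmean; apply/funext => x; rewrite mulrC.
Qed.

Lemma point_mass_series (a : l1 R) (b : nat -> disk R) : exists f : circle R -> C,
  [/\ L1 f, L1norm f <= l1norm a &
      forall h : Hinf R, series (fun n => a n * h (b n)) @ \oo --> pairing f h].
Proof.
have b1 n : normc (val (b n)) < 1 by exact: normc_disk.
pose k n x : C := (poisson (val (b n)) x)%:C * a n.
have LP n : L1 (fun x => (poisson (val (b n)) x)%:C : C).
  exact: L1_continuous (poisson_continuous (b1 n)).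
have Lk n : L1 (k n) by exact: L1Z.
have nk n : L1norm (k n) = normc (a n).
  have -> : L1norm (k n) = mean (fun x => normc (a n) * poisson (val (b n)) x).
    rewrite /L1norm; congr mean; apply/funext => x.
    by rewrite ComplexField.Normc.normcM normc_real ger0_norm ?poisson_ge0// mulrC.
  have [iP _] := LP n; rewrite meanZ; last exact: iP.
  by rewrite mean_poisson// mulr1.
have ck : cvgn (series (fun n => L1norm (k n))).
  by under eq_fun do rewrite nk; exact: l1_summable.
have [_ [s [Ls ks _ ns]]] := L1_series Lk ck.
exists s; split=> //.
  by apply: le_trans ns _; under eq_fun do rewrite nk.
move=> h; have [u hu] := boundary_function_exists h.
have [_ ub _ _] := hu.
rewrite (pairing_boundary_function _ hu).
have Lku n := L1_boundary_function hu (Lk n).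
have cku : cvgn (series (fun n => L1norm (fun x => k n x * u x))).
  have : cvgn (series (fun n => supnorm h * normc (a n))).
    exact: is_cvg_seriesZ (@l1_summable R a).
  apply: series_le_cvg => n; first exact: L1norm_ge0.
    by rewrite mulr_ge0 ?supnorm_ge0 ?normc_ge0.
  rewrite -nk /L1norm -(meanZ _ (L1_normc (Lk n))); apply: le_mean.
  - exact: L1_normc (Lku n).
  - exact: rintegrableZ (L1_normc (Lk n)).
  - apply: ae_circleS ub => x ux; rewrite ComplexField.Normc.normcM mulrC.
    by rewrite ler_wpM2r ?normc_ge0.
have [_ [s' [_ kus cs _]]] := L1_series Lku cku.
rewrite (ae_cmean (g := s')); last first.
  apply: ae_circleS2 ks kus => x kx; apply: cvg_unique; first exact: norm_hausdorff.
  rewrite (_ : series _ = fun n => series (k ^~ x) n * u x); first exact: cvgMr_tmp kx.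
  by apply/funext => n; rewrite /series/= mulr_suml.
rewrite (_ : (fun n => a n * h (b n)) = (fun n => cmean (fun x => k n x * u x))) //.
apply/funext => n; rewrite -extensionE (boundary_function_poisson hu (b1 n)).
rewrite mulrC -(cmeanZ _ (L1_poisson (b1 n) (_ : L1 u))); last by have [] := hu.
by congr cmean; apply/funext => x; rewrite /k; ring.
Qed.

Lemma normc_taylor (h : Hinf R) n : normc (taylor h n) <= supnorm h.
Proof.
have [u hu] := boundary_function_exists h; have [Lu ub uc _] := hu.
have Lux : L1 (fun x => u x * (val x)^-1 ^+ n).
  have cX := L1_cmeasurable (L1_continuous (@circle_continuousXV R n)).
  by apply: (L1M_bounded (M := 1) Lu cX); apply: ae_circleW => x; rewrite normc_circleXV.
rewrite -uc; apply: le_trans (normc_cmean Lux) _.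
rewrite -[leRHS](@mean_cst R); apply: le_mean.
- exact: L1_normc Lux.
- exact: rintegrable_cst.
- apply: ae_circleS ub => x ux.
  by rewrite ComplexField.Normc.normcM normc_circleXV mulr1.
Qed.

Lemma H10_cmean (g : circle R -> C) n : H10 g -> cmean (fun x => g x * val x ^+ n) = 0.
Proof.
move=> [[Lg g0] g00]; case: n => [|n].
  by rewrite -[RHS]g00 /fourier; congr cmean; apply/funext => x; rewrite oppr0.
have := g0 (- n.+1%:Z); rewrite oppr_lt0 => /(_ isT) <-.
by rewrite /fourier; congr cmean; apply/funext => x; rewrite opprK.
Qed.

(** A dilation of [h] is a series of nonnegative powers, each annihilated by [g]; dominated
    convergence with majorant [supnorm h * normc (g x)] passes to the radial limit. This makes
    pairings well defined modulo [H10]. *)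
Lemma H10_pairing (g : circle R -> C) (h : Hinf R) : H10 g -> pairing g h = 0.
Proof.
move=> H10g; have [[Lg _] _] := H10g.
have [u hu] := boundary_function_exists h; have [Lu ub uc _] := hu.
have dil0 r : 0 <= r -> r < 1 -> cmean (fun x => g x * dilation h r x) = 0.
  (* Division by [S] brings the Taylor coefficients to modulus at most 1, so the terms are bounded
     by powers of r as [cmean_L1_series_kernel] demands; the 1 keeps [S] positive when [h] is
     zero. *)
  move=> r0 r1; pose S := supnorm h + 1.
  have S0 : 0 < S by rewrite ltr_wpDl// supnorm_ge0.
  have SC0 : (S%:C : C) != 0 by rewrite (fmorph_eq0 (real_complex R)) gt_eqF.
  have nr : normc (r%:C : C) = r by rewrite normc_real ger0_norm.
  pose e n (x : circle R) : C := S%:C^-1 * taylor h n * (r%:C * val x) ^+ n.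
  have LgS : L1 (fun x => g x * S%:C) by exact: L1Z.
  have eX n : e n = fun x => S%:C^-1 * taylor h n * r%:C ^+ n * val x ^+ n.
    by apply/funext => x; rewrite /e exprMn mulrA.
  have ce n : circle_continuous (e n).
    rewrite eX.
    exact: (circle_continuousM (@circle_continuous_cst R _) (@circle_continuous_exp R n)).
  have nt n : normc ((S%:C : C)^-1 * taylor h n) <= 1.
    rewrite ComplexField.Normc.normcM ComplexField.Normc.normcV normc_real (gtr0_norm S0).
    rewrite ler_pdivrMl// mulr1; apply: le_trans (normc_taylor h n) _.
    by rewrite /S lerDl.
  have ne n x : normc (e n x) <= normc (r%:C : C) ^+ n.
    rewrite /e ComplexField.Normc.normcM normcX normc_dilation_arg// nr.
    by rewrite ler_piMl ?exprn_ge0//; exact: nt.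
  have es x : series (fun n => e n x) @ \oo --> S%:C^-1 * dilation h r x.
    have -> : series (fun n => e n x) =
        fun n => S%:C^-1 * series (fun n => taylor h n * (r%:C * val x) ^+ n) n.
      apply/funext => n; rewrite /series/= mulr_sumr; apply: eq_bigr => k _.
      by rewrite /e -mulrA.
    by apply: cvgMl_tmp; apply: taylor_cvg; rewrite normc_dilation_arg.
  have rC1 : normc (r%:C : C) < 1 by rewrite nr.
  have := cmean_L1_series_kernel LgS rC1 ce ne es.
  have -> : (fun x => g x * S%:C * (S%:C^-1 * dilation h r x)) =
      (fun x => g x * dilation h r x).
    by apply/funext => x; rewrite mulrA mulfK.
  have -> : (fun n => cmean (fun x => g x * S%:C * e n x)) = fun=> 0.
    apply/funext => n; rewrite eX -[RHS](mul0r (taylor h n * r%:C ^+ n)).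
    have Lgx : L1 (fun x => g x * val x ^+ n).
      have cX := L1_cmeasurable (L1_continuous (@circle_continuous_exp R n)).
      by apply: (L1M_bounded (M := 1) Lg cX); apply: ae_circleW => x; rewrite normc_circleX.
    rewrite -(H10_cmean n H10g) -(cmeanZ _ Lgx); congr cmean; apply/funext => x.
    rewrite -[in RHS](mulfK SC0 (g x)); ring.
  move=> cv; apply: cvg_unique cv _; first exact: norm_hausdorff.
  rewrite (_ : series _ = fun=> 0); first exact: cvg_cst.
  by apply/funext => n; rewrite /series/= big1.
pose r (n : nat) : R := 1 - harmonic n.
have r0 n : 0 <= r n by rewrite subr_ge0 invf_le1// ler1n.
have r1 n : r n < 1 by rewrite gtrBl invr_gt0.
have rc : r @ \oo --> (1 : R).
  by have := cvgB (cvg_cst (1 : R)) (@cvg_harmonic R); rewrite subr0; exact.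
have rcv : r @ \oo --> (1 : R)^'-.
  move=> A /= Ap; have rA : \forall n \near \oo, r n < 1 -> A (r n) by exact: rc Ap.
  by change (\forall n \near \oo, A (r n)); apply: filterS rA => n /(_ (r1 n)).
rewrite (pairing_boundary_function _ hu).
have Ld n : L1 (dilation h (r n)) by apply: L1_continuous; exact: dilation_continuous.
have H : cmean (fun x => g x * dilation h (r n) x) @[n --> \oo] --> cmean (fun x => g x * u x).
  apply: (dominated_cmean (H := fun x => supnorm h * normc (g x))).
  - by move=> n; exact: cmeasurableM (L1_cmeasurable Lg) (L1_cmeasurable (Ld n)).
  - exact: cmeasurableM (L1_cmeasurable Lg) (L1_cmeasurable Lu).
  - exact: rintegrableZ (L1_normc Lg).
  - apply: ae_circleS (boundary_function_radial hu) => x ux.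
    by apply: cvgMl_tmp; apply: cvg_comp rcv ux.
  - apply: ae_circleW => x n; rewrite ComplexField.Normc.normcM mulrC.
    by rewrite ler_wpM2r ?normc_ge0//; exact: normc_dilation.
move: H; rewrite (_ : (fun n => cmean _) = fun=> 0); last by apply/funext => n; exact: dil0.
by move=> H; apply: cvg_unique H (cvg_cst _); exact: norm_hausdorff.
Qed.

End Evaluation.

(** * The synthesis operator *)

Section Synthesis.
Variables (R : realType) (beta : nat -> Hinf R) (M : R).
Local Notation C := R[i].
Hypothesis betaM : forall (z : disk R) n, series (fun k => normc (beta k z)) n <= M.

Lemma synthesis_bound_ge0 : 0 <= M.
Proof.
have n0 : normc (0 : C) < 1 by rewrite ComplexField.Normc.normc0.
have [d _] := diskP n0.
by apply: le_trans (betaM d 0%N); rewrite /series/= big_geq.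
Qed.

(** The bound is kept for finite partial sums: these pass to radial limits, and one null set serves
    all n. *)
Lemma boundary_functions : exists u : nat -> circle R -> C,
  (forall n, boundary_function (beta n) (u n)) /\
  ae_circle (fun x => forall n, series (fun k => normc (u k x)) n <= M).
Proof.
have [u hu] := choice (fun n => boundary_function_exists (beta n)).
exists u; split=> //.
have := ae_circle_forall (fun n => boundary_function_radial (hu n)).
apply: ae_circleS => x ux n.
have cv : series (fun k => normc (extension (beta k) (r%:C * val x))) n @[r --> (1 : R)^'-] -->
    series (fun k => normc (u k x)) n.
  rewrite /series/=; elim: n => [|n IH].
    by rewrite big_geq//; under eq_fun do rewrite big_geq//; exact: cvg_cst.
  rewrite big_nat_recr//=; under eq_fun do rewrite big_nat_recr//=.
  by apply: cvgD IH _; apply: cvgc_norm; exact: ux.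
apply: (closed_cvg (fun y => y <= M) (@closed_le R M) _ _ cv).
have h0 : (0 : R) < 1 by [].
apply: filterS (filterI (nbhs_left_ge h0) (nbhs_left_lt (1 : R))) => r [r0 r1].
have rx : normc (r%:C * val x) < 1 by rewrite normc_dilation_arg.
have [d dr] := diskP rx; rewrite -dr.
by under eq_fun do rewrite extensionE; exact: betaM.
Qed.

Lemma pairing_series_le (f : circle R -> C) n : L1 f ->
  series (fun k => normc (pairing f (beta k))) n <= M * L1norm f.
Proof.
move=> Lf; have [u [hu uM]] := boundary_functions.
have Lfu k := L1_boundary_function (hu k) Lf.
apply: (@le_trans _ _ (series (fun k => L1norm (fun x => f x * u k x)) n)).
  apply: ler_sum => k _; rewrite (pairing_boundary_function _ (hu k)).
  exact: normc_cmean (Lfu k).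
have iF m : rintegrable (fun x => series (fun k => normc (f x * u k x)) m).
  rewrite /series/=; elim: m => [|m IH].
    by under eq_fun do rewrite big_geq//; exact: rintegrable_cst.
  under eq_fun do rewrite big_nat_recr//=.
  exact: rintegrableD IH (L1_normc (Lfu m)).
have -> : series (fun k => L1norm (fun x => f x * u k x)) n =
    mean (fun x => series (fun k => normc (f x * u k x)) n).
  rewrite /series/=; elim: n => [|n IH].
    by rewrite big_geq//; under [in RHS]eq_fun do rewrite big_geq//; rewrite mean_cst.
  rewrite big_nat_recr//= IH; under [in RHS]eq_fun do rewrite big_nat_recr//=.
  by rewrite (meanD (iF n) (L1_normc (Lfu n))).
rewrite /L1norm -(meanZ _ (L1_normc Lf)); apply: le_mean => //.
  exact: rintegrableZ (L1_normc Lf).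
apply: ae_circleS uM => x ux; rewrite mulrC.
apply: le_trans (ler_wpM2l (normc_ge0 _) (ux n)).
rewrite /series/= mulr_sumr; apply: ler_sum => k _.
by rewrite ComplexField.Normc.normcM.
Qed.

(** One [g] has to serve all [f]: it is first tested on Cauchy and Poisson kernels, to find the
    function in the disk, and then on general [f]. *)
Lemma pairing_synthesis (c : linf R) : exists g : circle R -> C, L1 g /\
  forall f, L1 f -> series (fun n => c n * pairing f (beta n)) @ \oo -->
    cmean (fun x => f x * g x).
Proof.
have [u [hu uM]] := boundary_functions.
have M0 := synthesis_bound_ge0.
have cu : ae_circle (fun x => forall n, series (fun k => normc (c k * u k x)) n <= supnorm c * M).
  apply: ae_circleS uM => x ux n.
  apply: le_trans (ler_wpM2l (supnorm_ge0 c) (ux n)).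
  rewrite /series/= mulr_sumr; apply: ler_sum => k _.
  by rewrite ComplexField.Normc.normcM ler_wpM2r ?normc_ge0// le_supnorm.
have nc (k : nat) x : 0 <= normc (c k * u k x) by exact: normc_ge0.
have Lu k : L1 (u k) by have [] := hu k.
have Luc k : L1 (fun x => u k x * c k) by exact: L1Z.
pose g x := limn (series (fun k => c k * u k x)).
have gcv : ae_circle (fun x => series (fun k => c k * u k x) @ \oo --> g x).
  apply: ae_circleS cu => x cx; apply: abs_cvg_cseries.
  by have [] := cvg_nnseries_le (fun k => nc k x) cx.
have gb : ae_circle (fun x => normc (g x) <= supnorm c * M).
  apply: ae_circleS cu => x cx; have [cv le] := cvg_nnseries_le (fun k => nc k x) cx.
  exact: le_trans (normc_lim_series cv) le.
have [g' mg' gg'] : exists2 g', cmeasurable g' & ae_circle (fun x => g x = g' x).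
  apply: cmeasurable_ae_cvg gcv => n; apply: cmeasurable_series => k.
  by have := L1_cmeasurable (Luc k); under eq_fun do rewrite mulrC.
have cg' : ae_circle (fun x => series (fun k => c k * u k x) @ \oo --> g' x).
  by apply: ae_circleS2 gcv gg' => x cx <-.
have gb' : ae_circle (fun x => normc (g' x) <= supnorm c * M).
  by apply: ae_circleS2 gb gg' => x gx <-.
exists g'; split; first exact: L1_bounded mg' gb'.
move=> f Lf; have Lfu k := L1_boundary_function (hu k) Lf.
have Lfuc k : L1 (fun x => f x * u k x * c k) by exact: L1Z.
have -> : series (fun n => c n * pairing f (beta n)) =
    fun n => cmean (fun x => series (fun k => f x * u k x * c k) n).
  apply/funext => n; rewrite cmean_series//; congr (series _ n); apply/funext => k.
  by rewrite (pairing_boundary_function _ (hu k)) mulrC (cmeanZ _ (Lfu k)).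
have fE x n : series (fun k => f x * u k x * c k) n = f x * series (fun k => c k * u k x) n.
  by rewrite /series/= mulr_sumr; apply: eq_bigr => k _; rewrite -mulrA [u k x * _]mulrC.
apply: (dominated_cmean (H := fun x => supnorm c * M * normc (f x))).
- by move=> n; apply: cmeasurable_series => k; exact: L1_cmeasurable (Lfuc k).
- exact: cmeasurableM (L1_cmeasurable Lf) mg'.
- exact: rintegrableZ (L1_normc Lf).
- apply: ae_circleS cg' => x cx; under eq_fun do rewrite fE.
  by apply: cvgMl_tmp; exact: cx.
- apply: ae_circleS cu => x cx n; rewrite fE ComplexField.Normc.normcM mulrC.
  by rewrite ler_wpM2r ?normc_ge0//; exact: le_trans (normc_series_le _ _) (cx n).
Qed.

Lemma synthesis (c : linf R) : exists h : Hinf R,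
  [/\ forall z, series (fun n => c n * beta n z) @ \oo --> h z,
      forall f, L1 f -> series (fun n => c n * pairing f (beta n)) @ \oo --> pairing f h &
      supnorm h <= M * supnorm c].
Proof.
have [g [Lg cg]] := pairing_synthesis c.
have M0 := synthesis_bound_ge0.
have cb z n : series (fun k => normc (c k * beta k z)) n <= M * supnorm c.
  apply: le_trans (ler_wpM2r (supnorm_ge0 c) (betaM z n)).
  rewrite /series/= mulr_suml; apply: ler_sum => k _.
  by rewrite ComplexField.Normc.normcM mulrC ler_wpM2l ?normc_ge0// le_supnorm.
have cn z k : 0 <= normc (c k * beta k z) by exact: normc_ge0.
pose s (z : disk R) : C := limn (series (fun n => c n * beta n z)).
have sb z : normc (s z) <= M * supnorm c.
  have [cv le] := cvg_nnseries_le (cn z) (cb z).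
  exact: le_trans (normc_lim_series cv) le.
have scv z : series (fun n => c n * beta n z) @ \oo --> s z.
  by apply: abs_cvg_cseries; have [] := cvg_nnseries_le (cn z) (cb z).
(* Any kernel that evaluates the [beta n] at z also represents [s]. The Cauchy kernel yields
   analyticity of [s], and the Poisson kernel identifies [g] as its boundary function. *)
have sker (k : circle R -> C) z : L1 k -> (forall n, pairing k (beta n) = beta n z) ->
    s z = cmean (fun x => k x * g x).
  move=> Lk kb; have := cg k Lk; under eq_fun do rewrite kb.
  by apply: cvg_unique (scv z); exact: norm_hausdorff.
have sK z : s z = cmean (fun x => g x * cauchy_kernel (val z) x).
  have Lk := L1_continuous (cauchy_kernel_continuous (normc_disk z)).
  rewrite (sker _ z Lk); first by congr cmean; apply/funext => x; exact: mulrC.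
  by move=> n; rewrite pairing_cauchy_kernel ?extensionE//; exact: normc_disk.
have sP z : s z = cmean (fun x => g x * (poisson (val z) x)%:C).
  have Lk := L1_continuous (poisson_continuous (normc_disk z)).
  rewrite (sker _ z Lk); first by congr cmean; apply/funext => x; exact: mulrC.
  by move=> n; rewrite pairing_poisson ?extensionE//; exact: normc_disk.
have s_bounded : s \in @bounded_pred R (disk R) by apply/asboolP; exists (M * supnorm c).
have s_analytic : BFun s_bounded \in @analytic_pred R.
  apply/asboolP => z0.
  exists (fun n => cmean (fun x => g x * cauchy_kernel (val z0) x *
    ((val x)^-1 * cauchy_kernel (val z0) x) ^+ n)), (1 - normc (val z0)).
  split=> [|z zz0]; first by rewrite subr_gt0; exact: normc_disk.
  rewrite -[X in _ --> X]/(s z) sK.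
  exact: cauchy_transform_expansion Lg (normc_disk z0) zz0.
exists (HinfFun s_analytic); split.
- exact: scv.
- move=> f Lf; rewrite (pairing_cmean _ Lg); first exact: cg.
  by move=> z z1; have [d <-] := diskP z1; rewrite extensionE -sP.
- by apply: supnorm_le => [|z]; [rewrite mulr_ge0// supnorm_ge0|exact: sb].
Qed.

End Synthesis.

(** * Continuity for the weak* topologies *)

Section WeakStar.
Variable R : realType.
Local Notation C := R[i].

Lemma initial_ptws_continuous (I : Type) (X : topologicalType) (Y : choiceType)
    (w : Y -> {ptws I -> C}) (f : X -> Y) :
  (forall i, continuous (fun x => w (f x) i)) ->
  continuous (f : X -> initial_topology w).
Proof.
move=> cf; apply: continuous_comp_initial => x; apply/cvg_sup => i.
exact: (@continuous_comp_initial (I -> C) X C (fun g => g i) (w \o f) (cf i) x).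
Qed.

Lemma initial_ptws_coordinate (I : Type) (Y : choiceType) (w : Y -> {ptws I -> C}) (i : I) :
  continuous ((fun y => w y i) : initial_topology w -> C).
Proof.
move=> y; have wy := @initial_continuous Y {ptws I -> C} w y.
have /cvg_sup/(_ i) wyi := wy.
have pi := @initial_continuous (I -> C) C (fun g => g i) (w y).
move=> A /pi /wyi; apply; apply: fmap_filter; exact: (@nbhs_filter (initial_topology w) y).
Qed.

Lemma pairing_wstar_continuous (f : circle R -> C) : L1 f ->
  continuous (pairing f : Hinf_wstar R -> C).
Proof.
move=> Lf; have Lf' : f \in @L1 R by exact/mem_set.
exact: (@initial_ptws_coordinate (@L1 R) (Hinf R)
  (fun h : Hinf R => (fun f : @L1 R => pairing (val f) h) : {ptws @L1 R -> C})
  (SigSub Lf')).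
Qed.

Lemma Hinf_wstar_continuous (X : topologicalType) (T : X -> Hinf R) :
  (forall f, L1 f -> continuous (fun x => pairing f (T x))) ->
  continuous (T : X -> Hinf_wstar R).
Proof.
move=> cT; apply: initial_ptws_continuous => f; apply: cT; exact: set_valP.
Qed.

Lemma l1_wstar_continuous (a : l1 R) :
  continuous ((fun c => limn (series (fun n => a n * c n))) : linf_wstar R -> C).
Proof.
exact: (@initial_ptws_coordinate (l1 R) (linf R)
  (fun c : linf R => (fun a : l1 R => limn (series (fun n => a n * c n))) : {ptws l1 R -> C}) a).
Qed.

Lemma linf_wstar_continuous (X : topologicalType) (T : X -> linf R) :
  (forall a : l1 R, continuous (fun x => limn (series (fun n => a n * T x n)))) ->
  continuous (T : X -> linf_wstar R).
Proof. by move=> cT; exact: initial_ptws_continuous. Qed.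

Lemma restr_wstar_continuous (b : nat -> disk R) :
  continuous (restr b : Hinf_wstar R -> linf_wstar R).
Proof.
apply: linf_wstar_continuous => a; have [f [Lf _ fb]] := point_mass_series a b.
have -> : (fun h : Hinf_wstar R => limn (series (fun n => a n * restr b h n))) = pairing f.
  by apply/funext => h; apply: cvg_lim (fb h); exact: norm_hausdorff.
exact: pairing_wstar_continuous.
Qed.

End WeakStar.

(** * Functionals and norm of the predual *)

Section Predual.
Variable R : realType.
Local Notation C := R[i].

Lemma limn_series_delta (f d : nat -> C) k : (forall n, d n = (n == k)%:R) ->
  series (fun n => f n * d n) @ \oo --> f k.
Proof.
move=> dE; rewrite (_ : (fun n => f n * d n) = fun n => (n == k)%:R * f k).
  exact: cvg_series_delta.
apply/funext => n; rewrite dE; case: eqVneq => [->|_]; first by rewrite mulrC.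
by rewrite mulr0 mul0r.
Qed.

Lemma l1_linf_cvg (a : l1 R) (c : linf R) : cvgn (series (fun n => a n * c n)).
Proof.
apply: abs_cvg_cseries.
have : cvgn (series (fun n => supnorm c * normc (a n))).
  exact: is_cvg_seriesZ (@l1_summable R a).
apply: series_le_cvg => n; first exact: normc_ge0.
  by rewrite mulr_ge0 ?supnorm_ge0 ?normc_ge0.
by rewrite ComplexField.Normc.normcM mulrC ler_wpM2r ?normc_ge0 ?le_supnorm.
Qed.

Definition point_functional (b : nat -> disk R) (E : set (Hinf R)) (a : l1 R) : E -> C :=
  fun h => limn (series (fun n => a n * (val h : Hinf R) (b n))).

Lemma point_functional_linear b E : linear (@point_functional b E).
Proof.
move=> k a a'; apply/funext => h.
rewrite -[RHS]/(k * point_functional b a h + point_functional b a' h).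
apply: cvg_lim; first exact: norm_hausdorff.
have ca := @l1_linf_cvg a (restr b (val h)); have ca' := @l1_linf_cvg a' (restr b (val h)).
have kca := cvgD (cvgMl_tmp (a := k) ca) ca'.
rewrite (_ : series _ = fun n => k * series (fun n => a n * restr b (val h) n) n +
  series (fun n => a' n * restr b (val h) n) n); first exact: kca.
apply/funext => n; rewrite /series/= mulr_sumr -big_split/=; apply: eq_bigr => i _.
by rewrite mulrDl mulrA.
Qed.

HB.instance Definition _ b (E : set (Hinf R)) := GRing.isLinear.Build C (l1 R) (E -> C) *:%R
  (@point_functional b E) (@point_functional_linear b E).

Lemma pairing_addr_H10 (f g : circle R -> C) (h : Hinf R) : L1 f -> H10 g ->
  pairing (f + g) h = pairing f h.
Proof.
move=> Lf H10g; have [[Lg _] _] := H10g; have [u hu] := boundary_function_exists h.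
have /(congr1 (fun x => pairing f h + x)) := H10_pairing h H10g; rewrite addr0 => <-.
rewrite !(pairing_boundary_function _ hu).
rewrite -(cmeanD (L1_boundary_function hu Lf) (L1_boundary_function hu Lg)).
by congr cmean; apply/funext => x; rewrite -mulrDl.
Qed.

Lemma H10_0 : H10 (0 : circle R -> C).
Proof.
have z (k : circle R -> C) : cmean (fun x => (0 : circle R -> C) x * k x) = 0.
  by rewrite -[RHS](@cmean_cst R 0); congr cmean; apply/funext => x; rewrite mul0r.
split; last exact: z.
split=> [|n _]; last exact: z.
exact: L1_continuous (@circle_continuous_cst R 0).
Qed.

Lemma L1H10_norm_le (f : circle R -> C) : L1H10_norm f <= L1norm f.
Proof.
apply: ge_inf; first by exists 0 => _ [g _ <-]; exact: L1norm_ge0.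
by exists 0; [exact: H10_0|rewrite addr0].
Qed.

Lemma L1H10_norm_ge0 (f : circle R -> C) : 0 <= L1H10_norm f.
Proof.
apply: lb_le_inf; first by exists (L1norm (f + 0)), 0 => //; exact: H10_0.
by move=> _ [g _ <-]; exact: L1norm_ge0.
Qed.

Lemma predual_norm_le (E : set (Hinf R)) (phi : E -> C) f : L1 f ->
  (forall h, phi h = pairing f (val h)) -> predual_norm E phi <= L1norm f.
Proof.
move=> Lf phif; apply: le_trans (L1H10_norm_le f).
apply: ge_inf; first by exists 0 => _ [g _ <-]; exact: L1H10_norm_ge0.
by exists f.
Qed.

(** The double infimum, over representatives f and over g in [H10], collapses: f + g again
    represents [phi]. Membership in the predual keeps the infimum from ranging over the empty
    set. *)
Lemma le_predual_norm (E : set (Hinf R)) (phi : E -> C) (y : R) : predual E phi ->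
  (forall f, L1 f -> (forall h, phi h = pairing f (val h)) -> y <= L1norm f) ->
  y <= predual_norm E phi.
Proof.
move=> [f0 Lf0 phif0] yf; apply: lb_le_inf; first by exists (L1H10_norm f0), f0.
move=> _ [f [Lf phif] <-]; apply: lb_le_inf.
  by exists (L1norm (f + 0)), 0 => //; exact: H10_0.
move=> _ [g H10g <-]; have [[Lg _] _] := H10g; apply: yf; first exact: L1D.
by move=> h; rewrite pairing_addr_H10.
Qed.

(** The equation is tested scalar by scalar, so only the Hausdorff property of the complex plane
    enters, not that of the weak* topology. *)
Lemma Hinf_wstar_closed_equalizer (phi psi : (circle R -> C) -> Hinf R -> C) :
  (forall f, L1 f -> continuous (phi f : Hinf_wstar R -> C)) ->
  (forall f, L1 f -> continuous (psi f : Hinf_wstar R -> C)) ->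
  @closed (Hinf_wstar R) [set h | forall f, L1 f -> phi f h = psi f h].
Proof.
move=> cphi cpsi.
pose d f : Hinf_wstar R -> C := fun h => phi f h - psi f h.
have -> : [set h | forall f, L1 f -> phi f h = psi f h] =
    \bigcap_(f in @L1 R) (d f @^-1` [set 0]) :> set (Hinf_wstar R).
  apply/seteqP; split=> h /= hf f Lf.
    by rewrite /d /= hf// subrr.
  by apply/eqP; rewrite -subr_eq0; apply/eqP; exact: hf Lf.
apply: closed_bigI => f Lf; apply: preimage_closed.
  move=> h _; have c1 := cphi f Lf h; have c2 := cpsi f Lf h; exact: (cvgB c1 c2).
apply: accessible_closed_set1; apply: hausdorff_accessible; exact: norm_hausdorff.
Qed.

Lemma lipschitz_continuous_norm (U V : normedModType C) (f : U -> V) (k : R) :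
  0 <= k -> (forall x y, `|f x - f y| <= k%:C * `|x - y|) -> continuous f.
Proof.
move=> k0 kf x; apply/cvgrPdist_lt => e e0.
have k1 : (0 : C) < (k + 1)%:C by rewrite -[0]/((0 : R)%:C) ltcR ltr_wpDl.
have ek : 0 < e / (k + 1)%:C by rewrite divr_gt0.
have idx : (id : U -> U) @ x --> x by exact: cvg_id.
move/cvgrPdist_lt : idx => /(_ _ ek) near_x.
apply: filterS near_x => y /= xy; apply: le_lt_trans (kf x y) _.
rewrite ltr_pdivlMr// mulrC in xy; apply: le_lt_trans xy.
by rewrite ler_wpM2r// lecR lerDl.
Qed.

End Predual.

(** * Homeomorphisms, closed range and bases *)

Section SynthesisOperator.
Variables (R : realType) (b : nat -> disk R) (M : R) (beta : nat -> Hinf R).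
Local Notation C := R[i].
Hypothesis beta_delta : forall j k : nat, beta k (b j) = (k == j)%:R.
Hypothesis betaM : forall (z : disk R) n, series (fun k => normc (beta k z)) n <= M.

Variable T : {linear linf R -> Hinf R}.
Hypothesis TE : forall (c : linf R) z, series (fun n => c n * beta n z) @ \oo --> T c z.
Hypothesis pairingT : forall (c : linf R) f, L1 f ->
  series (fun n => c n * pairing f (beta n)) @ \oo --> pairing f (T c).
Hypothesis supnormT : forall c : linf R, supnorm (T c) <= M * supnorm c.
Let E : set (Hinf R) := range T.

Lemma restr_synthesis : cancel T (restr b).
Proof.
move=> c; apply/val_inj/funext => j /=.
apply: cvg_unique (@TE c (b j)) _; first exact: norm_hausdorff.
by apply: limn_series_delta => n.
Qed.

Lemma synthesis_unit n : T (linf_unit R n) = beta n.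
Proof.
apply/val_inj/val_inj/funext => z /=.
apply: cvg_unique (@TE (linf_unit R n) z) _; first exact: norm_hausdorff.
under [X in series X]eq_fun do rewrite mulrC.
exact: limn_series_delta.
Qed.

Lemma synthesis_range h : E h -> T (restr b h) = h.
Proof. by move=> [c _ <-]; rewrite restr_synthesis. Qed.

Lemma pairing_l1 f : L1 f -> exists a : l1 R, (forall n, a n = pairing f (beta n)) /\
  l1norm a <= M * L1norm f.
Proof.
move=> Lf; pose p n := pairing f (beta n).
have [cp le] := @cvg_nnseries_le R (fun n => normc (p n)) (M * L1norm f)
  (fun n => normc_ge0 _) (fun n => pairing_series_le betaM n Lf).
have sp : p \in @summable_pred R by apply/asboolP.
by exists (L1Seq sp).
Qed.

Lemma pairing_synthesis_continuous f : L1 f ->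
  continuous ((fun c => pairing f (T c)) : linf_wstar R -> C).
Proof.
move=> Lf; have [a [aE _]] := pairing_l1 Lf.
have -> : (fun c => pairing f (T c)) = (fun c : linf_wstar R => limn (series (fun n => a n * c n))).
  apply/funext => c; apply/esym/cvg_lim; first exact: norm_hausdorff.
  by under [X in series X]eq_fun do rewrite aE mulrC; exact: pairingT.
exact: l1_wstar_continuous.
Qed.

Lemma synthesis_homeo_wstar : @homeo_onto (linf_wstar R) (Hinf_wstar R) T E (restr b).
Proof.
split=> //; first by apply: Hinf_wstar_continuous => f; exact: pairing_synthesis_continuous.
  exact: restr_synthesis.
by apply: continuous_subspaceT; exact: restr_wstar_continuous.
Qed.

Lemma normrT c : `|T c| <= M%:C * `|c|.
Proof.
rewrite -[`|T c|]/((supnorm (T c))%:C) -[`|c|]/((supnorm c)%:C) -rmorphM/= lecR.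
exact: supnormT.
Qed.

Lemma normr_restr (h : Hinf R) : `|restr b h| <= `|h|.
Proof.
rewrite -[`|h|]/((supnorm h)%:C) -[`|_|]/((supnorm (restr b h))%:C) lecR.
by apply: supnorm_le => [|n]; [exact: supnorm_ge0|exact: (@le_supnorm R _ (hinf_fun h) (b n))].
Qed.

Lemma synthesis_homeo_norm : @homeo_onto (linf R) (Hinf R) T E (restr b).
Proof.
split=> //.
- apply: (@lipschitz_continuous_norm R _ _ T M (synthesis_bound_ge0 betaM)) => c d.
  by rewrite -linearB; exact: normrT.
- exact: restr_synthesis.
- apply: continuous_subspaceT.
  apply: (@lipschitz_continuous_norm R _ _ (restr b) 1 ler01) => h k.
  rewrite mul1r; have -> : restr b h - restr b k = restr b (h - k) by exact: val_inj.
  exact: normr_restr.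
Qed.

Lemma synthesis_range_closed : @closed (Hinf_wstar R) E.
Proof.
have -> : E = [set h | forall f, L1 f ->
    pairing f (T (restr b h)) = pairing f h] :> set (Hinf_wstar R).
  apply/seteqP; split=> [h Eh f _|h hf]; first by rewrite synthesis_range.
  exists (restr b h) => //; apply/val_inj/val_inj/funext => z /=.
  have z1 := normc_disk z.
  (* Poisson kernels as test functions recover the value at z on both sides. *)
  have := hf _ (L1_continuous (poisson_continuous z1)).
  by rewrite !pairing_poisson// !extensionE.
apply: (@Hinf_wstar_closed_equalizer R (fun f h => pairing f (T (restr b h)))) => f Lf.
  move=> h; have c1 := @restr_wstar_continuous R b h.
  by apply: (@cvg_comp _ _ _ (restr b) (fun c => pairing f (T c)) _ _ _ c1);
    exact: (pairing_synthesis_continuous Lf).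
exact: pairing_wstar_continuous.
Qed.

Lemma synthesis_l1_basis : l1_basis (predual E) (predual_norm E) (fun n => evaluation E (b n)).
Proof.
pose Phi : {linear l1 R -> (E -> C)} := @point_functional R b E.
have PhiE (a : l1 R) f (h : E) :
    (forall g : Hinf R, series (fun n => a n * g (b n)) @ \oo --> pairing f g) ->
    Phi a h = pairing f (val h).
  by move=> fa; apply: cvg_lim (fa (val h)); exact: norm_hausdorff.
have Ebeta n : beta n \in E by apply/mem_set; exists (linf_unit R n); rewrite ?synthesis_unit.
(* The [beta n] lie in E and act as coordinate functionals; injectivity and the lower norm bound
   both rest on this. *)
have Phi_beta (a : l1 R) n : Phi a (SigSub (Ebeta n)) = a n.
  apply: cvg_lim; first exact: norm_hausdorff.
  by apply: limn_series_delta => k /=; rewrite beta_delta eq_sym.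
have Phi_predual (a : l1 R) : predual E (Phi a).
  have [f [Lf _ fa]] := point_mass_series a b.
  by exists f => // h; exact: PhiE.
exists Phi; split.
- move=> a a' aa'; apply/val_inj/funext => n.
  by rewrite -[LHS]Phi_beta aa' Phi_beta.
(* On E every h is T (restr b h), so a functional induced by f has the coefficients
   [pairing f (beta n)], and these are summable. *)
- apply/seteqP; split=> [_ [a _ <-]//|phi [f Lf phif]].
  have [a [aE _]] := pairing_l1 Lf.
  exists a => //; apply/funext => h; rewrite phif.
  apply: cvg_lim; first exact: norm_hausdorff.
  have Eh : E (val h) by exact: set_valP.
  have := @pairingT (restr b (val h)) f Lf; rewrite synthesis_range//.
  by under [X in _ -> series X @ _ --> _]eq_fun do rewrite aE mulrC.
- exists 1 => a; rewrite mul1r -[`|a|]/((l1norm a)%:C) lecR.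
  have [f [Lf fa fP]] := point_mass_series a b.
  by apply: le_trans fa; apply: predual_norm_le => // h; exact: PhiE.
(* Every representative f of [Phi a] satisfies pairing f (beta n) = a n, so its L^1 norm times M
   bounds the norm of [a]. *)
- exists M => a; rewrite -[`|a|]/((l1norm a)%:C) lecR.
  (* At the point [b 0] the function [beta 0] alone already contributes 1. *)
  have M0 : 0 < M.
    have /lt_le_trans := (ltr01 : (0 : R) < 1); apply.
    have := betaM (b 0%N) 1%N; rewrite /series/= big_nat1 beta_delta eqxx.
    by rewrite ComplexField.Normc.normc1.
  rewrite mulrC -ler_pdivrMr//; apply: le_predual_norm => // f Lf fP.
  rewrite ler_pdivrMr// mulrC; have [a' [aE le]] := pairing_l1 Lf.
  suff -> : a = a' by [].
  by apply/val_inj/funext => n; rewrite -[LHS]Phi_beta fP -aE.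
- move=> n; apply/funext => h; apply: cvg_lim; first exact: norm_hausdorff.
  under [X in series X]eq_fun do rewrite mulrC.
  exact: limn_series_delta.
Qed.

End SynthesisOperator.

Theorem theorem3p5 (R : realType) (b : nat -> disk R) (M : R)
    (beta : nat -> Hinf R)
    (b_interpolating : interpolating b)
    (b_constant : interpolation_constant b M)
    (beta_delta : forall j k : nat, beta k (b j) = (k == j)%:R)
    (beta_sum : (ereal_sup (range (fun z : disk R =>
        \sum_(0 <= n <oo) (normc (beta n z))%:E)) <= M%:E)%E) :
  exists T : {linear linf R -> Hinf R},
    let E : set (Hinf R) := range T in
    (forall (c : linf R) (z : disk R),
       series (fun n => c n * beta n z) @ \oo --> T c z) /\
    [/\ @homeo_onto (linf_wstar R) (Hinf_wstar R) T E (restr b),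
        @homeo_onto (linf R) (Hinf R) T E (restr b),
        (forall c : linf R, `|T c| <= M%:C * `|c|) &
        (forall h : Hinf R, E h -> `|restr b h| <= `|h|)] /\
    [/\ @closed (Hinf_wstar R) E,
        l1_basis (predual E) (predual_norm E) (fun n => evaluation E (b n)) &
        linf_basis E beta].
Proof.
(* The extended-real supremum is traded for real bounds on finite partial sums, the form that
   survives radial limits. *)
have betaM (z : disk R) n : series (fun k => normc (beta k z)) n <= M.
  rewrite -lee_fin -sumEFin; apply: (@le_trans _ _ (\sum_(0 <= k <oo) (normc (beta k z))%:E)%E).
    by apply: nneseries_lim_ge => k _ _; rewrite lee_fin normc_ge0.
  by apply: le_trans beta_sum; apply: ereal_sup_ubound; exists z.
have [T0 hT0] := choice (synthesis betaM).
have T0E (c : linf R) (z : disk R) : series (fun n => c n * beta n z) @ \oo --> T0 c z.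
  by have [] := hT0 c.
have T0_linear : linear T0.
  move=> k c d; apply/val_inj/val_inj/funext => z.
  rewrite -[RHS]/(k * T0 c z + T0 d z).
  apply: cvg_unique (@T0E (k *: c + d) z) _; first exact: norm_hausdorff.
  rewrite (_ : series _ = fun n => k * series (fun n => c n * beta n z) n +
    series (fun n => d n * beta n z) n).
    exact: (cvgD (cvgMl_tmp (a := k) (@T0E c z)) (@T0E d z)).
  apply/funext => n; rewrite /series/= mulr_sumr -big_split/=; apply: eq_bigr => i _.
  by rewrite mulrA -mulrDl.
pose T : {linear linf R -> Hinf R} :=
  HB.pack T0 (GRing.isLinear.Build R[i] (linf R) (Hinf R) *:%R T0 T0_linear).
have pairingT (c : linf R) f : L1 f ->
    series (fun n => c n * pairing f (beta n)) @ \oo --> pairing f (T c).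
  by have [_ + _] := hT0 c; apply.
have supnormT (c : linf R) : supnorm (T c) <= M * supnorm c by have [] := hT0 c.
exists T; split; first exact: T0E.
split; split.
- exact: synthesis_homeo_wstar.
- exact: synthesis_homeo_norm.
- exact: normrT.
- by move=> h _; exact: normr_restr.
- exact: synthesis_range_closed.
- exact: synthesis_l1_basis.
- exists T, (restr b); split; first exact: synthesis_homeo_wstar.
  exact: synthesis_unit.
Qed.
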